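(* Let $d,l,\alpha_2,\alpha_3$ be integers with $d\ge 2$, $l\ge 1$, $2\le \alpha_2\le\alpha_3$ and $\gcd(\alpha_2,d)=\gcd(\alpha_2,\alpha_3)=1$, and let $$X=\{x+y(x^{d}+z^{\alpha_2})^{l}+t^{\alpha_3}=0\}\subset \mathbb{A}^4=\mathrm{Spec}(\mathbb{C}[x,y,z,t])$$ be the corresponding Koras-Russell threefold of the second kind. Let $\mathcal{A}$ be the subgroup of $\mathrm{Aut}(\mathbb{C}[x,z,t])$ whose elements fix $\mathbb{C}[x,z]$ (elementwise) and send $t$ to $t+(x^{d}+z^{\alpha_2})^{l}p(x,z)$ for some polynomial $p(x,z)\in\mathbb{C}[x,z]$. Then $$\mathrm{Aut}(X)\simeq \mathcal{A}\rtimes\mathbb{G}_m ,$$ and the group $\mathcal{A}$ is isomorphic to the additive group $(\mathbb{C}[x,z],+)$.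
   Context: The base field is $\mathbb{C}$. $\mathrm{Aut}(X)$ denotes the group $\mathrm{Aut}_{\mathbb{C}}(\mathbb{C}[X])$ of $\mathbb{C}$-algebra automorphisms of the coordinate ring $\mathbb{C}[X]=\mathbb{C}[x,y,z,t]/(x+y(x^{d}+z^{\alpha_2})^{l}+t^{\alpha_3})$, and $\mathrm{Aut}(\mathbb{C}[x,z,t])$ is the group of $\mathbb{C}$-algebra automorphisms of the polynomial ring. $\mathbb{G}_m=\mathbb{C}^*$ is the multiplicative group. The defining polynomial of $X$ is homogeneous for the linear $\mathbb{G}_m$-action on $\mathbb{A}^4$ $$\lambda\cdot(x,y,z,t)=(\lambda^{\alpha_2\alpha_3}x,\ \lambda^{-(dl-1)\alpha_2\alpha_3}y,\ \lambda^{d\alpha_3}z,\ \lambda^{\alpha_2}t),$$ so this action restricts to $X$, and it also acts on $\mathbb{C}[x,z,t]$ by $x\mapsto\lambda^{\alpha_2\alpha_3}x$, $z\mapsto\lambda^{d\alpha_3}z$, $t\mapsto\lambda^{\alpha_2}t$. The factor $\mathbb{G}_m$ in the semi-direct product is the one given by this action, with $\mathbb{G}_m$ acting on the normal factor $\mathcal{A}$ by conjugation in $\mathrm{Aut}(\mathbb{C}[x,z,t])$. *)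

(* Defs.v *)
From HB Require Import structures.
From mathcomp Require Import all_boot all_order all_algebra.
From mathcomp Require Import generic_quotient ring_quotient.
From mathcomp Require Import boolp reals complex mpoly.

Set Implicit Arguments.
Unset Strict Implicit.
Unset Printing Implicit Defensive.

Import GRing.Theory.

Local Open Scope ring_scope.
Local Open Scope quotient_scope.

Section QuotientAlgebra.
Variables (F : comNzRingType) (A : comAlgType F) (I : idealr A).
Local Notation Q := {ideal_quot I}.

Definition quot_scale (c : F) (u : Q) : Q := \pi_Q (c *: repr u).

Lemma pi_scale (c : F) (a : A) : \pi_Q (c *: a) = quot_scale c (\pi_Q a).
Proof.
apply/eqP; rewrite /quot_scale -Quotient.idealrBE -scalerBr -mulr_algl.
by apply: (@idealMr _ I); rewrite Quotient.idealrBE reprK.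
Qed.

Fact quot_scaleA c e (u : Q) :
  quot_scale c (quot_scale e u) = quot_scale (c * e) u.
Proof. by elim/quotW: u => a; rewrite -(pi_scale e) -2!pi_scale scalerA. Qed.

Fact quot_scale1 : left_id 1 quot_scale.
Proof. by elim/quotW => a; rewrite -pi_scale scale1r. Qed.

Fact quot_scaleDr : right_distributive quot_scale +%R.
Proof.
move=> c; elim/quotW=> a; elim/quotW=> b.
by rewrite -2!pi_scale -2!(raddfD (\pi_Q)) -pi_scale scalerDr.
Qed.

Fact quot_scaleDl (u : Q) : {morph quot_scale^~ u : c e / c + e}.
Proof.
elim/quotW: u => a c e.
by rewrite -3!pi_scale -(raddfD (\pi_Q)) scalerDl.
Qed.

HB.instance Definition _ := GRing.Zmodule_isLmodule.Build F Q
  quot_scaleA quot_scale1 quot_scaleDr quot_scaleDl.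

Fact quot_scaleAl (c : F) (u v : Q) : c *: (u * v) = c *: u * v.
Proof.
elim/quotW: u => a; elim/quotW: v => b.
have piZ e (p : A) : e *: \pi_Q p = \pi_Q (e *: p) by rewrite pi_scale.
by rewrite -(rmorphM (\pi_Q)) !piZ -(rmorphM (\pi_Q)) scalerAl.
Qed.

HB.instance Definition _ := GRing.Lmodule_isLalgebra.Build F Q quot_scaleAl.
HB.instance Definition _ := GRing.Lalgebra_isComAlgebra.Build F Q.

End QuotientAlgebra.

Section AlgebraAutomorphisms.
Variables (F : nzRingType) (A : algType F).

Record algAut := AlgAut {
  algAut_fun :> {lrmorphism A -> A};
  algAut_bij : bijective algAut_fun }.

HB.instance Definition _ := gen_eqMixin algAut.
HB.instance Definition _ := gen_choiceMixin algAut.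

Lemma lrmorphism_ext (f g : {lrmorphism A -> A}) : f =1 g -> f = g.
Proof.
move=> /funext.
case: f => f [[f1] [f2] [f3]]; case: g => g [[g1] [g2] [g3]] /= efg.
subst g; congr (GRing.LRMorphism.Pack (GRing.LRMorphism.Class _ _ _));
  congr (_ _); exact: Prop_irrelevance.
Qed.

Lemma algAutP (f g : algAut) : f =1 g -> f = g.
Proof.
case: f g => f fb [g gb] /= /lrmorphism_ext efg; subst g.
by congr AlgAut; exact: Prop_irrelevance.
Qed.

Definition algAut_one : algAut :=
  @AlgAut idfun (@Bijective _ _ idfun idfun (frefl _) (frefl _)).

(* The product f * g is the composite of algebra maps f \o g. *)
Definition algAut_mul (f g : algAut) : algAut :=
  @AlgAut (f \o g) (bij_comp (algAut_bij f) (algAut_bij g)).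

Lemma algAut_inv_ex (f : algAut) :
  exists g : algAut, cancel f g /\ cancel g f.
Proof.
have [g fK gK] := algAut_bij f.
pose gA := GRing.isZmodMorphism.Build A A g (can2_zmod_morphism fK gK).
pose gM := GRing.isMonoidMorphism.Build A A g (can2_monoid_morphism fK gK).
pose gS := GRing.isScalable.Build F A A *:%R g (can2_scalable fK gK).
pose g' : {lrmorphism A -> A} := HB.pack g gA gM gS.
by exists (@AlgAut g' (Bijective gK fK)).
Qed.

Definition algAut_inv (f : algAut) : algAut := sval (cid (algAut_inv_ex f)).

Lemma algAutK (f : algAut) : cancel f (algAut_inv f).
Proof. exact: (svalP (cid (algAut_inv_ex f))).1. Qed.

Lemma algAutVK (f : algAut) : cancel (algAut_inv f) f.
Proof. exact: (svalP (cid (algAut_inv_ex f))).2. Qed.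

Fact algAut_mulA : associative algAut_mul.
Proof. by move=> f g h; apply: algAutP. Qed.
Fact algAut_mul1 : left_id algAut_one algAut_mul.
Proof. by move=> f; apply: algAutP. Qed.
Fact algAut_1mul : right_id algAut_one algAut_mul.
Proof. by move=> f; apply: algAutP. Qed.
Fact algAut_mulV : left_inverse algAut_one algAut_inv algAut_mul.
Proof. by move=> f; apply: algAutP => x /=; rewrite algAutK. Qed.
Fact algAut_Vmul : right_inverse algAut_one algAut_inv algAut_mul.
Proof. by move=> f; apply: algAutP => x /=; rewrite algAutVK. Qed.

HB.instance Definition _ := isGroup.Build algAut
  algAut_mulA algAut_mul1 algAut_1mul algAut_mulV algAut_Vmul.

Lemma algAut1E (x : A) : (1%g : algAut) x = x. Proof. by []. Qed.
Lemma algAutME (f g : algAut) (x : A) : (f * g)%g x = f (g x).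
Proof. by []. Qed.

End AlgebraAutomorphisms.

Section MultiplicativeGroup.
Variable F : fieldType.

Record Gm := MkGm { Gm_val :> F; Gm_neq0 : Gm_val != 0 }.

HB.instance Definition _ := [isSub for Gm_val].
HB.instance Definition _ := [Choice of Gm by <:].

Definition Gm_one : Gm := MkGm (oner_neq0 F).
Definition Gm_mul (u v : Gm) : Gm := MkGm (mulf_neq0 (Gm_neq0 u) (Gm_neq0 v)).
Definition Gm_inv (u : Gm) : Gm := MkGm (invr_neq0 (Gm_neq0 u)).

Fact Gm_mulA : associative Gm_mul.
Proof. by move=> u v w; apply: val_inj; rewrite /= mulrA. Qed.
Fact Gm_mul1 : left_id Gm_one Gm_mul.
Proof. by move=> u; apply: val_inj; rewrite /= mul1r. Qed.
Fact Gm_1mul : right_id Gm_one Gm_mul.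
Proof. by move=> u; apply: val_inj; rewrite /= mulr1. Qed.
Fact Gm_mulV : left_inverse Gm_one Gm_inv Gm_mul.
Proof. by move=> u; apply: val_inj; rewrite /= mulVf ?Gm_neq0. Qed.
Fact Gm_Vmul : right_inverse Gm_one Gm_inv Gm_mul.
Proof. by move=> u; apply: val_inj; rewrite /= mulfV ?Gm_neq0. Qed.

HB.instance Definition _ := isGroup.Build Gm
  Gm_mulA Gm_mul1 Gm_1mul Gm_mulV Gm_Vmul.

End MultiplicativeGroup.

(* Each gact h is invertible, with inverse gact h^-1, so this is a group
   homomorphism H -> Aut(N). *)
Record groupAct (N H : groupType) := GroupAct {
  gact :> H -> N -> N;
  gactM : forall h, {morph gact h : a b / (a * b)%g};
  gact1l : forall a, gact 1%g a = a;
  gactMl : forall g h a, gact (g * h)%g a = gact g (gact h a) }.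

(* phi is a phantom parameter of the carrier; it determines the group law *)
Record semidirect (N H : groupType) (phi : groupAct N H) :=
  SemiDirect { sd_left : N; sd_right : H }.

Section SemidirectProduct.
Variables (N H : groupType) (phi : groupAct N H).

Lemma gact1 h : phi h 1%g = 1%g.
Proof.
by apply: (mulgI (phi h 1%g)); rewrite -gactM !mulg1.
Qed.

Lemma gactV h a : (phi h a^-1 = (phi h a)^-1)%g.
Proof.
by apply: (mulgI (phi h a)); rewrite -gactM !mulgV gact1.
Qed.

HB.instance Definition _ := gen_eqMixin (semidirect phi).
HB.instance Definition _ := gen_choiceMixin (semidirect phi).

Definition sd_one : semidirect phi := SemiDirect phi 1%g 1%g.
Definition sd_mul (u v : semidirect phi) : semidirect phi :=
  SemiDirect phi (sd_left u * phi (sd_right u) (sd_left v))%g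
             (sd_right u * sd_right v)%g.
Definition sd_inv (u : semidirect phi) : semidirect phi :=
  SemiDirect phi (phi (sd_right u)^-1 (sd_left u)^-1)%g (sd_right u)^-1%g.

Fact sd_mulA : associative sd_mul.
Proof.
by move=> [a g] [b h] [c k]; rewrite /sd_mul /= gactM gactMl !mulgA.
Qed.
Fact sd_mul1 : left_id sd_one sd_mul.
Proof. by move=> [a g]; rewrite /sd_mul /= gact1l !mul1g. Qed.
Fact sd_1mul : right_id sd_one sd_mul.
Proof. by move=> [a g]; rewrite /sd_mul /= gact1 !mulg1. Qed.
Fact sd_mulV : left_inverse sd_one sd_inv sd_mul.
Proof. by move=> [a g]; rewrite /sd_mul /= -gactM !mulVg gact1. Qed.
Fact sd_Vmul : right_inverse sd_one sd_inv sd_mul.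
Proof. by move=> [a g]; rewrite /sd_mul /= -gactMl !mulgV gact1l mulgV. Qed.

HB.instance Definition _ := isGroup.Build (semidirect phi)
  sd_mulA sd_mul1 sd_1mul sd_mulV sd_Vmul.

End SemidirectProduct.

Section KorasRussell.
Variables (F : fieldType) (d l a2 a3 : nat).

(* {mpoly F[4]} is F[x, y, z, t] with variables in this order. *)
Definition kr_poly : {mpoly F[4]} :=
  let x := 'X_(inord 0) in let y := 'X_(inord 1) in
  let z := 'X_(inord 2) in let t := 'X_(inord 3) in
  x + y * (x ^+ d + z ^+ a2) ^+ l + t ^+ a3.

(* The principal ideal (kr_poly) as a boolean predicate. *)
Definition kr_ideal : {pred {mpoly F[4]}} :=
  fun p => `[< exists q, p = q * kr_poly >].

Fact kr_ideal_closed : idealr_closed kr_ideal.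
Proof.
split.
- by apply/asboolP; exists 0; rewrite mul0r.
- (* kr_poly vanishes at the point (-1, 0, 0, 1), whatever the exponents *)
  apply/asboolP => -[q].
  move=> /(congr1 (meval (fun i : 'I_4 => nth 0 [:: -1; 0; 0; 1] i))).
  rewrite meval1 mevalM /kr_poly !(mevalD, mevalM, rmorphXn) /= !mevalXU.
  rewrite !inordK //= mul0r addr0 expr1n addNr mulr0 => /eqP.
  by rewrite oner_eq0.
- move=> p u v /asboolP[q ->] /asboolP[r ->]; apply/asboolP.
  by exists (p * q + r); rewrite mulrDl mulrA.
Qed.

HB.instance Definition _ :=
  isIdealr.Build {mpoly F[4]} kr_ideal kr_ideal_closed.

(* F[X] with the quotient F-algebra structure; kr_x ... kr_t are the classes of
   the variables. *)
Definition kr_ring : comAlgType F := {ideal_quot kr_ideal}.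

Definition kr_x : kr_ring := \pi_{ideal_quot kr_ideal} 'X_(inord 0).
Definition kr_y : kr_ring := \pi_{ideal_quot kr_ideal} 'X_(inord 1).
Definition kr_z : kr_ring := \pi_{ideal_quot kr_ideal} 'X_(inord 2).
Definition kr_t : kr_ring := \pi_{ideal_quot kr_ideal} 'X_(inord 3).

(* F[x, z, t] is {mpoly F[3]} with variables in this order, and its subring
   F[x, z] is the image of {mpoly F[2]} under xz_incl. *)
Definition xzt_x : {mpoly F[3]} := 'X_(inord 0).
Definition xzt_z : {mpoly F[3]} := 'X_(inord 1).
Definition xzt_t : {mpoly F[3]} := 'X_(inord 2).

Definition xz_incl (q : {mpoly F[2]}) : {mpoly F[3]} :=
  q \mPo [tuple xzt_x; xzt_z].

HB.instance Definition _ := GRing.LRMorphism.copy xz_incl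
  (comp_mpoly [tuple xzt_x; xzt_z] : {mpoly F[2]} -> {mpoly F[3]}).

Definition kr_A : {pred algAut {mpoly F[3]}} := fun f =>
  `[< (forall q : {mpoly F[2]}, f (xz_incl q) = xz_incl q) /\
      (exists p : {mpoly F[2]},
         f xzt_t = xzt_t + (xzt_x ^+ d + xzt_z ^+ a2) ^+ l * xz_incl p) >].

Lemma xz_incl_x : xz_incl 'X_(inord 0) = xzt_x.
Proof. by rewrite /xz_incl comp_mpolyXU inordK. Qed.

Lemma xz_incl_z : xz_incl 'X_(inord 1) = xzt_z.
Proof. by rewrite /xz_incl comp_mpolyXU inordK. Qed.

Lemma xz_incl_F :
  xz_incl (('X_(inord 0) ^+ d + 'X_(inord 1) ^+ a2) ^+ l) =
  (xzt_x ^+ d + xzt_z ^+ a2) ^+ l.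
Proof. by rewrite rmorphXn rmorphD !rmorphXn /= xz_incl_x xz_incl_z. Qed.

Fact kr_A_closed : group_closed kr_A.
Proof.
split=> [|f g /asboolP[fxz [p fp]] /asboolP[gxz [q gq]]]; apply/asboolP.
  by split=> //; exists 0; rewrite raddf0 mulr0 addr0.
have gVxz r : (g^-1)%g (xz_incl r) = xz_incl r.
  by rewrite -{1}gxz -algAutME mulVg.
split=> [r|]; first by rewrite algAutME gVxz fxz.
exists (p - q); rewrite algAutME.
have -> : (g^-1)%g xzt_t =
    xzt_t - (xzt_x ^+ d + xzt_z ^+ a2) ^+ l * xz_incl q.
  apply: (can_inj (algAutK g)); rewrite -algAutME mulgV algAut1E.
  by rewrite rmorphB /= gq -xz_incl_F -rmorphM gxz addrK.
rewrite rmorphB /= fp -xz_incl_F -!rmorphM /= fxz -addrA -rmorphB /=.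
by rewrite -mulrBr.
Qed.

Definition kr_A_group := {f : algAut {mpoly F[3]} | f \in kr_A}.

HB.instance Definition _ := SubChoice.on kr_A_group.
HB.instance Definition _ := SubChoice_isSubGroup.Build
  (algAut {mpoly F[3]}) kr_A kr_A_group kr_A_closed.

Definition torus_fun (u : Gm F) (p : {mpoly F[3]}) : {mpoly F[3]} :=
  p \mPo [tuple (u : F) ^+ (a2 * a3) *: xzt_x; (u : F) ^+ (d * a3) *: xzt_z;
                (u : F) ^+ a2 *: xzt_t].

HB.instance Definition _ u := GRing.LRMorphism.copy (torus_fun u)
  (comp_mpoly [tuple (u : F) ^+ (a2 * a3) *: xzt_x;
      (u : F) ^+ (d * a3) *: xzt_z; (u : F) ^+ a2 *: xzt_t]
    : {mpoly F[3]} -> {mpoly F[3]}).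

Lemma torus_fun_x u : torus_fun u xzt_x = (u : F) ^+ (a2 * a3) *: xzt_x.
Proof. by rewrite /torus_fun comp_mpolyXU inordK. Qed.
Lemma torus_fun_z u : torus_fun u xzt_z = (u : F) ^+ (d * a3) *: xzt_z.
Proof. by rewrite /torus_fun comp_mpolyXU inordK. Qed.
Lemma torus_fun_t u : torus_fun u xzt_t = (u : F) ^+ a2 *: xzt_t.
Proof. by rewrite /torus_fun comp_mpolyXU inordK. Qed.

Lemma mpoly_lrmorph_ext n (B : comAlgType F) (f g : {lrmorphism {mpoly F[n]} -> B}) :
  (forall i, f 'X_i = g 'X_i) -> f =1 g.
Proof.
move=> fg p; rewrite (mpolyE p) !linear_sum; apply: eq_bigr => m _ /=.
rewrite !linearZ /= mpolyXE_id !rmorph_prod; congr (_ *: _).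
by apply: eq_bigr => i _; rewrite !rmorphXn /= fg.
Qed.

Lemma mpoly3_ext (f g : {lrmorphism {mpoly F[3]} -> {mpoly F[3]}}) :
  f xzt_x = g xzt_x -> f xzt_z = g xzt_z -> f xzt_t = g xzt_t -> f =1 g.
Proof.
move=> fx fz ft; apply: mpoly_lrmorph_ext => -[[|[|[|//]]] i3].
- by have -> : Ordinal i3 = inord 0 by apply: val_inj; rewrite /= inordK.
- by have -> : Ordinal i3 = inord 1 by apply: val_inj; rewrite /= inordK.
- by have -> : Ordinal i3 = inord 2 by apply: val_inj; rewrite /= inordK.
Qed.

Lemma torus_funM u v : torus_fun (u * v)%g =1 torus_fun u \o torus_fun v.
Proof.
apply: mpoly3_ext => /=.
- by rewrite !torus_fun_x linearZ /= torus_fun_x scalerA -exprMn mulrC.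
- by rewrite !torus_fun_z linearZ /= torus_fun_z scalerA -exprMn mulrC.
- by rewrite !torus_fun_t linearZ /= torus_fun_t scalerA -exprMn mulrC.
Qed.

Lemma torus_fun1 : torus_fun 1%g =1 idfun.
Proof.
apply: mpoly3_ext => /=.
- by rewrite torus_fun_x expr1n scale1r.
- by rewrite torus_fun_z expr1n scale1r.
- by rewrite torus_fun_t expr1n scale1r.
Qed.

Fact torus_bij u : bijective (torus_fun u).
Proof.
by exists (torus_fun u^-1%g) => p;
  rewrite -[LHS]torus_funM (mulVg, mulgV) torus_fun1.
Qed.

Definition torus_aut (u : Gm F) : algAut {mpoly F[3]} :=
  @AlgAut F {mpoly F[3]} (torus_fun u) (torus_bij u).

Lemma torus_autM : {morph torus_aut : u v / (u * v)%g}.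
Proof. by move=> u v; apply: algAutP => p; rewrite /= torus_funM. Qed.

Lemma torus_aut1 : torus_aut 1%g = 1%g.
Proof. by apply: algAutP => p; rewrite /= torus_fun1. Qed.

Lemma torus_autV u : torus_aut u^-1%g = (torus_aut u)^-1%g.
Proof. by apply: (mulgI (torus_aut u)); rewrite -torus_autM !mulgV torus_aut1. Qed.

Lemma torus_xz u (q : {mpoly F[2]}) :
  exists q', torus_aut u (xz_incl q) = xz_incl q'.
Proof.
pose s := [tuple (u : F) ^+ (a2 * a3) *: ('X_(inord 0) : {mpoly F[2]});
                 (u : F) ^+ (d * a3) *: 'X_(inord 1)].
exists (q \mPo s).
apply: (mpoly_lrmorph_ext (f := torus_fun u \o xz_incl)
                          (g := xz_incl \o comp_mpoly s)) => -[[|[|//]] i2] /=.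
- have -> : Ordinal i2 = inord 0 by apply: val_inj; rewrite /= inordK.
  by rewrite xz_incl_x torus_fun_x comp_mpolyXU inordK // linearZ /= xz_incl_x.
- have -> : Ordinal i2 = inord 1 by apply: val_inj; rewrite /= inordK.
  by rewrite xz_incl_z torus_fun_z comp_mpolyXU inordK // linearZ /= xz_incl_z.
Qed.

Fact torus_normal u (f : algAut {mpoly F[3]}) :
  f \in kr_A -> (torus_aut u * f * (torus_aut u)^-1)%g \in kr_A.
Proof.
case/asboolP=> fxz [p fp]; apply/asboolP; split=> [q|].
  rewrite !algAutME -torus_autV; have [q' eq_q] := torus_xz u^-1%g q.
  by rewrite eq_q fxz -eq_q -algAutME -torus_autM mulgV torus_aut1.
have [p' pE] := torus_xz u p.
exists ((u : F) ^- a2 *: ((u : F) ^+ (d * a2 * a3 * l) *: p')).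
rewrite !algAutME -torus_autV /= torus_fun_t linearZ /= fp -xz_incl_F.
rewrite linearZ /= rmorphD rmorphM /= torus_fun_t [torus_fun u (xz_incl p)]pE.
rewrite xz_incl_F rmorphXn rmorphD !rmorphXn /= torus_fun_x torus_fun_z.
rewrite !exprZn -!exprM [(a2 * a3 * d)%N]mulnC mulnA.
rewrite [(d * a3 * a2)%N]mulnAC -scalerDr exprZn.
rewrite scalerDr scalerA exprVn mulVf ?expf_neq0 ?Gm_neq0 // scale1r.
by rewrite !linearZ /= -?scalerAl ?scalerAr -[in LHS]exprM.
Qed.

(* The factor Gm acts on A by conjugation inside Aut(F[x, z, t]). *)
Definition torus_conj (u : Gm F) (f : kr_A_group) : kr_A_group :=
  Sub (torus_aut u * val f * (torus_aut u)^-1)%g (torus_normal u (valP f)).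

Fact torus_conjM u : {morph torus_conj u : f g / (f * g)%g}.
Proof.
have vM (f g : kr_A_group) : val (f * g)%g = (val f * val g)%g by [].
by move=> f g; apply: val_inj; rewrite vM !SubK !mulgA mulgVK.
Qed.
Fact torus_conj1 f : torus_conj 1%g f = f.
Proof.
by apply: val_inj; rewrite !SubK torus_aut1 invg1 mulg1 mul1g.
Qed.
Fact torus_conjMl u v f : torus_conj (u * v)%g f = torus_conj u (torus_conj v f).
Proof.
by apply: val_inj; rewrite !SubK torus_autM invgM !mulgA.
Qed.

Definition torus_act : groupAct kr_A_group (Gm F) :=
  GroupAct torus_conjM torus_conj1 torus_conjMl.

End KorasRussell.

(* Main.v *)
Require Import Defs.
From HB Require Import structures.
From mathcomp Require Import all_boot all_order all_algebra.
From mathcomp Require Import generic_quotient ring_quotient fraction.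
From mathcomp Require Import zify ring.
From mathcomp Require Import boolp reals complex mpoly.

Set Implicit Arguments.
Unset Strict Implicit.
Unset Printing Implicit Defensive.

Import GRing.Theory Num.Theory.
Local Open Scope ring_scope.

(** Write A = C[x, z], F = x^d + z^a2 and B for the coordinate ring of X.  Since
    y = - (x + t^a3) / F^l, the ring B embeds in Frac(A)[t] ([iota]); it is a
    domain, and every automorphism of C[x, z, t] has at most one extension to B.

    The heart of the matter is that an automorphism of X preserves A.  This is
    deduced from [lnd_kernel]: the kernel of every nonzero locally nilpotent
    derivation D of B lies in A.  Filter B by the degree in t and, within a
    t-degree, by the weighted degree of the leading coefficient, x having weight
    a2 and z weight d.  Then D induces a homogeneous derivation gr D on the
    associated graded ring, where y F^l = - t^a3.  If gr D killed t, it would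
    kill y and F, hence x and z, because a sum of two powers with exponents at
    least 2 is killed only when both bases are ([nu_pham]); this is absurd.  If
    it killed y but not t, then every element of A that it does not kill would
    have so large an order of nilpotency that F could have smaller order than
    x^d and z^a2 only by cancellation, and homogeneity leads to a numerical
    contradiction.  So t and y both have positive order, and an element killed by
    D has a leading form free of t and y, which puts it in A.  The
    derivation t |-> F^l, y |-> - a3 t^(a3-1) of B kills A, so its conjugate by an
    automorphism s kills s(A); hence s(A) lies in A ([aut_xz_lr]).

    An automorphism s then sends t to al t + be with al and be in A, and al is a
    unit.  Comparing the coefficients in t of the image of the equation of X
    shows that s F is a multiple of F, that F^l divides be and that s x is
    congruent to a multiple of x modulo F^l.  An automorphism of A that scales F
    scales the Hamiltonian derivation of F, and this bounds the weighted degrees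
    of the images of x and z; in the end x and z are scaled
    ([plane_aut_torus]).  So s is x |-> u^a3 x, z |-> r z, t |-> u t + F^l p with
    r^a2 = u^(a3 d) ([aut_form]); as a2 is prime to d a3, there is a unique v with
    u = v^a2 and r = v^(d a3) ([common_root], [coprime_pow_inj]).

    Conversely, every shear t |-> t + F^l p and every torus element extends to B,
    and the extension of a product is the product of the extensions by
    uniqueness.  This defines the isomorphism [kr_action]; the coefficient p of
    a shear gives the isomorphism [kr_A_coef] with the additive group of A. *)

(** * Leading forms of locally nilpotent derivations *)

(** A filtration of B by degrees in G through the two predicates of having
    degree at most g and less than g. The group G carries no order of its
    own, and the associated graded ring is never formed: the axiom
    [fltM_inv] says that it is a domain. *)
Record degFiltration (B : comNzRingType) (G : zmodType) := DegFiltration {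
  fle : G -> B -> Prop;
  flt : G -> B -> Prop;
  fltW : forall g b, flt g b -> fle g b;
  flt0 : forall g, flt g 0;
  fleD : forall g a b, fle g a -> fle g b -> fle g (a + b);
  fltD : forall g a b, flt g a -> flt g b -> flt g (a + b);
  fleN : forall g a, fle g a -> fle g (- a);
  fltN : forall g a, flt g a -> flt g (- a);
  fleM : forall g h a b, fle g a -> fle h b -> fle (g + h) (a * b);
  fltM : forall g h a b, flt g a -> fle h b -> flt (g + h) (a * b);
  fltM_inv : forall g h a b, fle g a -> fle h b -> flt (g + h) (a * b) ->
    flt g a \/ flt h b;
  fltMn_inv : forall g a n, flt g (a *+ n.+1) -> flt g a }.

Record locNilpDer (B : nzRingType) := LocNilpDer {
  lnd :> B -> B;
  lndD : {morph lnd : a b / a + b};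
  lndM : forall a b, lnd (a * b) = lnd a * b + a * lnd b;
  lnd_nil : forall a, exists n, iter n lnd a = 0 }.

Section LocNilpDerTheory.
Variables (B : nzRingType) (D : locNilpDer B).

Lemma lnd0 : D 0 = 0.
Proof. by apply: (addrI (D 0)); rewrite -lndD !addr0. Qed.

Lemma lndN : {morph D : a / - a}.
Proof. by move=> a; apply: (addrI (D a)); rewrite -lndD !subrr lnd0. Qed.

Lemma lndMn n : {morph D : a / a *+ n}.
Proof. by move=> a; elim: n => [|n IHn]; rewrite ?mulr0n ?lnd0 // !mulrS lndD IHn. Qed.

Lemma iter_lndD n : {morph iter n D : a b / a + b}.
Proof. by elim: n => [//|n IHn] a b; rewrite !iterS IHn lndD. Qed.

Lemma iter_lndN n : {morph iter n D : a / - a}.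
Proof. by elim: n => [//|n IHn] a; rewrite !iterS IHn lndN. Qed.

End LocNilpDerTheory.

Lemma lndX (B : comNzRingType) (D : locNilpDer B) a n :
  D (a ^+ n.+1) = a ^+ n * D a *+ n.+1.
Proof.
elim: n => [|n IHn]; first by rewrite expr1 expr0 mul1r mulr1n.
by rewrite exprS lndM IHn mulrnAr mulrA -exprS [D a * _]mulrC -mulrS.
Qed.

(** With u = a^(e-1), v = b^(e'-1), x = D a and y = D b, the last factor is
    D (a^e + b^e'). *)
Lemma pham_id (B : comNzRingType) (a b u v x y e e' : B) :
  e' * ((a * u + b * v) * y) =
  u * (e' * (a * y) - e * (b * x)) + b * (e * (u * x) + e' * (v * y)).
Proof. ring. Qed.

Section LeadingForms.
Variables (B : comNzRingType) (G : zmodType) (f : degFiltration B G).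
Variables (D : locNilpDer B) (del : G).
Hypothesis fle_lnd : forall g a, fle f g a -> fle f (g + del) (D a).
Hypothesis flt_lnd : forall g a, flt f g a -> flt f (g + del) (D a).
Implicit Types (g h : G) (a b : B) (m n k : nat).

Local Notation fle := (fle f).
Local Notation flt := (flt f).

Lemma fle0 g : fle g 0. Proof. exact/fltW/flt0. Qed.

Lemma fleB g a b : fle g a -> fle g b -> fle g (a - b).
Proof. by move=> ga gb; apply/fleD/fleN. Qed.

Lemma fltMr g h a b : fle g a -> flt h b -> flt (g + h) (a * b).
Proof. by move=> ga hb; rewrite addrC mulrC; apply: fltM. Qed.

Lemma fleMn g a n : fle g a -> fle g (a *+ n).
Proof.
by move=> ga; elim: n => [|n IHn]; [exact: fle0 | rewrite mulrS; apply: fleD].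
Qed.

Lemma fltMn g a n : flt g a -> flt g (a *+ n).
Proof.
by move=> ga; elim: n => [|n IHn]; [exact: flt0 | rewrite mulrS; apply: fltD].
Qed.

Lemma flt_trans g a b : flt g (a - b) -> flt g b -> flt g a.
Proof. by move=> gab gb; rewrite -(subrK b a); apply: fltD. Qed.

Lemma fle_iter n g a : fle g a -> fle (g + del *+ n) (iter n D a).
Proof.
by elim: n => [|n IHn] ga; rewrite ?addr0 // mulrSr addrA; apply/fle_lnd/IHn.
Qed.

Lemma flt_iter n g a : flt g a -> flt (g + del *+ n) (iter n D a).
Proof.
by elim: n => [|n IHn] ga; rewrite ?addr0 // mulrSr addrA; apply/flt_lnd/IHn.
Qed.

Lemma flt_iter_ge m n g a : (m <= n)%N ->
  flt (g + del *+ m) (iter m D a) -> flt (g + del *+ n) (iter n D a).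
Proof.
move=> /subnK <-; rewrite iterD mulrnDr => ga.
by rewrite [_ *+ (n - m) + _]addrC addrA; apply: flt_iter.
Qed.

(** The leading form of degree g of a is killed by the power n + 1 of the
    homogeneous derivation of degree del that D induces on leading forms. *)
Definition lead_order_le g n a := fle g a /\ flt (g + del *+ n.+1) (iter n.+1 D a).

Local Notation nule := lead_order_le.

(** The leading form of degree g of a is nonzero and is killed by the
    induced derivation in n + 1 steps but not in n. *)
Definition lead_order g n a := nule g n a /\ ~ flt (g + del *+ n) (iter n D a).
Local Notation nu := lead_order.

Lemma nu_fle g n a : nu g n a -> fle g a. Proof. by case=> -[]. Qed.

Lemma nu_exact g n a : nu g n a -> ~ flt g a.
Proof. by case=> _ + ga; apply; apply: flt_iter. Qed.

Lemma nu_ex g a : fle g a -> ~ flt g a -> exists n, nu g n a.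
Proof.
move=> ga ngta; have [N DN0] := lnd_nil D a.
have: flt (g + del *+ N) (iter N D a) by rewrite DN0; apply: flt0.
elim: N {DN0} => [|N IHN] gN; first by case: ngta; rewrite -[g]addr0.
have [/IHN //|ngtN] := boolp.pselect (flt (g + del *+ N) (iter N D a)).
by exists N.
Qed.

Lemma nu_nule g m n a : nu g m a -> nule g n a -> (m <= n)%N.
Proof.
move=> [_ ngm] [_ gn]; rewrite leqNgt; apply/negP => lt_nm; apply: ngm.
exact: flt_iter_ge gn.
Qed.

Lemma nu_uniq g m n a : nu g m a -> nu g n a -> m = n.
Proof.
move=> gm gn; apply/eqP; rewrite eqn_leq.
by rewrite (nu_nule gm (proj1 gn)) (nu_nule gn (proj1 gm)).
Qed.

Lemma nuleW g m n a : (m <= n)%N -> nule g m a -> nule g n a.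
Proof. by move=> lemn [ga gm]; split=> //; apply: flt_iter_ge gm. Qed.

Lemma nule_flt g n a : flt g a -> nule g n a.
Proof. by move=> ga; split; [exact: fltW | exact: flt_iter]. Qed.

Lemma nuleD g n a b : nule g n a -> nule g n b -> nule g n (a + b).
Proof.
by move=> [? ?] [? ?]; split; [exact: fleD | rewrite iter_lndD; apply: fltD].
Qed.

Lemma nu_add g m n a b : nu g n a -> nule g m b -> (m < n)%N -> nu g n (a + b).
Proof.
move=> [an nan] bm lt_mn; split; first exact/nuleD/(nuleW (ltnW lt_mn)).
rewrite iter_lndD => gab; apply: nan; apply: flt_trans (_ : flt _ (- iter n D b)).
  by rewrite opprK.
by case: bm => _ bm; apply/fltN/(flt_iter_ge lt_mn).
Qed.

Lemma nu_lead g n a b : nu g n a -> flt g b -> nu g n (a + b).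
Proof.
move=> [an nan] gb; split; first exact/nuleD/nule_flt.
rewrite iter_lndD => gab; apply: nan; apply: flt_trans (_ : flt _ (- iter n D b)).
  by rewrite opprK.
exact/fltN/flt_iter.
Qed.

Lemma nuN g n a : nu g n a -> nu g n (- a).
Proof.
move=> [[ga an] nan]; rewrite /lead_order /lead_order_le !iter_lndN; split; first split.
- exact: fleN.
- exact: fltN.
- by move/fltN; rewrite opprK.
Qed.

Lemma nu_der g n a : nu g n.+1 a -> nu (g + del) n (D a).
Proof.
move=> [[ga an] nan]; rewrite /lead_order /lead_order_le -!iterSr -!addrA -!mulrS.
by do !split=> //; apply: fle_lnd.
Qed.

Lemma nu_iter g n a : nu g n a -> nu (g + del *+ n) 0 (iter n D a).
Proof.
move=> [[ga an] nan]; rewrite /lead_order /lead_order_le mulr0n mulr1n addr0 -addrA -mulrSr.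
by do !split=> //; apply: fle_iter.
Qed.

(** In Leibniz's formula for the power m + n of D on a b, only the term with
    m derivations on a and n on b contributes to the leading form. *)
Lemma iter_lnd_mul m n g h a b : nule g m a -> nule h n b ->
  flt (g + h + del *+ (m + n))
      (iter (m + n) D (a * b) - iter m D a * iter n D b *+ 'C(m + n, m)).
Proof.
move eqN: (m + n)%N => N; elim: N m n eqN g h a b => [|N IHN] m n eqN g h a b.
  have [-> ->] : m = 0%N /\ n = 0%N by lia.
  by move=> _ _ /=; rewrite subrr; apply: flt0.
move=> am bn; rewrite iterSr lndM iter_lndD.
have subst_bin : N.+1 = (m + n)%N by [].
have A1 : flt (g + h + del *+ N.+1) (iter N D (D a * b) -
    if m is m'.+1 then iter m D a * iter n D b *+ 'C(N, m') else 0).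
  case: m eqN am subst_bin => [|m] eqN am _.
    rewrite subr0 mulrS addrACA addrA; apply: flt_iter; apply: fltM.
      by case: am => _; rewrite mulr1n.
    by case: bn.
  have := IHN m n _ (g + del) h (D a) b; rewrite -!iterSr => /(_ ltac:(lia)).
  have -> : g + h + del *+ N.+1 = g + del + h + del *+ N.
    by rewrite mulrS addrACA addrA.
  apply; last by [].
  by case: am => ga am; split; [exact: fle_lnd | rewrite -iterSr -addrA -mulrS].
have A2 : flt (g + h + del *+ N.+1) (iter N D (a * D b) -
    if n is n'.+1 then iter m D a * iter n D b *+ 'C(N, m) else 0).
  case: n eqN bn subst_bin {A1} => [|n] eqN bn _.
    rewrite subr0 mulrS addrA -[g + h + del]addrA; apply: flt_iter.
    by apply: fltMr; [case: am | case: bn => _; rewrite mulr1n].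
  have := IHN m n _ g (h + del) a (D b); rewrite -!iterSr => /(_ ltac:(lia)).
  have -> : g + h + del *+ N.+1 = g + (h + del) + del *+ N by rewrite mulrS !addrA.
  apply; first by [].
  by case: bn => hb bn; split; [exact: fle_lnd | rewrite -iterSr -addrA -mulrS].
have -> : iter m D a * iter n D b *+ 'C(N.+1, m) =
   (if m is m'.+1 then iter m D a * iter n D b *+ 'C(N, m') else 0) +
   (if n is n'.+1 then iter m D a * iter n D b *+ 'C(N, m) else 0).
  clear -subst_bin; case: m subst_bin => [|m] subst_bin.
    by case: n subst_bin => [|n] //; rewrite !bin0 add0r.
  rewrite binS mulrnDr addrC; congr (_ + _).
  case: n subst_bin => [|n] subst_bin //.
  by rewrite bin_small ?mulr0n //; lia.
by rewrite opprD addrACA; apply: fltD.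
Qed.

Lemma nuleM m n g h a b : nule g m a -> nule h n b -> nule (g + h) (m + n) (a * b).
Proof.
move=> am bn; split; first by apply: fleM; [case: am | case: bn].
have := iter_lnd_mul (nuleW (leqnSn m) am) bn; rewrite addSn => /flt_trans.
apply; apply/fltMn; rewrite addnC -addnS addnC mulrnDr [X in flt X]addrACA.
by case: am => ga am; case: bn => hb bn; apply: fltM => //; apply: fle_iter.
Qed.

(** Orders add up because the associated graded ring is a domain of
    characteristic 0: the binomial coefficient in [iter_lnd_mul] is
    invertible. *)
Lemma nuM m n g h a b : nu g m a -> nu h n b -> nu (g + h) (m + n) (a * b).
Proof.
move=> [am nam] [bn nbn]; split; first exact: nuleM.
move=> gab; have := iter_lnd_mul am bn => /fltN; rewrite opprB => /flt_trans /(_ gab).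
have [k ->] : exists k, 'C(m + n, m) = k.+1.
  by exists ('C(m + n, m)).-1; rewrite prednK // bin_gt0 leq_addr.
move=> /fltMn_inv; rewrite mulrnDr addrACA => /fltM_inv[] //.
- by apply: fle_iter; case: am.
- by apply: fle_iter; case: bn.
Qed.

Lemma nuMn g n a k : nu g n a -> nu g n (a *+ k.+1).
Proof.
have iterMn i : iter i D (a *+ k.+1) = iter i D a *+ k.+1.
  by elim: i => // i IHi; rewrite !iterS IHi lndMn.
move=> [[ga an] nan]; rewrite /lead_order /lead_order_le !iterMn; split; first split.
- exact: fleMn.
- exact: fltMn.
- by move=> /fltMn_inv.
Qed.

Lemma nuX g n a k : nu 0 0 1 -> nu g n a -> nu (g *+ k) (n * k) (a ^+ k).
Proof.
move=> nu1 an; elim: k => [|k IHk]; first by rewrite mulr0n muln0 expr0.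
by rewrite mulrS mulnS exprS; apply: nuM.
Qed.

(** Put k = a^r + b^s, and suppose that its leading form is killed. Up to
    lower terms, a^(r-1) divides s k D b, so that (r - 1) m <= n - 1 when a
    and b have positive orders m and n; exchanging a and b gives (s - 1) n
    <= m - 1, and the two inequalities exclude each other. If one order
    vanishes so does the other, for m r = n s by the vanishing of the order
    of k. *)
Lemma nu_pham g h r s m n a b : (1 < r)%N -> (1 < s)%N -> nu 0 0 1 ->
  g *+ r = h *+ s -> nu g m a -> nu h n b ->
  nu (g *+ r) 0 (a ^+ r + b ^+ s) -> m = 0%N /\ n = 0%N.
Proof.
move=> r1 s1 nu1 gh am bn k0.
have ar := nuX r nu1 am; have bs := nuX s nu1 bn; rewrite -gh in bs.
have eq_mn : (m * r = n * s)%N.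
  case: (ltngtP (m * r) (n * s)) => // lt_mn.
    rewrite addrC in k0; have := nu_uniq k0 (nu_add bs (proj1 ar) lt_mn); lia.
  by have := nu_uniq k0 (nu_add ar (proj1 bs) lt_mn); lia.
case: m am ar eq_mn => [|m] am ar eq_mn; first by split=> //; nia.
case: n bn bs eq_mn => [|n] bn bs eq_mn; first by nia.
have key r' s' g' h' m' n' a' b' : (0 < r')%N -> (0 < s')%N ->
    g' *+ r'.+1 = h' *+ s'.+1 -> nu g' m'.+1 a' -> nu h' n'.+1 b' ->
    nu (g' *+ r'.+1) 0 (a' ^+ r'.+1 + b' ^+ s'.+1) -> (m'.+1 * r' <= n')%N.
  move=> r'0 s'0 gh' am' bn' k0'.
  set F := _ + _ in k0'.
  have FDb : (F * D b') *+ s'.+1 =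
      a' ^+ r' * ((a' * D b') *+ s'.+1 - (b' * D a') *+ r'.+1) + b' * D F.
    rewrite /F lndD !lndX !exprS.
    have := pham_id a' b' (a' ^+ r') (b' ^+ s') (D a') (D b') r'.+1%:R s'.+1%:R.
    by rewrite !mulr_natl.
  have bD := nu_der bn'.
  have nuL := nuMn s' (nuM k0' bD); rewrite add0n in nuL.
  have lt_bDF : flt (g' *+ r'.+1 + (h' + del)) (b' * D F).
    rewrite addrCA; apply: fltMr; first exact: nu_fle bn'.
    by case: k0' => -[_]; rewrite mulr1n.
  have nuR := nu_lead nuL (fltN lt_bDF); rewrite FDb addrK in nuR.
  set W := _ - _ in nuR.
  have ar' := nuX r' nu1 am'.
  have le_W : fle (g' + (h' + del)) W.
    apply: fleB; apply: fleMn.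
      by apply: fleM; [exact: nu_fle am' | exact: nu_fle bD].
    by rewrite addrCA; apply: fleM; [exact: nu_fle bn' | exact/nu_fle/(nu_der am')].
  have nW : ~ flt (g' + (h' + del)) W.
    move=> ltW; apply: (nu_exact nuR).
    by rewrite mulrSr -addrA; apply: fltMr => //; apply: nu_fle ar'.
  have [k Wk] := nu_ex le_W nW.
  have := nuM ar' Wk; rewrite addrA -mulrSr => nuR'.
  by have := nu_uniq nuR nuR'; lia.
case: r s r1 s1 gh k0 eq_mn {ar bs} => [//|r] [//|s] r1 s1 gh k0 eq_mn.
have := key r s g h m n a b r1 s1 gh am bn k0.
rewrite gh addrC in k0; have := key s r h g n m b a s1 r1 (esym gh) bn am k0.
nia.
Qed.

End LeadingForms.

(** * The weighted plane and the curve x^d + z^a *)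

Section MeasureProduct.
Variables (n : nat) (R : idomainType) (mf : measure n).
Implicit Types (p q : {mpoly R[n]}) (m : 'X_{1..n}).
Local Notation size p := (mmeasure mf p).

Lemma mmeasure_leP p k :
  reflect (forall m, p@_m != 0 -> (mf m < k)%N) (size p <= k)%N.
Proof.
rewrite mmeasureE; apply: (iffP idP) => [le_pk m m_p | le_pk].
  by apply: leq_trans le_pk; rewrite (bigD1_seq m) ?mcoeff_msupp //= leq_max leqnn.
rewrite big_seq; elim/big_ind: _ => // [x y|m]; first by rewrite geq_max => -> ->.
by rewrite mcoeff_msupp => /le_pk.
Qed.

Lemma mmeasureM_le p q i j :
  (size p <= i)%N -> (size q <= j.+1)%N -> (size (p * q) <= i + j)%N.
Proof.
move=> /mmeasure_leP le_pi /mmeasure_leP le_qj; apply/mmeasure_leP => m.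
rewrite -mcoeff_msupp => /msuppM_le /allpairsP [[m1 m2] /= [m1p m2q ->]].
rewrite mcoeff_msupp in m1p; rewrite mcoeff_msupp in m2q.
by rewrite mfD; have := le_pi _ m1p; have := le_qj _ m2q; lia.
Qed.

Lemma dhomog_measure p e : p != 0 -> p \is e.-homog for mf -> size p = e.+1.
Proof.
move=> p0 hom_p; apply/eqP; rewrite eqn_leq; apply/andP; split.
  apply/mmeasure_leP => m; rewrite -mcoeff_msupp => /(dhomog_mf hom_p) ->.
  exact: leqnn.
by rewrite -(dhomog_mf hom_p (mlead_supp p0)); apply/mmeasure_mnm_lt/mlead_supp.
Qed.

Lemma measure_top p : p != 0 -> exists2 r,
  (size r < size p)%N & p = pihomog mf (size p).-1 p + r.
Proof.
move=> p0; have sp := mpolySpred mf p0.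
exists (\sum_(e < (size p).-1) pihomog mf e p).
  rewrite sp ltnS; apply: leq_trans (mmeasure_sum _ _ _ _) _.
  apply/bigmax_leqP => i _; have [->|q0] := eqVneq (pihomog mf i p) 0.
    by rewrite mmeasure0.
  by rewrite (dhomog_measure q0 (pihomogP _ _ _)) ltn_ord.
rewrite addrC {1}(pihomog_partitionE (leqnn (size p))) sp.
by rewrite big_ord_recr.
Qed.

Lemma measure_top_neq0 p : p != 0 -> pihomog mf (size p).-1 p != 0.
Proof.
move=> p0; have [r lt_r p_eq] := measure_top p0.
apply/eqP => e0; rewrite e0 add0r in p_eq.
by rewrite -p_eq ltnn in lt_r.
Qed.

(** The top homogeneous components of p and q have a nonzero product, which
    is too large to be cancelled by the lower terms. *)
Lemma mmeasureM p q : p != 0 -> q != 0 -> size (p * q) = (size p + size q).-1.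
Proof.
move=> p0 q0; have sp := mpolySpred mf p0; have sq := mpolySpred mf q0.
apply/eqP; rewrite eqn_leq; apply/andP; split.
  have := @mmeasureM_le p q (size p) (size q).-1 (leqnn _); rewrite -sq => /(_ (leqnn _)).
  lia.
have [r lt_r p_eq] := measure_top p0; have [s lt_s q_eq] := measure_top q0.
set P := pihomog _ _ _ in p_eq; set Q := pihomog _ _ _ in q_eq.
have P0 : P != 0 := measure_top_neq0 p0; have Q0 : Q != 0 := measure_top_neq0 q0.
have homP := pihomogP mf (size p).-1 p; have homQ := pihomogP mf (size q).-1 q.
have PQ := dhomog_measure (mulf_neq0 P0 Q0) (dhomogM homP homQ).
have eqPQ : P * Q = p * q - r * q - P * s by rewrite {1}p_eq {1 2}q_eq; ring.
rewrite leqNgt; apply/negP => lt_pq.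
have sP : (size P <= (size p).-1.+1)%N by rewrite (dhomog_measure P0 homP).
have := mmeasureD_le mf (p * q - r * q) (- (P * s)).
have := mmeasureD_le mf (p * q) (- (r * q)).
rewrite !mmeasureN -eqPQ PQ.
have : (size (r * q) <= (size p).-1 + (size q).-1)%N.
  by apply: mmeasureM_le; [rewrite -ltnS -sp | rewrite -sq].
have : (size (P * s) <= (size q).-1 + (size p).-1)%N.
  by rewrite mulrC; apply: mmeasureM_le => //; rewrite -ltnS -sq.
have arith (u v w t i j k m : nat) : i = k.+1 -> j = m.+1 -> (u <= m + k)%N ->
    (v <= k + m)%N -> (w <= maxn t v)%N -> (k + m < maxn w u)%N ->
    (t < (i + j).-1)%N -> False by lia.
by move=> Ps rq D1 D2; exact: arith sp sq Ps rq D1 D2 lt_pq.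
Qed.

End MeasureProduct.

(** The weight for which x^d + z^a is homogeneous. *)
Definition wt (d a : nat) (m : 'X_{1..2}) : nat :=
  (a * m (inord 0) + d * m (inord 1))%N.

Fact wt0 d a : wt d a 0%MM = 0%N.
Proof. by rewrite /wt !mnm0E !muln0. Qed.
Fact wtD d a : {morph wt d a : m1 m2 / (m1 + m2)%MM >-> (m1 + m2)%N}.
Proof. by move=> m1 m2; rewrite /wt !mnmDE !mulnDr addnACA. Qed.
HB.instance Definition _ d a := isMeasure.Build 2 (wt d a) (wt0 d a) (@wtD d a).

Section Plane.
Variables (C : numClosedFieldType) (d a : nat).
Hypotheses (d1 : (1 < d)%N) (a1 : (1 < a)%N) (ad : coprime a d).

Local Notation A := {mpoly C[2]}.
Local Notation x := ('X_(inord 0) : A).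
Local Notation z := ('X_(inord 1) : A).
Local Notation whom e := (ishomog1 e (wt d a)).
Local Notation wsize := (mmeasure (wt d a)).

Definition curve : A := x ^+ d + z ^+ a.
Local Notation F := curve.

Lemma ord2_neq : (inord 0 : 'I_2) != inord 1.
Proof. by rewrite -val_eqE /= !inordK. Qed.

Lemma wtU0 : wt d a U_(inord 0)%MM = a.
Proof. by rewrite /wt !mnm1E eqxx (negPf ord2_neq) muln0 addn0 muln1. Qed.
Lemma wtU1 : wt d a U_(inord 1)%MM = d.
Proof. by rewrite /wt !mnm1E eqxx eq_sym (negPf ord2_neq) muln0 add0n muln1. Qed.

Lemma ord2P (P : 'I_2 -> Prop) : P (inord 0) -> P (inord 1) -> forall i, P i.
Proof.
move=> P0 P1 [[|[|//]] i2].
- by have -> : Ordinal i2 = inord 0 by apply: val_inj; rewrite /= inordK.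
- by have -> : Ordinal i2 = inord 1 by apply: val_inj; rewrite /= inordK.
Qed.

Lemma big_ord2E (R : Type) (idx : R) (op : Monoid.law idx) (f : 'I_2 -> R) :
  \big[op/idx]_(i < 2) f i = op (f (inord 0)) (f (inord 1)).
Proof.
rewrite big_ord_recl big_ord1; congr (op (f _) (f _)).
  by apply: val_inj; rewrite /= inordK.
by apply: val_inj; rewrite /= inordK.
Qed.

Lemma mpolyX2 m : 'X_[m] = x ^+ m (inord 0) * z ^+ m (inord 1) :> A.
Proof. by rewrite mpolyXE_id big_ord2E. Qed.

Definition mono i j : A := x ^+ i * z ^+ j.

Lemma whom_x : x \is whom a. Proof. by rewrite dhomogX; apply/eqP/wtU0. Qed.
Lemma whom_z : z \is whom d. Proof. by rewrite dhomogX; apply/eqP/wtU1. Qed.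
Lemma whom_mono i j : mono i j \is whom (a * i + d * j)%N.
Proof. by apply: dhomogM; apply: dhomogMn; [exact: whom_x | exact: whom_z]. Qed.

Lemma whom_curve : F \is whom (a * d)%N.
Proof.
apply: dhomogD; first exact/dhomogMn/whom_x.
by rewrite [(a * d)%N]mulnC; apply/dhomogMn/whom_z.
Qed.

Lemma curve_neq0 : F != 0.
Proof.
apply/eqP => /(congr1 (meval (fun i => (i == inord 0)%:R))) /eqP.
rewrite raddf0 mevalD !rmorphXn /= !mevalXU /= eqxx eq_sym [inord 1 == _]eq_sym (negPf ord2_neq).
by rewrite eq_sym expr1n expr0n; case: a a1 => //= a' _; rewrite addr0 oner_eq0.
Qed.

Lemma wsize_curveX l : wsize (F ^+ l) = (a * d * l).+1.
Proof.
by apply: dhomog_measure; [rewrite expf_neq0 ?curve_neq0 | exact/dhomogMn/whom_curve].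
Qed.

(** F q is homogeneous of weight e. The case q = 0 is separate since e may
    be smaller than the weight of F. *)
Definition cofactor e (q : A) := q = 0 \/ exists2 e', e = (e' + a * d)%N & q \is whom e'.

Lemma cofactorD e p q : cofactor e p -> cofactor e q -> cofactor e (p + q).
Proof.
move=> [->|[e1 e1E hp]]; rewrite ?add0r // => -[->|[e2 e2E hq]].
  by right; exists e1; rewrite ?addr0.
by right; exists e1 => //; apply: dhomogD => //; have -> : e1 = e2 by lia.
Qed.

Lemma cofactorZ e c q : cofactor e q -> cofactor e (c *: q).
Proof.
by move=> [->|[e1 e1E hp]]; [left; rewrite scaler0 | right; exists e1 => //; apply: dhomogZ].
Qed.

(** As a and d are coprime, the exponents of two monomials of the same
    weight differ by a multiple of (d, -a), and x^d is congruent to - z^a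
    modulo F. *)
Lemma mono_congr_le i j i' j' : (i' <= i)%N ->
  (a * i + d * j = a * i' + d * j')%N ->
  exists c q, [/\ c != 0, mono i j = c *: mono i' j' + F * q &
                  cofactor (a * i + d * j)%N q].
Proof.
move=> le_i eq_w.
have /dvdnP[k kE] : (d %| i - i')%N.
  have : (d %| a * (i - i'))%N by apply/dvdnP; exists (j' - j)%N; nia.
  by rewrite Gauss_dvdr // coprime_sym.
have iE : i = (i' + k * d)%N by lia.
have jE : j' = (j + k * a)%N by nia.
exists ((-1) ^+ k), (mono i' j * \sum_(s < k) (x ^+ d) ^+ (k.-1 - s) * (- z ^+ a) ^+ s).
split; first by rewrite signr_eq0.
  have -> : F = x ^+ d - - z ^+ a by rewrite opprK.
  rewrite mulrCA -subrXX iE jE /mono !exprD !(mulnC k) !exprM [(- _ ^+ a) ^+ k]exprNn.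
  by rewrite -mul_mpolyC rmorphXn rmorphN1 /=; ring.
case: k kE iE jE => [|k] kE iE jE; first by left; rewrite big_ord0 mulr0.
right; exists (a * i' + d * j + a * d * k)%N; first by rewrite iE; lia.
apply: dhomogM; first exact: whom_mono.
apply: rpred_sum => s _; have -> : (a * d * k = a * d * (k.+1.-1 - s) + a * d * s)%N.
  by rewrite -mulnDr subnK // -ltnS.
apply: dhomogM; apply: dhomogMn; first exact/dhomogMn/whom_x.
by rewrite dhomogN [(a * d)%N]mulnC; apply/dhomogMn/whom_z.
Qed.

Lemma mono_congr i j i' j' : (a * i + d * j = a * i' + d * j')%N ->
  exists c q, mono i j = c *: mono i' j' + F * q /\ cofactor (a * i + d * j)%N q.
Proof.
move=> eq_w; case: (leqP i' i) => [le_i|/ltnW le_i].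
  by have [c [q [_ ? ?]]] := mono_congr_le le_i eq_w; exists c, q.
have [c [q [c0 qE qe]]] := mono_congr_le le_i (esym eq_w).
exists c^-1, (- c^-1 *: q); rewrite qE; split; last first.
  by rewrite eq_w; apply: cofactorZ.
by rewrite scalerDr scalerA mulVf // scale1r -scalerAr scaleNr addrK.
Qed.

(** Modulo F all monomials of a given weight are proportional. *)
Lemma whom_split e p : p != 0 -> p \is whom e -> exists i j c q,
  [/\ (a * i + d * j = e)%N, p = c *: mono i j + F * q & cofactor e q].
Proof.
move=> p0 hom_p; pose m0 := mlead p.
have m0e : wt d a m0 = e by apply/(dhomog_mf hom_p)/mlead_supp.
exists (m0 (inord 0)), (m0 (inord 1)).
suff [c [q [pE qe]]] : exists c q,
    p = c *: mono (m0 (inord 0)) (m0 (inord 1)) + F * q /\ cofactor e q.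
  by exists c, q.
rewrite {1}[p]mpolyE.
have : {subset msupp p <= msupp p} by [].
elim: {1 3}(msupp p) => [|m s IHs] sub_s.
  by exists 0, 0; rewrite big_nil scale0r mulr0 addr0; split=> //; left.
have [|c [q [sE qe]]] := IHs; first by move=> m' m's; apply/sub_s; rewrite inE m's orbT.
have me : wt d a m = e by apply: (dhomog_mf hom_p); apply: sub_s; rewrite inE eqxx.
have [|c' [q' [mE q'e]]] := @mono_congr (m (inord 0)) (m (inord 1))
    (m0 (inord 0)) (m0 (inord 1)); first by rewrite -/(wt d a m) me -m0e.
exists (p@_m * c' + c), (p@_m *: q' + q); split.
  rewrite big_cons sE mpolyX2 -/(mono _ _) mE scalerDr scalerA scalerDl mulrDr.
  by rewrite -scalerAr addrACA.
by apply: cofactorD => //; apply: cofactorZ; rewrite -/(wt d a m) me in q'e.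
Qed.

End Plane.

(** * Primality of the curve and its Hamiltonian derivation *)

Section VanishingDerivation.
Variables (n : nat) (R : comNzRingType) (S : comNzRingType).
Variables (h : {rmorphism {mpoly R[n]} -> S}) (E : {mpoly R[n]} -> S).
Hypotheses (ED : {morph E : p q / p + q}).
Hypothesis EM : forall p q, E (p * q) = E p * h q + h p * E q.
Hypothesis EC : forall c : R, E c%:MP = 0.

(** A derivation along h is determined by its values on the variables. It is
    used for the difference of two derivations, and for the composite of a
    derivation with a substitution. *)
Lemma mpoly_der_eq0 : (forall i, E 'X_i = 0) -> forall p, E p = 0.
Proof.
move=> EX; have E0 : E 0 = 0 by rewrite -[0]/(0%:MP) EC.
have E1 : E 1 = 0 by rewrite -[1]/(1%:MP) EC.
move=> p; rewrite (mpolyE p); elim/big_ind: _ => // [u v|m _].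
  by rewrite ED => -> ->; rewrite addr0.
rewrite -mul_mpolyC EM EC mul0r add0r mpolyXE_id.
suff -> : E (\prod_(i < n) 'X_i ^+ m i) = 0 by rewrite mulr0.
elim/big_ind: _ => // [u v Eu Ev|i _]; first by rewrite EM Eu Ev mul0r mulr0 addr0.
by elim: (m i) => [|k IHk]; rewrite ?expr0 // exprS EM EX IHk mul0r mulr0 addr0.
Qed.

End VanishingDerivation.

Lemma mderivXn n (R : comNzRingType) (i : 'I_n) (p : {mpoly R[n]}) k :
  (p ^+ k.+1)^`M(i) = p^`M(i) * p ^+ k *+ k.+1.
Proof.
elim: k => [|k IHk]; first by rewrite expr0 mulr1 expr1.
by rewrite exprS mderivM IHk mulrnAr mulrCA -exprS [RHS]mulrS.
Qed.

Lemma mderivU n (R : comNzRingType) (i j : 'I_n) :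
  ('X_i : {mpoly R[n]})^`M(j) = (i == j)%:R.
Proof.
rewrite mderivX mnm1E; have [->|ne] := eqVneq i j; last by rewrite scale0r.
have -> : (U_(j) - U_(j))%MM = 0%MM :> 'X_{1..n}.
  by apply/mnmP => k; rewrite mnmBE mnm0E subnn.
by rewrite mpolyX0 scale1r.
Qed.

Section PlaneCurve.
Variables (C : numClosedFieldType) (d a : nat).
Hypotheses (d1 : (1 < d)%N) (a1 : (1 < a)%N) (ad : coprime a d).

Local Notation A := {mpoly C[2]}.
Local Notation x := ('X_(inord 0) : A).
Local Notation z := ('X_(inord 1) : A).
Local Notation whom e := (ishomog1 e (wt d a)).
Local Notation wsize := (mmeasure (wt d a)).
Local Notation F := (curve C d a).
Local Notation mono := (mono C).

(** The curve x^d + z^a = 0 is parametrized by x = eps T^a, z = T^d, where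
    eps^d = -1. *)
Let eps : C := d.-root (-1).
Let epsd : eps ^+ d = -1. Proof. by rewrite rootCK //; lia. Qed.
Let eps0 : eps != 0.
Proof.
apply/eqP => e0; move/eqP: epsd; rewrite e0 expr0n (_ : (d == 0)%N = false); last lia.
by rewrite eq_sym oppr_eq0 oner_eq0.
Qed.

Definition param : A -> {poly C} :=
  mmap (@polyC C) (fun i : 'I_2 => if i == inord 0 then eps%:P * 'X^a else 'X^d).
HB.instance Definition _ := GRing.RMorphism.on param.

Lemma paramZ c p : param (c *: p) = c%:P * param p.
Proof. exact: mmapZ. Qed.

Lemma param_mono i j : param (mono i j) = (eps ^+ i) *: 'X^(a * i + d * j).
Proof.
rewrite /mono rmorphM !rmorphXn /= /param !mmapX !mmap1U eqxx eq_sym.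
rewrite (negPf ord2_neq) exprMn -polyC_exp -!exprM -mulrA -exprD.
by rewrite mul_polyC.
Qed.

Lemma param_curve : param F = 0.
Proof.
have -> : F = mono d 0 + mono 0 a by rewrite /mono !expr0 mulr1 mul1r.
rewrite rmorphD /= !param_mono epsd expr0 scale1r scaleN1r.
by rewrite !muln0 addn0 add0n mulnC addNr.
Qed.

Lemma param_whom e p : p \is whom e -> param p = (param p)`_e *: 'X^e.
Proof.
have [->|p0 hom_p] := eqVneq p 0; first by rewrite rmorph0 coef0 scale0r.
have [i [j [c [q [eE -> _]]]]] := whom_split d1 a1 ad p0 hom_p.
rewrite rmorphD rmorphM /= param_curve mul0r addr0 paramZ param_mono eE.
by rewrite mul_polyC scalerA coefZ coefXn eqxx mulr1.
Qed.

Lemma param_pihomog e p :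
  param (pihomog (wt d a) e p) = (param p)`_e *: 'X^e.
Proof.
have -> : (param p)`_e = \sum_(s < wsize p) (param (pihomog (wt d a) s p))`_e.
  by rewrite {1}(pihomog_partitionE (leqnn (wsize p))) rmorph_sum coef_sum.
rewrite (param_whom (pihomogP (wt d a) e p)); congr (_ *: _).
have H (s : nat) : (param (pihomog (wt d a) s p))`_e =
    if s == e then (param (pihomog (wt d a) e p))`_e else 0.
  have [-> //|ne_se] := eqVneq s e.
  by rewrite (param_whom (pihomogP _ _ _)) coefZ coefXn eq_sym (negPf ne_se) mulr0.
under eq_bigr => s _ do rewrite H.
rewrite -big_mkcond /=; have [le_e|lt_e] := leqP (wsize p) e; last first.
  by rewrite (big_pred1 (Ordinal lt_e)).
rewrite big_pred0 => [|s]; last by apply/negbTE; have := ltn_ord s; lia.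
suff -> : pihomog (wt d a) e p = 0 by rewrite rmorph0 coef0.
rewrite /pihomog big_seq_cond big_pred0 // => m; apply/negbTE/negP => /andP[m_p /eqP me].
by have := mmeasure_mnm_lt (wt d a) m_p; rewrite me ltnNge le_e.
Qed.

Definition curve_dvd p := exists q, p = F * q.

(** In each weight, p is congruent modulo F to a multiple of one monomial,
    whose image under the parametrization is a nonzero multiple of a power
    of T. *)
Lemma param_eq0 p : param p = 0 -> curve_dvd p.
Proof.
move=> p0; rewrite (pihomog_partitionE (leqnn (wsize p))).
elim/big_ind: _ => [|u v [q1 ->] [q2 ->]|e _].
- by exists 0; rewrite mulr0.
- by exists (q1 + q2); rewrite mulrDr.
have := param_pihomog e p; rewrite p0 coef0 scale0r.
set q := pihomog _ _ _; have [->|q0] := eqVneq q 0.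
  by exists 0; rewrite mulr0.
have [i [j [c [r [eE -> _]]]]] := whom_split d1 a1 ad q0 (pihomogP (wt d a) e p).
rewrite rmorphD rmorphM /= param_curve mul0r addr0 paramZ param_mono.
rewrite mul_polyC scalerA => /eqP; rewrite scaler_eq0 mulf_eq0 expf_eq0.
rewrite (negPf eps0) andbF orbF -size_poly_eq0 size_polyXn orbF => /eqP ->.
by exists r; rewrite scale0r add0r.
Qed.

Lemma curve_dvd_param p : curve_dvd p -> param p = 0.
Proof. by case=> q ->; rewrite rmorphM /= param_curve mul0r. Qed.

(** The ring C[x, z] / F embeds in C[T] by the parametrization. *)
Lemma curve_prime p q : curve_dvd (p * q) -> curve_dvd p \/ curve_dvd q.
Proof.
move=> /curve_dvd_param/eqP; rewrite rmorphM mulf_eq0 => /orP[] /eqP /param_eq0 ?.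
  by left.
by right.
Qed.

Lemma mono_ndvd i j : ~ curve_dvd (mono i j).
Proof.
move=> /curve_dvd_param /eqP; rewrite param_mono scaler_eq0 expf_eq0.
by rewrite (negPf eps0) andbF -size_poly_eq0 size_polyXn.
Qed.

Lemma mpoly_mul_const (p q : A) c : c != 0 -> p * q = c%:MP ->
  exists2 u, u != 0 & p = u%:MP.
Proof.
move=> c0 pqc; have up : p \in mpoly_unit (R := C) (n := 2).
  apply: (@mpoly_intro_unit _ _ _ (c^-1 *: q)).
  by rewrite -scalerAl mulrC pqc -mul_mpolyC -mpolyCM mulVf.
by case/andP: up => /eqP pE; rewrite unitfE => u0; exists (p@_0%MM).
Qed.

Lemma curveX_factor n c (p q : A) : c != 0 -> p * q = c%:MP * F ^+ n ->
  exists i u, [/\ (i <= n)%N, u != 0 & p = u%:MP * F ^+ i].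
Proof.
move=> c0; elim: n p q => [|n IHn] p q.
  rewrite expr0 mulr1 => /(mpoly_mul_const c0) [u u0 ->].
  by exists 0%N, u; rewrite expr0 mulr1.
move=> pqE; have [|[p' pE]|[q' qE]] := @curve_prime p q.
- by exists (c%:MP * F ^+ n); rewrite pqE exprS mulrCA.
- have [|i [u [le_i u0 p'E]]] := IHn p' q.
    by apply: (mulfI (curve_neq0 C d a1)); rewrite mulrA -pE pqE exprS mulrCA.
  by exists i.+1, u; split=> //; rewrite pE p'E exprS mulrCA.
have [|i [u [le_i u0 p'E]]] := IHn p q'.
  by apply: (mulfI (curve_neq0 C d a1)); rewrite mulrCA -qE pqE exprS mulrCA.
by exists i, u; split=> //; apply: leqW.
Qed.

(** The Jacobian determinant of p and F. *)
Definition hamiltonian (p : A) : A :=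
  p^`M(inord 0) * F^`M(inord 1) - p^`M(inord 1) * F^`M(inord 0).

Local Notation ham := hamiltonian.

Lemma hamD : {morph ham : p q / p + q}.
Proof. by move=> p q; rewrite /hamiltonian !mderivD; ring. Qed.
Lemma hamM p q : ham (p * q) = ham p * q + p * ham q.
Proof. by rewrite /hamiltonian !mderivM; ring. Qed.
Lemma hamC c : ham c%:MP = 0.
Proof. by rewrite /hamiltonian !mderivC !mul0r subr0. Qed.
Lemma ham_curve : ham F = 0.
Proof. by rewrite /hamiltonian mulrC subrr. Qed.
Lemma hamZ c p : ham (c *: p) = c *: ham p.
Proof. by rewrite -!mul_mpolyC hamM hamC mul0r add0r. Qed.

Lemma mderiv_curve0 : F^`M(inord 0) = d%:R * x ^+ d.-1.
Proof.
rewrite /curve mderivD; case: d d1 => // d' _; case: a a1 => // a' _.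
rewrite !mderivXn !mderivU eqxx eq_sym (negPf ord2_neq) !mul0r mul0rn addr0 mul1r.
by rewrite mulr_natl.
Qed.

Lemma mderiv_curve1 : F^`M(inord 1) = a%:R * z ^+ a.-1.
Proof.
rewrite /curve mderivD; case: d d1 => // d' _; case: a a1 => // a' _.
rewrite !mderivXn !mderivU eqxx (negPf ord2_neq) !mul0r mul0rn add0r mul1r.
by rewrite mulr_natl.
Qed.

Lemma hamE p : ham p =
  p^`M(inord 0) * (a%:R * z ^+ a.-1) - p^`M(inord 1) * (d%:R * x ^+ d.-1).
Proof. by rewrite /hamiltonian mderiv_curve0 mderiv_curve1. Qed.

Lemma ham_x : ham x = a%:R * z ^+ a.-1.
Proof.
by rewrite /hamiltonian !mderivU eqxx (negPf ord2_neq) mul1r mul0r subr0 mderiv_curve1.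
Qed.
Lemma natr_mpoly_neq0 n : (0 < n)%N -> (n%:R : A) != 0.
Proof. by move=> n0; rewrite -mpolyC_nat mpolyC_eq0 pnatr_eq0 -lt0n. Qed.

Lemma mpolyX_neq0 (m : 'X_{1..2}) : ('X_[m] : A) != 0.
Proof. by rewrite -msize_poly_eq0 msizeX. Qed.

(** The derivative in x lowers weights by a and the factor F_z = a z^(a-1)
    raises them by d (a - 1); in the other term x and z are exchanged. Both
    shifts are a d - a - d. *)
Lemma wsize_ham p : (wsize (ham p) + (a + d) <= wsize p + a * d)%N.
Proof.
have ge_ad : (a + d <= a * d)%N by nia.
rewrite {1}[p]mpolyE.
have ham_sum (s : seq 'X_{1..2}) : ham (\sum_(m <- s) p@_m *: 'X_[m]) =
    \sum_(m <- s) p@_m *: ham 'X_[m].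
  elim: s => [|m s IHs]; first by rewrite !big_nil -[0]/(0%:MP) hamC.
  by rewrite !big_cons hamD hamZ IHs.
rewrite ham_sum.
apply: leq_trans (_ : _ <= (wsize p + (a * d - (a + d))) + (a + d))%N _; last by lia.
rewrite leq_add2r; apply: leq_trans (mmeasure_sum _ _ _ _) _.
rewrite big_seq; apply/bigmax_leqP_seq => m m_p _.
have lt_m : (wt d a m < wsize p)%N := mmeasure_mnm_lt (wt d a) m_p.
apply: leq_trans (mmeasureZ_le _ _ _) _.
apply: leq_trans (_ : _ <= (wt d a m + (a * d - (a + d))).+1)%N _; last by lia.
rewrite /hamiltonian mderiv_curve0 mderiv_curve1 !mderivX.
apply: leq_trans (mmeasureD_le _ _ _) _; rewrite mmeasureN geq_max.
have wtB i (m' : 'X_{1..2}) k : ('X_i : A) \is whom k -> m' i != 0%N ->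
    (wt d a (m' - U_(i))%MM + k = wt d a m')%N.
  rewrite dhomogX => /eqP <- mi.
  have : (m' - U_(i) + U_(i))%MM = m' by rewrite submK // lep1mP.
  by move=> {2}<-; rewrite (wtD d a).
have bound (i : 'I_2) k (w : A) e n : ('X_i : A) \is whom k -> w \is whom e ->
   (e + a + d = a * d + k)%N ->
   (wsize ((m i)%:R *: 'X_[m - U_(i)] * (n%:R * w)) <= (wt d a m + (a * d - (a + d))).+1)%N.
  move=> hi hw eE; have [->|mi] := eqVneq (m i) 0%N.
    by rewrite scale0r mul0r mmeasure0.
  rewrite -scalerAl; apply: leq_trans (mmeasureZ_le _ _ _) _.
  rewrite mulrCA -mpolyC_nat mul_mpolyC; apply: leq_trans (mmeasureZ_le _ _ _) _.
  have [->|w0] := eqVneq w 0; first by rewrite mulr0 mmeasure0.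
  rewrite mmeasureM ?mpolyX_neq0 // mmeasureX (dhomog_measure w0 hw) addnS /=.
  by have := wtB i m k hi mi; lia.
apply/andP; split.
  apply: (bound _ a _ (d * a.-1)%N); [exact: whom_x | exact/dhomogMn/whom_z |].
  by case: a a1 => //= a' _; lia.
apply: (bound _ d _ (a * d.-1)%N); [exact: whom_z | exact/dhomogMn/whom_x |].
by case: d d1 => //= d' _; lia.
Qed.

End PlaneCurve.

(** * Plane automorphisms preserving the curve *)

Section PlaneAutomorphism.
Variables (C : numClosedFieldType) (d a : nat).
Hypotheses (d1 : (1 < d)%N) (a1 : (1 < a)%N) (ad : coprime a d).

Local Notation A := {mpoly C[2]}.
Local Notation x := ('X_(inord 0) : A).
Local Notation z := ('X_(inord 1) : A).
Local Notation wsize := (mmeasure (wt d a)).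
Local Notation F := (curve C d a).
Local Notation ham := (@hamiltonian C d a).

#[local] Opaque hamiltonian.

(** The conjugate E of the Hamiltonian derivation kills F, that is, F_x E x
    + F_z E z = 0; since F_x and F_z have no common factor, (E x, E z) is a
    multiple of (F_z, - F_x). *)
Lemma ham_conj (phi phi' : {lrmorphism A -> A}) c :
  cancel phi phi' -> cancel phi' phi -> phi' F = c *: F ->
  exists e, forall p, phi (ham (phi' p)) = e * ham p.
Proof.
move=> K K' F_eq; pose E p := phi (ham (phi' p)).
have ED : {morph E : p q / p + q}.
  by move=> p q; rewrite /E (rmorphD phi') hamD (rmorphD phi).
have EM p q : E (p * q) = E p * q + p * E q.
  by rewrite /E (rmorphM phi') hamM rmorphD !(rmorphM phi) /= !K'.
have EC k : E k%:MP = 0.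
  have -> : k%:MP = k *: 1 :> A by rewrite -mul_mpolyC mulr1.
  by rewrite /E linearZ /= hamZ rmorph1 hamC scaler0 rmorph0.
have chain p : E p = p^`M(inord 0) * E x + p^`M(inord 1) * E z.
  apply/eqP; rewrite -subr_eq0; apply/eqP; move: p.
  apply: (mpoly_der_eq0 (h := idfun)) => [p q|p q|k|i] /=.
  - by rewrite ED !mderivD; ring.
  - by rewrite EM !mderivM; ring.
  - by rewrite EC !mderivC; ring.
  elim/ord2P: i; rewrite !mderivU !eqxx ?(negPf ord2_neq).
    by rewrite mul1r mul0r addr0 subrr.
  by rewrite [inord 1 == _]eq_sym (negPf ord2_neq) mul1r mul0r add0r subrr.
have EF : d%:R * x ^+ d.-1 * E x + a%:R * z ^+ a.-1 * E z = 0.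
  rewrite -(mderiv_curve0 C d1 a1) -(mderiv_curve1 C d1 a1) -chain.
  by rewrite /E F_eq hamZ ham_curve scaler0 rmorph0.
(* Coprimality of the two partial derivatives is replaced by the primality
   of F: z^(a-1) times something is divisible by F, and z^(a-1) is not. *)
have FE : d%:R * (F * E x) = z ^+ a.-1 * (d%:R * z * E x - a%:R * x * E z).
  have -> : F = x * x ^+ d.-1 + z * z ^+ a.-1.
    by rewrite -!exprS !prednK; [ | lia | lia].
  apply/eqP; rewrite -subr_eq0; apply/eqP; transitivity (x * 0 : A); last by rewrite mulr0.
  by rewrite -EF; ring.
have [||[e' e'E]] := @curve_prime C d a d1 a1 ad (z ^+ a.-1)
    (d%:R * z * E x - a%:R * x * E z).
- by exists (d%:R * E x); rewrite -FE mulrCA.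
- move=> zF; exfalso; move: zF; rewrite -[z ^+ _]mul1r -[1](expr0 x).
  exact: mono_ndvd.
have d0 : (d%:R : A) != 0 by apply: natr_mpoly_neq0; lia.
have a0 : (a%:R : A) != 0 by apply: natr_mpoly_neq0; lia.
have Ex : d%:R * E x = z ^+ a.-1 * e'.
  apply: (mulfI (curve_neq0 C d a1)).
  by rewrite mulrCA FE e'E mulrCA.
have Ez : a%:R * E z = - (x ^+ d.-1 * e').
  apply: (mulfI (expf_neq0 a.-1 (mpolyX_neq0 C U_(inord 1)))).
  apply/eqP; rewrite -subr_eq0; apply/eqP; rewrite -EF.
  transitivity (a%:R * z ^+ a.-1 * E z + x ^+ d.-1 * (z ^+ a.-1 * e')); first by ring.
  by rewrite -Ex; ring.
exists ((d%:R * a%:R)^-1 *: e') => p; rewrite -/(E p) chain hamE //.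
rewrite -scalerAl.
have da0 : (d%:R * a%:R : C) != 0 by rewrite mulf_neq0 // pnatr_eq0; lia.
apply: (scalerI da0); rewrite scalerA divff // scale1r.
rewrite -mul_mpolyC rmorphM /= !mpolyC_nat.
transitivity (a%:R * p^`M(inord 0) * (d%:R * E x) + d%:R * p^`M(inord 1) * (a%:R * E z)).
  by ring.
by rewrite Ex Ez; ring.
Qed.

(** Let n and m be the weights of phi x and phi z. By [ham_conj] the image
    of ham x = a z^(a-1) is a constant multiple of ham (phi x), and
    [wsize_ham] gives (a - 1) m + a + d <= n + a d. On the other hand (phi
    x)^d + (phi z)^a = c F has weight a d, so that either both powers have
    at most this weight or d n = a m; in both cases n <= a. A multiple of
    F^l is heavier than this, so phi x = k x. Then the same identity says
    that (phi z)^(a-1) is a constant multiple of z^(a-1), and multiplying by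
    phi z yields the claim. *)
Lemma plane_aut_torus (phi phi' : {lrmorphism A -> A}) c k l g :
  cancel phi phi' -> cancel phi' phi -> c != 0 -> phi F = c *: F ->
  (0 < l)%N -> phi x = k *: x + F ^+ l * g ->
  phi x = k *: x /\ exists2 r, r != 0 & phi z = r *: z.
Proof.
move=> K K' c0 phiF l0 phix.
have phi'F : phi' F = c^-1 *: F.
  by apply: (can_inj K); rewrite K' linearZ /= phiF scalerA mulVf // scale1r.
have [e eE] := ham_conj K K' phi'F; have [e' e'E] := ham_conj K' K phiF.
have hamx0 : ham x != 0.
  rewrite ham_x // mulf_neq0 ?expf_neq0 ?mpolyX_neq0 //.
  by apply: natr_mpoly_neq0; lia.
have ee' : e * phi e' = 1%:MP.
  apply: (mulIf hamx0); have -> : 1%:MP * ham x = ham x by rewrite -[1%:MP]/(1 : A) mul1r.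
  rewrite -mulrA mulrCA -eE -(rmorphM phi) -e'E.
  by rewrite K'; exact: K'.
have [u u0 uE] := mpoly_mul_const (oner_neq0 C) ee'.
have hx := eE (phi x); rewrite K ham_x // uE rmorphM rmorph_nat rmorphXn /= in hx.
have phi0 p : p != 0 -> phi p != 0.
  by move=> p0; rewrite -(rmorph0 phi) (inj_eq (can_inj K)).
have x0 := phi0 _ (mpolyX_neq0 C U_(inord 0)).
have z0 := phi0 _ (mpolyX_neq0 C U_(inord 1)).
have wS (p : A) : p != 0 -> wsize p = (wsize p).-1.+1.
  by move=> p0; apply: mpolySpred.
have wM (p q : A) : p != 0 -> q != 0 -> wsize (p * q) = (wsize p + wsize q).-1.
  exact: mmeasureM.
have wD (p q : A) : (wsize (p + q) <= maxn (wsize p) (wsize q))%N.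
  exact: mmeasureD_le.
have wN (p : A) : wsize (- p) = wsize p by exact: mmeasureN.
have wZ (p : A) c' : c' != 0 -> wsize (c' *: p) = wsize p by exact: mmeasureZ.
have sX n (p : A) : p != 0 -> wsize (p ^+ n) = (n * (wsize p).-1).+1.
  move=> p0; elim: n => [|n IHn]; first by rewrite expr0 mmeasure1.
  rewrite exprS wM ?expf_neq0 // IHn.
  by have := wS _ p0; lia.
have sxn := wS _ x0; have szn := wS _ z0.
set n := (wsize (phi x)).-1 in sxn; set m := (wsize (phi z)).-1 in szn.
(* The weights of both sides of hx are compared. *)
have ineq : (a.-1 * m + (a + d) <= n + a * d)%N.
  have := wsize_ham d1 a1 ad (phi x); rewrite sxn.
  have := congr1 wsize hx; rewrite mul_mpolyC wZ // => <-.
  by rewrite -mpolyC_nat mul_mpolyC wZ ?pnatr_eq0 ?sX //; lia.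
have eqF : phi x ^+ d + phi z ^+ a = c *: F by rewrite -phiF rmorphD !rmorphXn.
have sF : wsize (c *: F) = (a * d).+1.
  by rewrite wZ // -[F]expr1 wsize_curveX // muln1.
have sum_size (p q : A) i j : wsize p = i.+1 -> wsize q = j.+1 -> (i < j)%N ->
    wsize (p + q) = j.+1.
  move=> pi qj lt_ij; apply/eqP; rewrite eqn_leq; apply/andP; split.
    by apply: leq_trans (wD _ _) _; rewrite pi qj; lia.
  have := wD (p + q) (- p); rewrite addrC addKr wN pi qj.
  by lia.
have sx := sX d _ x0; have sz := sX a _ z0; rewrite -/n in sx; rewrite -/m in sz.
(* If the two powers have different weights, there is no cancellation in
   their sum; if they have the same weight, the inequality above bounds n,
   except when a = d = 2, which coprimality excludes. *)
have len : (n <= a)%N.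
  case: (ltngtP (d * n) (a * m)) => lt_nm.
  - have := sum_size _ _ _ _ sx sz lt_nm; rewrite eqF sF => -[eq_m]; nia.
  - have := sum_size _ _ _ _ sz sx lt_nm; rewrite addrC eqF sF => -[eq_n]; nia.
  have ne : (a + d < a * d)%N.
    suff : a <> d \/ a <> 2 by nia.
    case: (a =P d) => [ad_eq|]; last by left.
    by move: ad; rewrite ad_eq /coprime gcdnn => /eqP; lia.
  have : (a * (a.-1 * m + (a + d)) <= a * (n + a * d))%N by rewrite leq_mul2l ineq orbT.
  have -> : (a * (a.-1 * m + (a + d)) = a.-1 * (a * m) + a * (a + d))%N by lia.
  by rewrite -lt_nm; nia.
have phixk : phi x = k *: x.
  have [g0|g0] := eqVneq g 0; first by rewrite phix g0 mulr0 addr0.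
  have sFg : (a * d * l < wsize (F ^+ l * g))%N.
    have := wS _ g0.
    by rewrite wM ?expf_neq0 ?curve_neq0 // wsize_curveX //; lia.
  have : (wsize (phi x - k *: x) <= a.+1)%N.
    apply: leq_trans (wD _ _) _; rewrite wN geq_max sxn ltnS len /=.
    apply: leq_trans (mmeasureZ_le _ _ _) _.
    by rewrite mmeasureX; have := wtU0 d a => /= ->.
  rewrite phix addrC addKr; nia.
split=> //.
have k0 : k != 0 by apply: contraNneq x0 => k0; rewrite phixk k0 scale0r.
have zpow : phi z ^+ a.-1 = (u * k) *: z ^+ a.-1.
  have a0 : (a%:R : A) != 0 by apply: natr_mpoly_neq0; lia.
  apply: (mulfI a0); rewrite hx phixk hamZ ham_x //.
  by rewrite -!mul_mpolyC rmorphM /=; ring.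
have za : (u * k) *: (z ^+ a.-1 * phi z) = (c - k ^+ d) *: x ^+ d + c *: z ^+ a.
  rewrite scalerAl -zpow -exprSr prednK; last by lia.
  have -> : phi z ^+ a = c *: F - phi x ^+ d by rewrite -eqF addrC addKr.
  by rewrite phixk exprZn /curve scalerDr scalerBl addrAC.
have uk0 : u * k != 0 by rewrite mulf_neq0.
have ck : c - k ^+ d = 0.
  have := congr1 (meval (fun i => (i == inord 0)%:R : C)) za.
  rewrite mevalZ mevalM mevalD !mevalZ !rmorphXn /= !mevalXU /= eqxx eq_sym.
  rewrite (negPf ord2_neq) expr1n !expr0n.
  have [-> ->] : (a.-1 == 0)%N = false /\ (a == 0)%N = false.
    by split; apply/negbTE; move: a1; case: (a) => [|[|?]].
  by rewrite !mulr0n mul0r mulr0 mulr1 mulr0 addr0.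
exists ((u * k)^-1 * c); first by rewrite mulf_neq0 ?invr_eq0.
apply: (mulfI (expf_neq0 a.-1 (mpolyX_neq0 C U_(inord 1)))).
apply: (scalerI uk0); rewrite za ck scale0r add0r -scalerAr -exprSr prednK; last by lia.
by rewrite scalerA mulrA mulfV // mul1r.
Qed.

End PlaneAutomorphism.

(** * Presentation and normal form of the coordinate ring *)

Section Presentation.
Local Open Scope quotient_scope.
Variables (F : fieldType) (d l a2 a3 : nat).
Local Notation B := (kr_ring F d l a2 a3).

Definition krpi : {mpoly F[4]} -> B := \pi_{ideal_quot (@kr_ideal F d l a2 a3)}.

Fact krpi_zmod : zmod_morphism krpi. Proof. exact: raddfB. Qed.
HB.instance Definition _ := GRing.isZmodMorphism.Build _ _ krpi krpi_zmod.
Fact krpi_monoid : monoid_morphism krpi.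
Proof. by split; [exact: rmorph1 | exact: rmorphM]. Qed.
HB.instance Definition _ := GRing.isMonoidMorphism.Build _ _ krpi krpi_monoid.
Fact krpi_scal : scalable krpi.
Proof. by move=> c p; rewrite /krpi pi_scale. Qed.
HB.instance Definition _ := GRing.isScalable.Build F _ B *:%R krpi krpi_scal.

Lemma krpi_surj (b : B) : exists p, b = krpi p.
Proof. by exists (repr b); rewrite /krpi reprK. Qed.

Lemma krpi_eq0 p : krpi p = 0 -> exists q, p = q * kr_poly F d l a2 a3.
Proof.
move=> /eqP; rewrite -(rmorph0 krpi) -Quotient.idealrBE subr0.
by move/asboolP.
Qed.

Lemma krpi_poly : krpi (kr_poly F d l a2 a3) = 0.
Proof.
apply/eqP; rewrite -(rmorph0 krpi) -Quotient.idealrBE subr0.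
by apply/asboolP; exists 1; rewrite mul1r.
Qed.

Lemma kr_lift (S : nzRingType) (f : {rmorphism {mpoly F[4]} -> S}) :
  f (kr_poly F d l a2 a3) = 0 ->
  exists g : {rmorphism B -> S}, forall p, g (krpi p) = f p.
Proof.
move=> f0; pose g (b : B) := f (repr b).
have gE p : g (krpi p) = f p.
  apply/eqP; rewrite -subr_eq0 -rmorphB; apply/eqP.
  have [|q ->] := @krpi_eq0 (repr (krpi p) - p).
    by rewrite rmorphB /= {1}/krpi reprK subrr.
  by rewrite rmorphM f0 mulr0.
have gB : zmod_morphism g.
  move=> u v; have [p ->] := krpi_surj u; have [q ->] := krpi_surj v.
  by rewrite -rmorphB !gE rmorphB.
have gM : monoid_morphism g.
  split=> [|u v]; first by rewrite -(rmorph1 krpi) gE rmorph1.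
  have [p ->] := krpi_surj u; have [q ->] := krpi_surj v.
  by rewrite -rmorphM !gE rmorphM.
pose g1 := GRing.isZmodMorphism.Build B S g gB.
pose g2 := GRing.isMonoidMorphism.Build B S g gM.
pose g' : {rmorphism B -> S} := HB.pack g g1 g2.
by exists g'.
Qed.

Lemma kr_lift_alg (S : comAlgType F) (f : {lrmorphism {mpoly F[4]} -> S}) :
  f (kr_poly F d l a2 a3) = 0 ->
  exists g : {lrmorphism B -> S}, forall p, g (krpi p) = f p.
Proof.
move=> f0; have [g gE] := @kr_lift S f f0.
have gZ : scalable g.
  by move=> c u; have [p ->] := krpi_surj u; rewrite -(linearZZ krpi) !gE; exact: (linearZZ f).
pose g3 := GRing.isScalable.Build F B S *:%R g gZ.
pose g' : {lrmorphism B -> S} := HB.pack (g : B -> S) g g3.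
by exists g'.
Qed.

Lemma krpi_x : krpi 'X_(inord 0) = kr_x F d l a2 a3. Proof. by []. Qed.
Lemma krpi_y : krpi 'X_(inord 1) = kr_y F d l a2 a3. Proof. by []. Qed.
Lemma krpi_z : krpi 'X_(inord 2) = kr_z F d l a2 a3. Proof. by []. Qed.
Lemma krpi_t : krpi 'X_(inord 3) = kr_t F d l a2 a3. Proof. by []. Qed.

Lemma ord4P (P : 'I_4 -> Prop) :
  P (inord 0) -> P (inord 1) -> P (inord 2) -> P (inord 3) -> forall i, P i.
Proof.
move=> P0 P1 P2 P3 [[|[|[|[|//]]]] i4].
- by have -> : Ordinal i4 = inord 0 by apply: val_inj; rewrite /= inordK.
- by have -> : Ordinal i4 = inord 1 by apply: val_inj; rewrite /= inordK.
- by have -> : Ordinal i4 = inord 2 by apply: val_inj; rewrite /= inordK.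
- by have -> : Ordinal i4 = inord 3 by apply: val_inj; rewrite /= inordK.
Qed.

Lemma kr_lrmorph_ext (S : comAlgType F) (f g : {lrmorphism B -> S}) :
  f (kr_x F d l a2 a3) = g (kr_x F d l a2 a3) ->
  f (kr_y F d l a2 a3) = g (kr_y F d l a2 a3) ->
  f (kr_z F d l a2 a3) = g (kr_z F d l a2 a3) ->
  f (kr_t F d l a2 a3) = g (kr_t F d l a2 a3) -> f =1 g.
Proof.
move=> fx fy fz ft b; have [p ->] := krpi_surj b.
apply: (mpoly_lrmorph_ext (f := f \o krpi) (g := g \o krpi)) => i /=.
by elim/ord4P: i.
Qed.

Lemma kr_ind (S : B -> Prop) : S 1 -> (forall u v, S u -> S v -> S (u + v)) ->
  (forall c u, S u -> S (c *: u)) ->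
  (forall u, S u -> S (kr_x F d l a2 a3 * u)) ->
  (forall u, S u -> S (kr_y F d l a2 a3 * u)) ->
  (forall u, S u -> S (kr_z F d l a2 a3 * u)) ->
  (forall u, S u -> S (kr_t F d l a2 a3 * u)) -> forall b, S b.
Proof.
move=> S1 SD SZ Sx Sy Sz St b; have [p ->] := krpi_surj b.
have S0 : S 0 by rewrite -(scale0r 1); apply: SZ.
rewrite (mpolyE p) linear_sum; elim/big_ind: _ => //= m _.
rewrite linearZ /=; apply: SZ; rewrite mpolyXE_id rmorph_prod.
elim: (index_enum _) => [|i s IHs]; first by rewrite big_nil.
rewrite big_cons /= rmorphXn; elim: (m i) => [|k IHk]; first by rewrite expr0 mul1r.
rewrite exprS -mulrA; move: IHk; move: (_ * _) => u.
by elim/ord4P: i; [apply: Sx | apply: Sy | apply: Sz | apply: St].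
Qed.

Definition kr_xz (p : {mpoly F[2]}) : B :=
  krpi (p \mPo [tuple 'X_(inord 0); 'X_(inord 2)]).
HB.instance Definition _ := GRing.LRMorphism.copy kr_xz
  (krpi \o comp_mpoly [tuple 'X_(inord 0); 'X_(inord 2)]).

Lemma kr_xz_x : kr_xz 'X_(inord 0) = kr_x F d l a2 a3.
Proof. by rewrite /kr_xz comp_mpolyXU inordK. Qed.
Lemma kr_xz_z : kr_xz 'X_(inord 1) = kr_z F d l a2 a3.
Proof. by rewrite /kr_xz comp_mpolyXU inordK. Qed.

End Presentation.

Section NormalForm.
Variables (C : numClosedFieldType) (d l a2 a3 : nat).
Hypotheses (d1 : (1 < d)%N) (l0 : (0 < l)%N) (a21 : (1 < a2)%N) (a31 : (1 < a3)%N).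

Local Notation A := {mpoly C[2]}.
Local Notation B := (kr_ring C d l a2 a3).
Local Notation xB := (kr_x C d l a2 a3).
Local Notation yB := (kr_y C d l a2 a3).
Local Notation zB := (kr_z C d l a2 a3).
Local Notation tB := (kr_t C d l a2 a3).
Local Notation F := (curve C d a2).
Local Notation jA := (@kr_xz C d l a2 a3).

Lemma kr_curve : jA F = xB ^+ d + zB ^+ a2.
Proof. by rewrite /curve rmorphD !rmorphXn /= kr_xz_x kr_xz_z. Qed.

Lemma kr_rel : xB + yB * jA (F ^+ l) + tB ^+ a3 = 0.
Proof.
rewrite rmorphXn /= kr_curve -(krpi_poly C d l a2 a3) /kr_poly.
by rewrite !(rmorphD, rmorphM, rmorphXn).
Qed.

(** The monomial y^q t^r with i = q a3 + r and r < a3; its degree in t, in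
    the sense of the embedding in Frac(A)[t], is i. *)
Definition yt_monomial i : B := yB ^+ (i %/ a3) * tB ^+ (i %% a3).

Local Notation kr_e := yt_monomial.

(** B is a free A-module on the monomials y^q t^r with r < a3: the
    coefficients of a polynomial over A serve as coordinates. *)
Definition normal_form (P : {poly A}) : B := \sum_(i < size P) jA P`_i * kr_e i.

Local Notation nf := normal_form.

Lemma nfE n (P : {poly A}) : (size P <= n)%N -> nf P = \sum_(i < n) jA P`_i * kr_e i.
Proof.
move=> le_n; rewrite /normal_form (big_ord_widen n (fun i => jA P`_i * kr_e i) le_n).
rewrite big_mkcond; apply: eq_bigr => i _; case: ltnP => // /leq_sizeP -> //.
by rewrite rmorph0 mul0r.
Qed.

Lemma nf_zmod : zmod_morphism nf.
Proof.
move=> P Q; pose n := maxn (size P) (size Q).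
rewrite (@nfE n P) ?leq_maxl // (@nfE n Q) ?leq_maxr // (@nfE n (P - Q)); last first.
  by rewrite -(size_polyN Q) in n *; apply: size_polyD.
rewrite -sumrB; apply: eq_bigr => i _.
by rewrite coefB rmorphB mulrBl.
Qed.

Lemma nf0 : nf 0 = 0. Proof. by rewrite /normal_form size_poly0 big_ord0. Qed.
Lemma nfB P Q : nf (P - Q) = nf P - nf Q. Proof. exact: nf_zmod. Qed.
Lemma nfN P : nf (- P) = - nf P. Proof. by rewrite -[- P]add0r nfB nf0 add0r. Qed.
Lemma nfD P Q : nf (P + Q) = nf P + nf Q. Proof. by rewrite -[Q]opprK nfB nfN !opprK. Qed.
Lemma nf_sum (I : Type) (r : seq I) (Q : I -> {poly A}) :
  nf (\sum_(i <- r) Q i) = \sum_(i <- r) nf (Q i).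
Proof.
by elim: r => [|i r IHr]; rewrite ?big_nil ?nf0 // !big_cons nfD IHr.
Qed.

Lemma nfZ (p : A) (P : {poly A}) : nf (p *: P) = jA p * nf P.
Proof.
rewrite (nfE (size_scale_leq p P)) /normal_form mulr_sumr; apply: eq_bigr => i _.
by rewrite coefZ rmorphM mulrA.
Qed.

Lemma nfXn i : nf 'X^i = kr_e i.
Proof.
rewrite /normal_form size_polyXn big_ord_recr /= big1 => [|j _].
  by rewrite add0r coefXn eqxx rmorph1 mul1r.
by rewrite coefXn ltn_eqF // rmorph0 mul0r.
Qed.

Lemma kr_eDl i : kr_e (a3 + i) = yB * kr_e i.
Proof.
by rewrite /yt_monomial divnDl ?dvdnn // divnn (ltnW a31) modnDl exprS mulrA.
Qed.

(** Multiplication by t either increases r, or replaces t^a3 by - x - y F^l. *)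
Lemma kr_eS i : tB * kr_e i =
  if (i %% a3 == a3.-1)%N then - (xB * kr_e (i - a3.-1)) - jA (F ^+ l) * kr_e i.+1
  else kr_e i.+1.
Proof.
have a30 : (0 < a3)%N by lia.
have iE := divn_eq i a3; have lt_i := ltn_pmod i a30.
set q := (i %/ a3)%N in iE; set r := (i %% a3)%N in iE lt_i *.
case: eqP => [rE|/eqP rE]; last first.
  have eq1 : (i.+1 = q * a3 + r.+1)%N by rewrite addnS -iE.
  have lt_r : (r.+1 < a3)%N by lia.
  rewrite {2}/yt_monomial eq1 divnMDl // divn_small // addn0 modnMDl modn_small //.
  by rewrite /yt_monomial -/q -/r exprS mulrCA.
have eq1 : (i.+1 = q.+1 * a3)%N by rewrite mulSn iE rE; lia.
have eq2 : (i - a3.-1 = q * a3)%N by rewrite iE rE addnK.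
rewrite eq1 eq2 /yt_monomial !mulnK // !modnMl -/q -/r !expr0 !mulr1 mulrCA rE -exprS prednK //.
have -> : tB ^+ a3 = - (xB + yB * jA (F ^+ l)).
  by apply/eqP; rewrite -addr_eq0 addrC kr_rel.
by rewrite exprS; ring.
Qed.

Lemma nf_surj b : exists P, b = nf P.
Proof.
have nfS P : exists Q, tB * nf P = nf Q.
  rewrite {1}/normal_form mulr_sumr; elim/big_ind: _ => [|u v [P1 ->] [P2 ->]|i _].
  - by exists 0; rewrite nf0.
  - by exists (P1 + P2); rewrite nfD.
  rewrite mulrCA kr_eS; case: ifP => _.
    exists (P`_i *: (- ('X_(inord 0) *: 'X^(i - a3.-1)) - (F ^+ l) *: 'X^(i.+1))).
    by rewrite nfZ nfB nfN !nfZ !nfXn kr_xz_x.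
  by exists (P`_i *: 'X^(i.+1)); rewrite nfZ nfXn.
apply: (kr_ind (S := fun b => exists P, b = nf P)).
- by exists 'X^0; rewrite nfXn /yt_monomial div0n mod0n !expr0 mulr1.
- by move=> u v [P ->] [Q ->]; exists (P + Q); rewrite nfD.
- move=> c u [P ->]; exists (c%:MP *: P); rewrite nfZ.
  by rewrite -[c%:MP]mulr1 mul_mpolyC linearZ /= rmorph1 -scalerAl mul1r.
- by move=> u [P ->]; exists ('X_(inord 0) *: P); rewrite nfZ kr_xz_x.
- move=> u [P ->]; exists (\sum_(i < size P) P`_i *: 'X^(a3 + i)).
  rewrite nf_sum {1}/normal_form mulr_sumr; apply: eq_bigr => i _ /=.
  by rewrite nfZ nfXn kr_eDl mulrCA.
- by move=> u [P ->]; exists ('X_(inord 1) *: P); rewrite nfZ kr_xz_z.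
- by move=> u [P ->]; apply: nfS.
Qed.

End NormalForm.

(** * The bidegree filtration *)

Lemma mpoly_rmorph_ext n (R : nzRingType) (S : nzRingType)
    (f g : {rmorphism {mpoly R[n]} -> S}) :
  (forall c, f c%:MP = g c%:MP) -> (forall i, f 'X_i = g 'X_i) -> f =1 g.
Proof.
move=> fgC fgX p; rewrite (mpolyE p) !rmorph_sum; apply: eq_bigr => m _ /=.
rewrite -mul_mpolyC !rmorphM fgC; congr (_ * _).
rewrite mpolyXE_id; elim: (index_enum _) => [|i s IHs].
  by rewrite !big_nil !rmorph1.
by rewrite !big_cons !rmorphM IHs !rmorphXn /= fgX.
Qed.

Definition lexle (g h : int * int) : bool := (g.1 < h.1) || (g.1 == h.1) && (g.2 <= h.2).
Definition lexlt (g h : int * int) : bool := (g.1 < h.1) || (g.1 == h.1) && (g.2 < h.2).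

Lemma lexleP g h : reflect (g.1 < h.1 \/ g.1 = h.1 /\ g.2 <= h.2) (lexle g h).
Proof.
apply: (iffP orP) => [[|/andP[/eqP]]|[|[-> ->]]]; [by left|by right|by left|].
by right; rewrite eqxx.
Qed.
Lemma lexltP g h : reflect (g.1 < h.1 \/ g.1 = h.1 /\ g.2 < h.2) (lexlt g h).
Proof.
apply: (iffP orP) => [[|/andP[/eqP]]|[|[-> ->]]]; [by left|by right|by left|].
by right; rewrite eqxx.
Qed.
Lemma pair_add1 (g h : int * int) : (g + h).1 = g.1 + h.1. Proof. by []. Qed.
Lemma pair_add2 (g h : int * int) : (g + h).2 = g.2 + h.2. Proof. by []. Qed.
Lemma pair_mul1 (g : int * int) n : (g *+ n).1 = g.1 *+ n.
Proof. by elim: n => // n IHn; rewrite !mulrS pair_add1 IHn. Qed.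
Lemma pair_mul2 (g : int * int) n : (g *+ n).2 = g.2 *+ n.
Proof. by elim: n => // n IHn; rewrite !mulrS pair_add2 IHn. Qed.

Lemma lexltW g h : lexlt g h -> lexle g h.
Proof. by move/lexltP => lt_gh; apply/lexleP; lia. Qed.
Lemma lexle_refl g : lexle g g.
Proof. by apply/lexleP; right. Qed.
Lemma lexle_trans g h k : lexle g h -> lexle h k -> lexle g k.
Proof. by move=> /lexleP ? /lexleP ?; apply/lexleP; lia. Qed.
Lemma lexle_lt_trans g h k : lexle g h -> lexlt h k -> lexlt g k.
Proof. by move=> /lexleP ? /lexltP ?; apply/lexltP; lia. Qed.
Lemma lexlt_irr g : lexlt g g -> False.
Proof. by move/lexltP; lia. Qed.

Lemma lexD_le g h g' h' : lexle g g' -> lexle h h' -> lexle (g + h) (g' + h').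
Proof.
move: g h g' h' => [? ?] [? ?] [? ?] [? ?] /lexleP /= ? /lexleP /= ?.
by apply/lexleP => /=; lia.
Qed.
Lemma lexD_lt g h g' h' : lexlt g g' -> lexle h h' -> lexlt (g + h) (g' + h').
Proof.
move: g h g' h' => [? ?] [? ?] [? ?] [? ?] /lexltP /= ? /lexleP /= ?.
by apply/lexltP => /=; lia.
Qed.
Lemma lexD_lt_inv g h g' h' : lexle g g' -> lexle h h' ->
  lexlt (g + h) (g' + h') -> lexlt g g' \/ lexlt h h'.
Proof.
move: g h g' h' => [? ?] [? ?] [? ?] [? ?] /lexleP /= gg /lexleP /= hh /lexltP /= gh.
set G := lexlt _ _; have [|/lexltP /= ng] := boolP G; first by left.
by right; apply/lexltP => /=; lia.
Qed.

(** The next two lemmas are the bookkeeping of weights in [pdegM], stated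
    over plain variables. *)
Lemma pdeg_arith1 (u v t : nat) : (u.+1 + (v.+1 + t.+1).-1).-1 = (u + v + t).+1.
Proof. by lia. Qed.

Lemma pdeg_arith2 (D p q n m k l : nat) :
  (D * (l * k) + p + q)%N%:Z - (D * l * (n + m + k))%N%:Z =
  p%:Z - (D * l * n)%N%:Z + (q%:Z - (D * l * m)%N%:Z).
Proof.
by rewrite !mulnDr mulnA !PoszD; ring.
Qed.

Section Bidegree.
Variables (C : numClosedFieldType) (d l a2 a3 : nat).
Hypotheses (d1 : (1 < d)%N) (l0 : (0 < l)%N) (a21 : (1 < a2)%N) (a31 : (1 < a3)%N).

Local Notation A := {mpoly C[2]}.
Local Notation B := (kr_ring C d l a2 a3).
Local Notation yB := (kr_y C d l a2 a3).
Local Notation tB := (kr_t C d l a2 a3).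
Local Notation F := (curve C d a2).
Local Notation jA := (@kr_xz C d l a2 a3).
Local Notation nf := (@normal_form C d l a2 a3).
Local Notation kr_e := (@yt_monomial C d l a2 a3).
Local Notation K := {fraction A}.
Local Notation "x %:F" := (@tofrac _ x).
Local Notation wsize := (mmeasure (wt d a2)).
Local Notation whom e := (ishomog1 e (wt d a2)).

(** The leading coefficient in t of y = - (x + t^a3) / F^l. *)
Definition yfac : K := - ((F ^+ l)%:F)^-1.
Local Notation w := yfac.

Lemma curvel_neq0 : F ^+ l != 0. Proof. by rewrite expf_neq0 ?curve_neq0. Qed.

Lemma yfac_neq0 : w != 0.
Proof. by rewrite oppr_eq0 invr_eq0 tofrac_eq0 curvel_neq0. Qed.

(** The ring B maps to Frac(A)[t] by solving its equation for y. *)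
Lemma iota_ex : exists f : {rmorphism B -> {poly K}},
  [/\ forall p, f (jA p) = (p%:F)%:P, f tB = 'X &
      f yB = w *: ('X^a3 + ('X_(inord 0) : A)%:F%:P)].
Proof.
pose fC : {rmorphism C -> {poly K}} := @polyC K \o (@tofrac A \o @mpolyC 2 C).
have [g gE] : exists g : {rmorphism A -> {poly K}}, forall p, g p = (p%:F)%:P.
  by exists (@polyC K \o @tofrac A).
pose h (i : 'I_4) : {poly K} := nth 0 [:: g 'X_(inord 0);
  w *: ('X^a3 + g 'X_(inord 0)); g 'X_(inord 1); 'X] i.
pose f0 : {rmorphism {mpoly C[4]} -> {poly K}} := mmap fC h.
have f0X i : f0 'X_i = h i by rewrite /f0 /= mmapX mmap1U.
have hE k : (k < 4)%N -> h (inord k) = nth 0 [:: g 'X_(inord 0);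
  w *: ('X^a3 + g 'X_(inord 0)); g 'X_(inord 1); 'X] k.
  by move=> lt_k; rewrite /h inordK.
have [|f fE] := @kr_lift C d l a2 a3 _ f0.
  rewrite /kr_poly !(rmorphD f0, rmorphM f0, rmorphXn f0) !f0X !hE //.
  rewrite [nth _ _ 0]/= [nth _ _ 1]/= [nth _ _ 2]/= [nth _ _ 3]/=.
  have -> : g 'X_(inord 0) ^+ d + g 'X_(inord 1) ^+ a2 = g F.
    by rewrite /curve rmorphD !rmorphXn.
  rewrite -(rmorphXn g) !gE.
  rewrite [_ * _%:P]mulrC mul_polyC scalerA /yfac mulrN mulfV ?tofrac_eq0 ?curvel_neq0 //.
  by rewrite scaleN1r opprD addrCA subrr addr0 addNr.
exists f; split=> [||]; last 2 first.
- by rewrite -krpi_t fE f0X hE.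
- by rewrite -krpi_y fE f0X hE // -gE.
move=> p; rewrite -gE; move: p.
apply: (mpoly_rmorph_ext (f := f \o jA) (g := g)) => [c|] /=.
  by rewrite /kr_xz comp_mpolyC fE /f0 /= mmapC gE.
elim/ord2P; first by rewrite kr_xz_x -krpi_x fE f0X hE.
by rewrite kr_xz_z -krpi_z fE f0X hE.
Qed.

Definition iota : {rmorphism B -> {poly K}} := sval (cid iota_ex).
Lemma iota_xz p : iota (jA p) = (p%:F)%:P.
Proof. by rewrite /iota; case: (cid _) => f []. Qed.
Lemma iota_t : iota tB = 'X.
Proof. by rewrite /iota; case: (cid _) => f []. Qed.
Lemma iota_y : iota yB = w *: ('X^a3 + ('X_(inord 0) : A)%:F%:P).
Proof. by rewrite /iota; case: (cid _) => f []. Qed.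

Lemma iota_y_size : size (iota yB) = a3.+1 /\ lead_coef (iota yB) = w.
Proof.
rewrite iota_y size_scale ?yfac_neq0 // lead_coefZ.
rewrite -[X in 'X^a3 + X]opprK -polyCN lead_coefXnsubC ?size_XnsubC; try lia.
by rewrite mulr1.
Qed.

Lemma iota_e i : size (iota (kr_e i)) = i.+1 /\ lead_coef (iota (kr_e i)) = w ^+ (i %/ a3).
Proof.
have [sy ly] := iota_y_size.
have y0 : iota yB != 0 by rewrite -size_poly_eq0 sy.
rewrite /yt_monomial rmorphM !rmorphXn /= iota_t lead_coefM !lead_coef_exp ly lead_coefX expr1n.
rewrite mulr1; split=> //; rewrite size_mul ?expf_neq0 ?polyX_eq0 //.
rewrite size_polyXn addnS /=; have := size_exp (iota yB) (i %/ a3).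
rewrite sy /= => sE; have sy0 : (0 < size (iota yB ^+ (i %/ a3)))%N.
  by rewrite lt0n size_poly_eq0 expf_neq0.
by rewrite -(prednK sy0) sE addSn mulnC -divn_eq.
Qed.

(** The monomials y^q t^r with r < a3 have distinct degrees in t, so that
    the leading term of a normal form is that of its last term. This gives
    the injectivity of both the normal form and the embedding. *)
Lemma iota_nf P : P != 0 -> size (iota (nf P)) = size P /\
  lead_coef (iota (nf P)) = (lead_coef P)%:F * w ^+ ((size P).-1 %/ a3).
Proof.
move=> P0; have sP : size P = (size P).-1.+1 by rewrite prednK // lt0n size_poly_eq0.
set n := (size P).-1 in sP *.
have lP0 : (lead_coef P)%:F != 0 :> K by rewrite tofrac_eq0 lead_coef_eq0.
have E : iota (nf P) = \sum_(i < n) (P`_i)%:F *: iota (kr_e i) +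
    (lead_coef P)%:F *: iota (kr_e n).
  rewrite /normal_form sP big_ord_recr rmorphD rmorph_sum /= rmorphM iota_xz mul_polyC.
  by congr (_ + _); apply: eq_bigr => i _; rewrite rmorphM /= iota_xz mul_polyC.
have [sn ln] := iota_e n.
have slt : (size (\sum_(i < n) (P`_i)%:F *: iota (kr_e i))%R <
    size ((lead_coef P)%:F *: iota (kr_e n)))%N.
  rewrite size_scale // sn ltnS; apply: leq_trans (size_sum _ _ _) _.
  apply/bigmax_leqP => i _.
  by apply: leq_trans (size_scale_leq _ _) _; rewrite (iota_e i).1.
rewrite E addrC size_polyDl // lead_coefDl // size_scale // lead_coefZ ln sn.
by rewrite sP.
Qed.

Lemma nf_eq0 P : (nf P == 0) = (P == 0).
Proof.
apply/eqP/eqP => [nP0|->]; last exact: nf0.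
apply/eqP; apply: contraT => P0; have [] := iota_nf P0.
by rewrite nP0 rmorph0 size_poly0 => /esym/eqP; rewrite size_poly_eq0 (negPf P0).
Qed.

Lemma nf_inj : injective nf.
Proof.
move=> P Q PQ; apply/eqP; rewrite -subr_eq0 -nf_eq0; apply/eqP.
by rewrite nfB PQ subrr.
Qed.

Lemma iota_inj : injective iota.
Proof.
move=> u v; have [P ->] := nf_surj d1 l0 a21 a31 u; have [Q ->] := nf_surj d1 l0 a21 a31 v.
move=> PQ; apply/eqP; rewrite -subr_eq0 -nfB nf_eq0.
apply: contraT => PQ0; have [] := iota_nf PQ0.
rewrite nfB rmorphB /= PQ subrr size_poly0 => /esym/eqP.
by rewrite size_poly_eq0 (negPf PQ0).
Qed.

Lemma kr_mul_eq0 (u v : B) : u * v = 0 -> u = 0 \/ v = 0.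
Proof.
move=> /(congr1 iota) /eqP; rewrite rmorphM rmorph0 mulf_eq0 -!(rmorph0 iota).
by case/orP => /eqP /iota_inj; [left | right].
Qed.

Lemma jA_inj : injective jA.
Proof.
move=> p q /(congr1 iota); rewrite !iota_xz => /polyC_inj /eqP.
by rewrite tofrac_eq => /eqP.
Qed.

(** The degree of a term p y^q t^r with q a3 + r = i and p of weight k: its
    degree in t, then the weight of its leading coefficient, to which each
    factor y contributes - a2 d l, the weight of F^-l. *)
Definition bideg i k : int * int := (i%:Z, k%:Z - (a2 * d * l * (i %/ a3))%N%:Z).

Definition pdeg (P : {poly A}) := bideg (size P).-1 (wsize (lead_coef P)).-1.

(** The degree in t and the weight of the leading coefficient are both
    additive. When r + r' >= a3 the product of two basis monomials has one
    more factor y, and the coefficient one more factor F^l; then k = 1, and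
    k = 0 otherwise. *)
Lemma pdegM P Q R : P != 0 -> Q != 0 -> nf P * nf Q = nf R ->
  R != 0 /\ pdeg R = pdeg P + pdeg Q.
Proof.
move=> P0 Q0 eqR; have R0 : R != 0.
  rewrite -nf_eq0 -eqR; apply/eqP => /kr_mul_eq0[] /eqP; rewrite nf_eq0.
    by rewrite (negPf P0).
  by rewrite (negPf Q0).
split=> //; have [sP lP] := iota_nf P0; have [sQ lQ] := iota_nf Q0.
have [sR lR] := iota_nf R0.
have sPpos : size P = (size P).-1.+1 by rewrite prednK // lt0n size_poly_eq0.
have sQpos : size Q = (size Q).-1.+1 by rewrite prednK // lt0n size_poly_eq0.
have iP0 : iota (nf P) != 0 by rewrite -size_poly_eq0 sP size_poly_eq0.
have iQ0 : iota (nf Q) != 0 by rewrite -size_poly_eq0 sQ size_poly_eq0.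
have sRE : (size R).-1 = ((size P).-1 + (size Q).-1)%N.
  by have := size_mul iP0 iQ0; rewrite -rmorphM eqR sR sP sQ; lia.
have := lead_coefM (iota (nf P)) (iota (nf Q)).
rewrite -rmorphM /= eqR lR lP lQ /pdeg sRE.
set n := (size P).-1; set m := (size Q).-1.
set p := lead_coef P; set q := lead_coef Q; set r := lead_coef R.
have p0 : p != 0 by rewrite lead_coef_eq0.
have q0 : q != 0 by rewrite lead_coef_eq0.
have r0 : r != 0 by rewrite lead_coef_eq0.
have lenm : (n %/ a3 + m %/ a3 <= (n + m) %/ a3)%N.
  rewrite leq_divRL; last exact: ltnW a31.
  by rewrite mulnDl; apply: leq_add; rewrite leq_trunc_div.
move kE: ((n + m) %/ a3 - (n %/ a3 + m %/ a3))%N => k.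
have nmE : ((n + m) %/ a3)%N = (n %/ a3 + m %/ a3 + k)%N by rewrite -kE subnKC.
rewrite nmE.
rewrite mulrACA -(exprD w (n %/ a3)) (exprD w (n %/ a3 + m %/ a3)) => eqw.
have w0 i : w ^+ i != 0 by rewrite expf_neq0 ?yfac_neq0.
have {eqw} eq_r : w ^+ k * r%:F = p%:F * q%:F.
  by apply: (mulIf (w0 (n %/ a3 + m %/ a3)%N)); rewrite -eqw mulrC [w ^+ k * _]mulrC mulrCA.
have wFl : w * (F ^+ l)%:F = (- 1)%:F.
  by rewrite /yfac mulNr mulVf ?tofrac_eq0 ?curvel_neq0 // tofracN tofrac1.
have rE : (-1) ^+ k * r = F ^+ (l * k) * (p * q).
  have wk : w ^+ k * ((F ^+ l) ^+ k)%:F = ((- 1) ^+ k)%:F.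
    by rewrite tofracXn -exprMn wFl -tofracXn.
  apply/eqP; rewrite -tofrac_eq exprM !tofracM -eq_r -wk -mulrA mulrCA.
  by apply/eqP; congr (_ * _).
have sgnE : (-1) ^+ k = ((-1) ^+ k)%:MP :> A by rewrite rmorphXn rmorphN rmorph1.
have := congr1 wsize rE; rewrite sgnE mul_mpolyC.
rewrite mmeasureZ ?expf_neq0 ?oppr_eq0 ?oner_eq0 //.
rewrite !mmeasureM ?mulf_neq0 ?expf_neq0 ?curve_neq0 // wsize_curveX //.
have wS (u : A) : u != 0 -> wsize u = (wsize u).-1.+1 by move=> u0; apply: mpolySpred.
move=> sr; have sr' : wsize r = (a2 * d * (l * k) + (wsize p).-1 + (wsize q).-1).+1.
  by rewrite sr {1}(wS _ p0) {1}(wS _ q0); apply: pdeg_arith1.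
apply: injective_projections; rewrite ?pair_add1 ?pair_add2 /=.
  exact: PoszD.
by rewrite sr' /= nmE; apply: pdeg_arith2.
Qed.

(** All terms of P have a bidegree related to g by rl, which is the large or
    the strict lexicographic order. *)
Definition pole (rl : int * int -> int * int -> bool) g (P : {poly A}) :=
  forall i m, (P`_i)@_m != 0 -> rl (bideg i (wt d a2 m)) g.

Lemma wtop (p : A) : p != 0 -> exists2 m, p@_m != 0 & wt d a2 m = (wsize p).-1.
Proof.
move=> p0; have sp : wsize p = (wsize p).-1.+1 by apply: mpolySpred.
have [//|nex] := pselect (exists2 m, p@_m != 0 & wt d a2 m = (wsize p).-1).
have /mmeasure_leP : forall m, p@_m != 0 -> (wt d a2 m < (wsize p).-1)%N.
  move=> m m_p; rewrite ltn_neqAle; apply/andP; split.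
    by apply/eqP => mE; apply: nex; exists m.
  rewrite -ltnS -sp; apply: (mmeasure_mnm_lt (wt d a2)).
  by rewrite mcoeff_msupp.
by rewrite sp ltnn.
Qed.

Lemma bideg_le i k k' : (k <= k')%N -> lexle (bideg i k) (bideg i k').
Proof. by move=> le_k; apply/lexleP; right; split=> //=; lia. Qed.

Lemma bideg_lt i k k' : (k < k')%N -> lexlt (bideg i k) (bideg i k').
Proof. by move=> le_k; apply/lexltP; right; split=> //=; lia. Qed.

Lemma bideg_lt1 i i' k k' : (i < i')%N -> lexlt (bideg i k) (bideg i' k').
Proof. by move=> le_k; apply/lexltP; left => /=; lia. Qed.

Lemma pdeg_max (P : {poly A}) : P != 0 -> pole lexle (pdeg P) P.
Proof.
move=> P0 i m m_P; have sP : size P = (size P).-1.+1.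
  by rewrite prednK // lt0n size_poly_eq0.
have : (i < size P)%N.
  by rewrite ltnNge; apply: contraNN m_P => /leq_sizeP ->; rewrite ?mcoeff0.
rewrite sP ltnS leq_eqVlt => /orP[/eqP iE|lt_i]; last first.
  exact/lexltW/bideg_lt1.
rewrite iE in m_P *; apply: bideg_le; rewrite -ltnS -mpolySpred ?lead_coef_eq0 //.
by apply: (mmeasure_mnm_lt (wt d a2)); rewrite mcoeff_msupp.
Qed.

Lemma pdeg_attained (P : {poly A}) : P != 0 ->
  exists i m, (P`_i)@_m != 0 /\ bideg i (wt d a2 m) = pdeg P.
Proof.
rewrite -lead_coef_eq0 => /wtop[m m_P mE]; exists (size P).-1, m.
by rewrite /pdeg -mE; split.
Qed.

Lemma pole_leP g (P : {poly A}) : pole lexle g P <-> (P != 0 -> lexle (pdeg P) g).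
Proof.
split=> [gP /pdeg_attained [i [m [m_P <-]]]|gP i m m_P]; first exact: gP.
have P0 : P != 0 by apply: contraNneq m_P => ->; rewrite coef0 mcoeff0.
exact: lexle_trans (pdeg_max P0 m_P) (gP P0).
Qed.

Lemma pole_ltP g (P : {poly A}) : pole lexlt g P <-> (P != 0 -> lexlt (pdeg P) g).
Proof.
split=> [gP /pdeg_attained [i [m [m_P <-]]]|gP i m m_P]; first exact: gP.
have P0 : P != 0 by apply: contraNneq m_P => ->; rewrite coef0 mcoeff0.
exact: lexle_lt_trans (pdeg_max P0 m_P) (gP P0).
Qed.

Definition kr_fil (rl : int * int -> int * int -> bool) g (b : B) :=
  exists2 P, b = nf P & pole rl g P.

Lemma kr_fil0 rl g : kr_fil rl g 0.
Proof. by exists 0; [rewrite nf0 | move=> i m; rewrite coef0 mcoeff0 eqxx]. Qed.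

Lemma kr_filD rl g u v : kr_fil rl g u -> kr_fil rl g v -> kr_fil rl g (u + v).
Proof.
move=> [P -> gP] [Q -> gQ]; exists (P + Q); first by rewrite nfD.
move=> i m; rewrite coefD mcoeffD; have [P0|/gP //] := eqVneq (P`_i)@_m 0.
by rewrite P0 add0r => /gQ.
Qed.

Lemma jA_C c : jA c%:MP = c *: 1.
Proof. by rewrite -[c%:MP]mulr1 mul_mpolyC linearZ /= rmorph1. Qed.

Lemma kr_filZ rl g c u : kr_fil rl g u -> kr_fil rl g (c *: u).
Proof.
move=> [P -> gP]; exists (c%:MP *: P); first by rewrite nfZ jA_C -scalerAl mul1r.
move=> i m; rewrite coefZ mul_mpolyC mcoeffZ mulf_eq0 negb_or => /andP[_].
exact: gP.
Qed.

Lemma kr_filN rl g u : kr_fil rl g u -> kr_fil rl g (- u).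
Proof. by rewrite -scaleN1r; apply: kr_filZ. Qed.

Lemma kr_fil_nf_le g P : kr_fil lexle g (nf P) <-> (P != 0 -> lexle (pdeg P) g).
Proof.
split=> [[Q /nf_inj -> /pole_leP //]|gP]; exists P => //; exact/pole_leP.
Qed.
Lemma kr_fil_nf_lt g P : kr_fil lexlt g (nf P) <-> (P != 0 -> lexlt (pdeg P) g).
Proof.
split=> [[Q /nf_inj -> /pole_ltP //]|gP]; exists P => //; exact/pole_ltP.
Qed.

Lemma nfM_pdeg P Q : exists2 R, nf P * nf Q = nf R &
  R != 0 -> [/\ P != 0, Q != 0 & pdeg R = pdeg P + pdeg Q].
Proof.
have [R eqR] := nf_surj d1 l0 a21 a31 (nf P * nf Q); exists R => // R0.
have P0 : P != 0.
  by apply: contraNneq R0 => P0; rewrite -nf_eq0 -eqR P0 nf0 mul0r.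
have Q0 : Q != 0.
  by apply: contraNneq R0 => Q0; rewrite -nf_eq0 -eqR Q0 nf0 mulr0.
by have [] := pdegM P0 Q0 eqR.
Qed.

Fact kr_filM g h u v : kr_fil lexle g u -> kr_fil lexle h v ->
  kr_fil lexle (g + h) (u * v).
Proof.
move=> [P -> /pole_leP gP] [Q -> /pole_leP gQ].
have [R -> RE] := nfM_pdeg P Q; apply/kr_fil_nf_le => /RE[P0 Q0 ->].
by apply: lexD_le; [apply: gP | apply: gQ].
Qed.

Fact kr_filM_lt g h u v : kr_fil lexlt g u -> kr_fil lexle h v ->
  kr_fil lexlt (g + h) (u * v).
Proof.
move=> [P -> /pole_ltP gP] [Q -> /pole_leP gQ].
have [R -> RE] := nfM_pdeg P Q; apply/kr_fil_nf_lt => /RE[P0 Q0 ->].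
by apply: lexD_lt; [apply: gP | apply: gQ].
Qed.

Fact kr_filM_inv g h u v : kr_fil lexle g u -> kr_fil lexle h v ->
  kr_fil lexlt (g + h) (u * v) -> kr_fil lexlt g u \/ kr_fil lexlt h v.
Proof.
move=> [P -> /pole_leP gP] [Q -> /pole_leP gQ].
have [R eqR RE] := nfM_pdeg P Q; rewrite eqR => /kr_fil_nf_lt gR.
have [->|P0] := eqVneq P 0; first by left; rewrite nf0; apply: kr_fil0.
have [->|Q0] := eqVneq Q 0; first by right; rewrite nf0; apply: kr_fil0.
have [R0 RE'] := pdegM P0 Q0 eqR; move: (gR R0); rewrite RE'.
by case/(lexD_lt_inv (gP P0) (gQ Q0)) => ?; [left | right]; apply/kr_fil_nf_lt.
Qed.

Fact kr_filW g u : kr_fil lexlt g u -> kr_fil lexle g u.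
Proof. by case=> P -> gP; exists P => // i m /gP /lexltW. Qed.

Fact kr_filMn_inv g u n : kr_fil lexlt g (u *+ n.+1) -> kr_fil lexlt g u.
Proof.
rewrite -scaler_nat => /(kr_filZ n.+1%:R^-1); rewrite scalerA mulVf ?scale1r //.
by rewrite pnatr_eq0.
Qed.

(** That the associated graded ring is a domain is [pdegM]. *)
Definition kr_filtration : degFiltration B (int * int)%type :=
  DegFiltration kr_filW (@kr_fil0 lexlt) (@kr_filD lexle) (@kr_filD lexlt)
    (@kr_filN lexle) (@kr_filN lexlt) kr_filM kr_filM_lt kr_filM_inv kr_filMn_inv.

Definition has_degree g (b : B) := kr_fil lexle g b /\ ~ kr_fil lexlt g b.

Lemma exact_nf P : P != 0 -> has_degree (pdeg P) (nf P).
Proof.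
move=> P0; split; first by apply/kr_fil_nf_le => _; apply: lexle_refl.
by move/kr_fil_nf_lt => /(_ P0) /lexlt_irr.
Qed.

Lemma exact_exists b : b <> 0 -> exists g, has_degree g b.
Proof.
have [P ->] := nf_surj d1 l0 a21 a31 b => /eqP; rewrite nf_eq0 => P0.
by exists (pdeg P); apply: exact_nf.
Qed.

Lemma exact_term i e (p : A) : p != 0 -> p \is whom e ->
  has_degree (bideg i e) (jA p * kr_e i).
Proof.
move=> p0 hom_p; rewrite -nfXn -nfZ.
have pX0 : p *: 'X^i != 0 :> {poly A}.
  by rewrite -mul_polyC mulf_neq0 ?polyC_eq0 // -size_poly_eq0 size_polyXn.
suff -> : bideg i e = pdeg (p *: 'X^i) by apply: exact_nf.
by rewrite /pdeg size_scale // size_polyXn lead_coefZ lead_coefXn mulr1 (dhomog_measure p0 hom_p).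
Qed.

(** The leading form of an element is a single homogeneous p(x, z) y^q t^r. *)
Lemma exact_lead g b : has_degree g b -> exists i e p r,
  [/\ g = bideg i e, p != 0, p \is whom e, b = jA p * kr_e i + r &
      kr_fil lexlt g r].
Proof.
move=> [[P -> /pole_leP gP] nlt].
have P0 : P != 0 by apply: contra_notN nlt => /eqP ->; rewrite nf0; apply: kr_fil0.
have gE : g = pdeg P.
  have /lexleP := gP P0; have : ~ lexlt (pdeg P) g.
    by move=> lt_g; apply: nlt; apply/kr_fil_nf_lt.
  move=> /negP/lexltP; case: g (pdeg P) {gP nlt} => [g1 g2] [h1 h2] /= ngh gh.
  by congr pair; lia.
have lP0 : lead_coef P != 0 by rewrite lead_coef_eq0.
have [r lt_r lE] := measure_top (wt d a2) lP0.
set p := pihomog _ _ _ in lE.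
have p0 : p != 0 by apply: measure_top_neq0.
exists (size P).-1, (wsize (lead_coef P)).-1, p, (nf (P - p *: 'X^((size P).-1))).
split=> //; first exact: pihomogP.
  by rewrite nfB nfZ nfXn // addrC subrK.
exists (P - p *: 'X^((size P).-1)) => // i m.
rewrite coefB coefZ coefXn gE; have [->|ne_i] := eqVneq i (size P).-1.
  rewrite mulr1 -/(lead_coef P) lE addrC addKr => m_r; apply: bideg_lt.
  have lt_m : (wt d a2 m < wsize r)%N.
    by apply: (mmeasure_mnm_lt (wt d a2)); rewrite mcoeff_msupp.
  by apply: leq_trans lt_m _; rewrite -ltnS -mpolySpred.
rewrite mulr0 subr0 => m_P; apply: bideg_lt1.
have : (i < size P)%N.
  by rewrite ltnNge; apply: contraNN m_P => /leq_sizeP ->; rewrite ?mcoeff0.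
by move=> lt_i; rewrite ltn_neqAle ne_i /= -ltnS (leq_trans lt_i) ?leqSpred.
Qed.

(** Each step of the filtration is spanned by monomials, so that a shift of
    degrees by a linear map can be checked on monomials. *)
Lemma kr_fil_span (rl : int * int -> int * int -> bool) g (S : B -> Prop) :
  S 0 -> (forall u v, S u -> S v -> S (u + v)) ->
  (forall c i m, rl (bideg i (wt d a2 m)) g -> S (c *: (jA 'X_[m] * kr_e i))) ->
  forall b, kr_fil rl g b -> S b.
Proof.
move=> S0 SD SX b [P -> gP]; rewrite /normal_form; elim/big_ind: _ => // i _.
rewrite {1}[P`_i]mpolyE linear_sum mulr_suml big_seq.
elim/big_ind: _ => // m m_P /=; rewrite linearZ /= -scalerAl; apply: SX.
by apply: gP; rewrite -mcoeff_msupp.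
Qed.

End Bidegree.

(** * Kernels of locally nilpotent derivations of the coordinate ring *)

(** Eliminating q from the first two equations and q' from the last two
    gives P nx = - a2 a3 and P nF = - d a2 a3, where P = e1 a2 d l + e2 a3.
    As nF differs from d nx, P vanishes, which is absurd. *)
Lemma bideg_contra (a2 a3 d l nx nF q q' : nat) (e1 e2 : int) :
  (0 < a2)%N -> (0 < a3)%N -> (nF < d * nx)%N ->
  e1 * nx%:Z = (q * a3)%N%:Z ->
  a2%:Z + e2 * nx%:Z = - (a2 * d * l * q)%N%:Z ->
  e1 * nF%:Z = (q' * a3)%N%:Z ->
  (a2 * d)%N%:Z + e2 * nF%:Z = - (a2 * d * l * q')%N%:Z -> False.
Proof.
rewrite !PoszM => a20 a30 lt_nF E1 E2 E3 E4.
have n0 : (d%:Z * nx%:Z - nF%:Z) != 0 by lia.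
have par : e1 * (a2%:Z * d%:Z * l%:Z) + e2 * a3%:Z = 0.
  apply: (mulfI n0); rewrite mulr0.
  transitivity (d%:Z * ((e1 * nx%:Z) * (a2%:Z * d%:Z * l%:Z) + a3%:Z * (a2%:Z + e2 * nx%:Z))
     - ((e1 * nF%:Z) * (a2%:Z * d%:Z * l%:Z) + a3%:Z * (a2%:Z * d%:Z + e2 * nF%:Z))).
    by ring.
  by rewrite E1 E2 E3 E4; ring.
have : a2%:Z * a3%:Z = 0.
  transitivity ((e1 * nx%:Z) * (a2%:Z * d%:Z * l%:Z) + a3%:Z * (a2%:Z + e2 * nx%:Z)
    - nx%:Z * (e1 * (a2%:Z * d%:Z * l%:Z) + e2 * a3%:Z)); first by ring.
  by rewrite E1 E2 par; ring.
by move/eqP; rewrite mulf_eq0; lia.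
Qed.

Lemma intMn (k : int) n : k *+ n = k * n%:Z. Proof. by rewrite -mulr_natr natz. Qed.

Section Kernel.
Variables (C : numClosedFieldType) (d l a2 a3 : nat).
Hypotheses (d1 : (1 < d)%N) (l0 : (0 < l)%N) (a21 : (1 < a2)%N) (a31 : (1 < a3)%N).
Hypothesis (a2d : coprime a2 d).

Local Notation A := {mpoly C[2]}.
Local Notation B := (kr_ring C d l a2 a3).
Local Notation xB := (kr_x C d l a2 a3).
Local Notation yB := (kr_y C d l a2 a3).
Local Notation zB := (kr_z C d l a2 a3).
Local Notation tB := (kr_t C d l a2 a3).
Local Notation F := (curve C d a2).
Local Notation jA := (@kr_xz C d l a2 a3).
Local Notation kr_e := (@yt_monomial C d l a2 a3).
Local Notation whom e := (ishomog1 e (wt d a2)).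
Local Notation bideg := (bideg d l a2 a3).
Local Notation has_degree := (@has_degree C d l a2 a3).
Local Notation fil := (@kr_filtration C d l a2 a3 d1 l0 a21 a31).
Local Notation kle := (@kr_fil C d l a2 a3 lexle).
Local Notation klt := (@kr_fil C d l a2 a3 lexlt).

Lemma bidegE i k : bideg i k = (i%:Z, k%:Z - (a2 * d * l * (i %/ a3))%N%:Z).
Proof. by []. Qed.

Lemma bideg0 k : bideg 0 k = (0%:Z, k%:Z).
Proof. by rewrite bidegE div0n muln0 subr0. Qed.

Lemma bideg0D i k k' : bideg 0 k + bideg i k' = bideg i (k + k').
Proof.
rewrite bideg0; apply: injective_projections; rewrite ?pair_add1 ?pair_add2 /=.
  by rewrite add0r.
by rewrite PoszD addrA.
Qed.

Lemma bideg_mul k n : bideg 0 k *+ n = bideg 0 (k * n).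
Proof.
rewrite !bideg0; apply: injective_projections; rewrite ?pair_mul1 ?pair_mul2 /=.
  by rewrite mul0rn.
by rewrite PoszM intMn.
Qed.

Lemma bideg_e i : bideg a3 0 *+ (i %/ a3) + bideg 1 0 *+ (i %% a3) = bideg i 0.
Proof.
apply: injective_projections;
  rewrite ?pair_add1 ?pair_add2 ?pair_mul1 ?pair_mul2 !bidegE /=.
  by rewrite !intMn mul1r -PoszM -PoszD mulnC -divn_eq.
rewrite divnn (ltnW a31) (@divn_small 1 a3) // muln0 !sub0r oppr0 mul0rn addr0 muln1.
by rewrite intMn mulNr -PoszM.
Qed.

Lemma kle_lt g h u : kle g u -> lexlt g h -> klt h u.
Proof. by case=> P -> gP gh; exists P => // i m /gP gm; apply: lexle_lt_trans gh. Qed.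

Lemma kle_le g h u : kle g u -> lexle g h -> kle h u.
Proof. by case=> P -> gP gh; exists P => // i m /gP gm; apply: lexle_trans gh. Qed.

Lemma kr_e0 : kr_e 0 = 1.
Proof. by rewrite /yt_monomial div0n mod0n !expr0 mulr1. Qed.
Lemma kr_e1 : kr_e 1 = tB.
Proof. by rewrite /yt_monomial divn_small // modn_small // expr0 mul1r expr1. Qed.
Lemma kr_ea3 : kr_e a3 = yB.
Proof. by rewrite /yt_monomial divnn (ltnW a31) modnn expr0 mulr1 expr1. Qed.

Lemma exact_xz e (p : A) : p != 0 -> p \is whom e -> has_degree (bideg 0 e) (jA p).
Proof. by move=> p0 hp; rewrite -[jA p]mulr1 -kr_e0; apply: exact_term. Qed.

Lemma exact_x : has_degree (bideg 0 a2) xB.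
Proof. by rewrite -kr_xz_x; apply: exact_xz; [apply: mpolyX_neq0 | apply: whom_x]. Qed.
Lemma exact_z : has_degree (bideg 0 d) zB.
Proof. by rewrite -kr_xz_z; apply: exact_xz; [apply: mpolyX_neq0 | apply: whom_z]. Qed.
Lemma exact_F : has_degree (bideg 0 (a2 * d)) (jA F).
Proof. by apply: exact_xz; [apply: curve_neq0 | apply: whom_curve]. Qed.
Lemma exact_e i : has_degree (bideg i 0) (kr_e i).
Proof.
rewrite -[kr_e i]mul1r -(rmorph1 jA).
by apply: exact_term; rewrite ?oner_neq0 ?dhomog1.
Qed.
Lemma exact_t : has_degree (bideg 1 0) tB. Proof. by rewrite -kr_e1; apply: exact_e. Qed.
Lemma exact_y : has_degree (bideg a3 0) yB. Proof. by rewrite -kr_ea3; apply: exact_e. Qed.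

Section Homogeneous.
Variables (D : locNilpDer B) (del : int * int).
Hypothesis Dscal : forall c b, D (c *: b) = c *: D b.
Hypothesis D_le : forall g b, fle fil g b -> fle fil (g + del) (D b).
Hypothesis D_lt : forall g b, flt fil g b -> flt fil (g + del) (D b).

Local Notation nu := (lead_order fil D del).
Local Notation nule := (lead_order_le fil D del).

Lemma iterDscal n c b : iter n D (c *: b) = c *: iter n D b.
Proof. by elim: n => [//|n IHn]; rewrite !iterS IHn Dscal. Qed.

Lemma nuleZ g n c b : nule g n b -> nule g n (c *: b).
Proof.
by move=> [gb Db]; split; [exact: kr_filZ | rewrite iterDscal; exact: kr_filZ].
Qed.

Lemma nuZ g n c b : c != 0 -> nu g n b -> nu g n (c *: b).
Proof.
move=> c0 [nb ntb]; split; first exact: nuleZ.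
rewrite iterDscal => /(@kr_filZ _ _ _ _ _ _ _ c^-1).
by rewrite scalerA mulVf // scale1r.
Qed.

Lemma nu_exists g b : has_degree g b -> exists n, nu g n b.
Proof. by case=> gb ngb; exact: (nu_ex (f := fil)). Qed.

Lemma nu_has_degree g n b : nu g n b -> has_degree g b.
Proof. by move=> nb; split; [apply: (nu_fle nb) | apply: (nu_exact D_lt nb)]. Qed.

Lemma exact1 : has_degree 0 1.
Proof. by have := exact_e 0; rewrite kr_e0 bideg0. Qed.

Lemma D1 : D 1 = 0.
Proof. by apply: (addrI (D 1)); rewrite addr0 -{3}[1]mulr1 lndM mul1r mulr1. Qed.

Lemma nu1 : nu 0 0 1.
Proof.
have [le1 nlt1] := exact1; rewrite /lead_order /lead_order_le mulr0n mulr1n !add0r /= D1.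
by do !split=> //; apply: kr_fil0.
Qed.

Variables (nx ny nz nt nF : nat).
Hypotheses (order_x : nu (bideg 0 a2) nx xB) (order_y : nu (bideg a3 0) ny yB).
Hypotheses (order_z : nu (bideg 0 d) nz zB) (order_t : nu (bideg 1 0) nt tB).
Hypothesis order_F : nu (bideg 0 (a2 * d)) nF (jA F).

Lemma nu_kr_e i : nu (bideg i 0) (ny * (i %/ a3) + nt * (i %% a3)) (kr_e i).
Proof. by rewrite -bideg_e; apply: (nuM D_le D_lt); apply: (nuX D_le D_lt _ nu1). Qed.

(** The order of an element is that of its leading form, a product of p, of
    a power of y and of a power of t. *)
Lemma nu_leadP g n b : nu g n b -> exists i e p m,
  [/\ g = bideg i e, p != 0, p \is whom e, nu (bideg 0 e) m (jA p) &
      n = (m + (ny * (i %/ a3) + nt * (i %% a3)))%N].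
Proof.
move=> nb; have [i [e [p [r [gE p0 hp bE lt_r]]]]] := exact_lead d1 l0 a21 a31 (nu_has_degree nb).
have [m mp] := nu_exists (exact_xz p0 hp).
exists i, e, p, m; split=> //.
have := nuM D_le D_lt mp (nu_kr_e i); rewrite bideg0D addn0 -gE => nu1.
have := nu_lead D_lt nu1 lt_r; rewrite -bE => nu2.
exact: (nu_uniq D_lt nb nu2).
Qed.

Lemma bideg_t_mul k : bideg 1 0 *+ k = (k%:Z, 0).
Proof.
apply: injective_projections; rewrite ?pair_mul1 ?pair_mul2 bidegE /=.
  by rewrite intMn mul1r.
by rewrite (@divn_small 1 a3) // muln0 subr0 mul0rn.
Qed.

(** Since x has smaller degree than t^a3, the relation y F^l = - t^a3 holds
    between leading forms. *)
Lemma nu_rel : (ny + nF * l = nt * a3)%N.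
Proof.
have nuL := nuM D_le D_lt order_y (nuX D_le D_lt l nu1 order_F).
have nuR := nuN (nuX D_le D_lt a3 nu1 order_t).
have lt_x : klt (bideg 1 0 *+ a3) (- xB).
  apply: kr_filN; apply: kle_lt (exact_x.1) _; apply/lexltP; left.
  by rewrite bideg_t_mul bideg0 /=; lia.
have := nu_lead D_lt nuR lt_x.
have -> : - tB ^+ a3 - xB = yB * jA F ^+ l.
  apply/eqP; rewrite -subr_eq0 -oppr_eq0 -(kr_rel C d l a2 a3) rmorphXn /=.
  by apply/eqP; ring.
have -> : bideg 1 0 *+ a3 = bideg a3 0 + bideg 0 (a2 * d) *+ l.
  rewrite bideg_mul addrC bideg0D addn0 bideg_t_mul bidegE divnn (ltnW a31) muln1.
  by rewrite subrr.
exact: (nu_uniq D_lt nuL).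
Qed.

(** If the leading form of t is killed, so are those of y and F by [nu_rel],
    then those of x and z by [nu_pham], and the degree del of D is not
    attained on the generators. *)
Lemma nt_gt0 : ~ (klt (bideg 0 a2 + del) (D xB) /\ klt (bideg a3 0 + del) (D yB) /\
    klt (bideg 0 d + del) (D zB) /\ klt (bideg 1 0 + del) (D tB)) -> (0 < nt)%N.
Proof.
move=> nlt; case: (posnP nt) => // nt0; case: nlt.
have lF0 : (ny = 0 /\ nF = 0)%N by have := nu_rel; rewrite nt0; nia.
have xz0 : nx = 0%N /\ nz = 0%N.
  have eq_deg : bideg 0 a2 *+ d = bideg 0 d *+ a2 by rewrite !bideg_mul mulnC.
  apply: (nu_pham D_le D_lt d1 a21 nu1 eq_deg order_x order_z).
  by have := order_F; rewrite lF0.2 kr_curve bideg_mul.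
have lt_of g n b : n = 0%N -> nu g n b -> klt (g + del) (D b).
  by move=> -> [[_]]; rewrite mulr1n.
by split; [|split; [|split]];
   [apply: lt_of xz0.1 order_x | apply: lt_of lF0.1 order_y |
    apply: lt_of xz0.2 order_z | apply: lt_of nt0 order_t].
Qed.

Lemma nu_DP g n b : nu g n.+1 b -> exists i e p m,
  [/\ g + del = bideg i e, nu (bideg 0 e) m (jA p) &
      n = (m + (ny * (i %/ a3) + nt * (i %% a3)))%N].
Proof.
move/(nu_der D_le) => /nu_leadP[i [e [p [m [gE _ _ mp nE]]]]].
by exists i, e, p, m.
Qed.

(** The leading form of D t has order nt - 1, so it is free of t. Its degree
    in t is one more than that of the leading form of D b, which therefore
    contains the factor t^(a3-1), of order nt (a3 - 1). *)
Lemma nxz_ge : (0 < nt)%N -> forall k n b, nu (bideg 0 k) n.+1 b ->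
  (nt * a3.-1 <= n)%N.
Proof.
move=> nt0 k n b /nu_DP[i [e [p [m [gE mp nE]]]]].
have [nt' ntE] : exists nt', nt = nt'.+1 by exists nt.-1; rewrite prednK.
have order_t' := order_t; rewrite ntE in order_t'.
have [i' [e' [p' [m' [gE' mp' nE']]]]] := nu_DP order_t'.
have i'0 : (i' %% a3 = 0)%N.
  apply/eqP; rewrite -leqn0 leqNgt; apply/negP => i'0.
  have : (nt <= nt * (i' %% a3))%N by rewrite leq_pmulr.
  by rewrite nE' in ntE; rewrite {1}ntE ltnNge addnA leq_addl.
have : (i.+1 = i')%N.
  move: (congr1 fst gE) (congr1 fst gE'); rewrite !pair_add1 !bidegE /=.
  by lia.
move=> iE; have iE' : (i %% a3 = a3.-1)%N.
  have a3E : a3 = a3.-1.+1 by rewrite prednK // ltnW.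
  have := i'0; rewrite -iE -addn1 => /eqP; rewrite -/(dvdn _ _) => /dvdnP[q qE].
  have q0 : (0 < q)%N by case: q qE => //; lia.
  have -> : i = (q.-1 * a3 + a3.-1)%N.
    apply/eqP; rewrite -(eqn_add2r 1) qE -addnA addn1 -a3E -mulSnr prednK //.
  by rewrite modnMDl modn_small // {2}a3E.
by rewrite nE iE' addnA leq_addl.
Qed.

Lemma nu_mono m : nu (bideg 0 (wt d a2 m))
  (nx * m (inord 0) + nz * m (inord 1)) (jA 'X_[m]).
Proof.
rewrite mpolyX2 rmorphM !rmorphXn /= kr_xz_x kr_xz_z.
have -> : bideg 0 (wt d a2 m) = bideg 0 a2 *+ m (inord 0) + bideg 0 d *+ m (inord 1).
  by rewrite !bideg_mul bideg0D.
by apply: (nuM D_le D_lt); apply: (nuX D_le D_lt _ nu1).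
Qed.

(** The case where x^d and z^a2 have the same order and F a smaller one. *)
Section Cancellation.
Hypothesis nxz : (d * nx = a2 * nz)%N.
Hypothesis nx0 : (0 < nx)%N.
Hypothesis nF_lt : (nF < d * nx)%N.
Hypothesis nF0 : (0 < nF)%N.

Lemma mono_order m e : wt d a2 m = e ->
  (a2 * (nx * m (inord 0) + nz * m (inord 1)) = e * nx)%N.
Proof. by move=> <-; rewrite mulnDr [in X in (_ + X)%N]mulnA -nxz /wt; ring. Qed.

(** All monomials of weight e have order e nx / a2. *)
Lemma whom_order_le e p n : p != 0 -> p \is whom e ->
  nu (bideg 0 e) n (jA p) -> (a2 * n <= e * nx)%N.
Proof.
move=> p0 hp np; pose m0 := mlead p.
have m0e : wt d a2 m0 = e by apply: (dhomog_mf hp); apply: mlead_supp.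
rewrite -(mono_order m0e) leq_mul2l; apply/orP; right.
apply: (nu_nule D_lt np); rewrite {1}[p]mpolyE linear_sum big_seq.
elim/big_ind: _ => [|u v un vn|m m_p].
- exact/(nule_flt D_lt)/flt0.
- exact: nuleD.
rewrite linearZ /=; apply: nuleZ.
have me : wt d a2 m = e by apply: (dhomog_mf hp).
have nm := nu_mono m; rewrite me in nm; apply: (nuleW D_lt) (nm.1).
have a20 : (0 < a2)%N := ltnW a21.
by rewrite -(leq_pmul2l a20) (mono_order me) (mono_order m0e).
Qed.

(** Modulo F, p is a multiple of one monomial. The order of this monomial is
    positive and, by [whom_order_le], larger than that of the multiple of F;
    and if the monomial is absent, the factor F has positive order. *)
Lemma whom_order_gt0 e p n : p != 0 -> p \is whom e ->
  nu (bideg 0 e) n (jA p) -> (0 < e)%N -> (0 < n)%N.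
Proof.
move=> p0 hp np e0; have [i [j [c [q [eE pE qe]]]]] := whom_split d1 a21 a2d p0 hp.
pose m : 'X_{1..2} := (U_(inord 0) *+ i + U_(inord 1) *+ j)%MM.
have mX : mono C i j = 'X_[m] by rewrite /m mpolyXD -!mpolyXn.
have mi : m (inord 0) = i /\ m (inord 1) = j.
  rewrite /m !mnmDE !mulmnE !mnm1E !eqxx [inord 1 == _]eq_sym (negPf ord2_neq).
  by rewrite !mul0n !mul1n addn0 add0n.
have wm : wt d a2 m = e by rewrite /wt mi.1 mi.2.
have nm := nu_mono m; rewrite wm in nm.
set k := (_ + _)%N in nm; have kE : (a2 * k = e * nx)%N := mono_order wm.
have k0 : (0 < k)%N.
  rewrite lt0n; apply/eqP => k0; move: kE; rewrite k0 muln0 => /esym/eqP.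
  by rewrite muln_eq0 !eqn0Ngt e0 nx0.
have [c0|c0] := eqVneq c 0.
  case: qe => [q0|[e' e'E hq]].
    by move: p0; rewrite pE q0 c0 scale0r mulr0 addr0 eqxx.
  have q0 : q != 0 by apply: contraNneq p0 => q0; rewrite pE q0 c0 scale0r mulr0 addr0.
  have [s sq] := nu_exists (exact_xz q0 hq).
  have := nuM D_le D_lt order_F sq; rewrite bideg0D addnC -e'E -rmorphM.
  have -> : F * q = p by rewrite pE c0 scale0r add0r.
  by move/(nu_uniq D_lt np) => ->; apply: ltn_addr.
have cm := nuZ c0 nm.
have pjE : jA p = c *: jA 'X_[m] + jA (F * q) by rewrite pE mX rmorphD /= linearZ.
case: qe => [q0|[e' e'E hq]].
  rewrite q0 mulr0 rmorph0 addr0 in pjE; rewrite -pjE in cm.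
  by rewrite (nu_uniq D_lt np cm).
have [q0|q0] := eqVneq q 0.
  rewrite q0 mulr0 rmorph0 addr0 in pjE; rewrite -pjE in cm.
  by rewrite (nu_uniq D_lt np cm).
have [s sq] := nu_exists (exact_xz q0 hq).
have := nuM D_le D_lt order_F sq; rewrite bideg0D addnC -e'E -rmorphM => nFq.
have sle := whom_order_le q0 hq sq.
have lt_k : (nF + s < k)%N.
  have a20 : (0 < a2)%N := ltnW a21.
  rewrite -(ltn_pmul2l a20) kE e'E mulnDl mulnDr addnC.
  by rewrite -mulnA -addnS; apply: leq_add => //; rewrite ltn_pmul2l.
have := nu_add D_lt cm nFq.1 lt_k; rewrite -pjE.
by move/(nu_uniq D_lt np) => ->.
Qed.

(** The last nonzero iterate of the induced derivation on a leading form is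
    killed by it; here it can only be a power of y, because t and the
    nonconstant homogeneous elements of A have positive order. *)
Lemma kernel_y_power g b n : (0 < nt)%N -> ny = 0%N -> nu g n b ->
  exists q, g + del *+ n = ((q * a3)%N%:Z, - (a2 * d * l * q)%N%:Z).
Proof.
move=> nt0 ny0 /(nu_iter D_le) /nu_leadP[i [e [p [m [-> p0 hp mp]]]]].
rewrite ny0 mul0n add0n => /esym/eqP; rewrite addn_eq0 => /andP[/eqP m0].
rewrite muln_eq0 eqn0Ngt nt0 /= => /dvdnP[q ->]; exists q.
case: (posnP e) => [->|e0].
  by rewrite bidegE mulnK ?sub0r // ltnW.
by have := whom_order_gt0 p0 hp mp e0; rewrite m0.
Qed.

(** [kernel_y_power] is applied to the iterates of x and of F. *)
Lemma no_cancellation : (0 < nt)%N -> ny = 0%N -> False.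
Proof.
move=> nt0 ny0; have [q qE] := kernel_y_power nt0 ny0 order_x.
have [q' q'E] := kernel_y_power nt0 ny0 order_F.
move: (congr1 fst qE) (congr1 snd qE) (congr1 fst q'E) (congr1 snd q'E).
rewrite !pair_add1 !pair_add2 !pair_mul1 !pair_mul2 !bideg0 !intMn /= !add0r.
by apply: bideg_contra; rewrite ?nF_lt ?(ltnW a21) ?(ltnW a31).
Qed.

End Cancellation.

(** If ny = 0, then nF l = nt a3 by [nu_rel], and the bound of [nxz_ge]
    makes nF smaller than the order of x^d, and than that of z^a2, whenever
    that order is nonzero. So their leading forms have the same order and
    cancel in F. *)
Lemma ny_gt0 : (0 < nt)%N -> (0 < ny)%N.
Proof.
move=> nt0; rewrite lt0n; apply/eqP => ny0.
have rel := nu_rel; rewrite ny0 add0n in rel.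
have nF0 : (0 < nF)%N.
  by rewrite lt0n; apply/eqP => nF0; move: rel; rewrite nF0; nia.
have nF_le : (nF <= nt * a3)%N by rewrite -rel leq_pmulr.
have big k n b : nu (bideg 0 k) n b -> (n = 0 \/ nt * a3.-1 < n)%N.
  by case: n => [|n]; [left | right; rewrite ltnS; apply: nxz_ge H].
have nxk := big _ _ _ order_x; have nzk := big _ _ _ order_z.
have xd := nuX D_le D_lt d nu1 order_x; have za := nuX D_le D_lt a2 nu1 order_z.
rewrite !bideg_mul in xd za; rewrite [(d * a2)%N]mulnC in za.
have order_F' := order_F; rewrite kr_curve in order_F'.
have ltx : (0 < nx -> nF < nx * d)%N.
  by clear -nxk nF_le a31 d1 nt0; nia.
have ltz : (0 < nz -> nF < nz * a2)%N.
  by clear -nzk nF_le a31 a21 nt0; nia.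
case: (ltngtP (nx * d) (nz * a2)) => lt_xz.
- rewrite addrC in order_F'; have := nu_uniq D_lt order_F' (nu_add D_lt za xd.1 lt_xz).
  by clear -ltz lt_xz; nia.
- have := nu_uniq D_lt order_F' (nu_add D_lt xd za.1 lt_xz).
  by clear -ltx lt_xz; nia.
case: (posnP nx) => [nx0|nx0].
  have lt_n : (nF <= 0)%N.
    apply: (nu_nule D_lt order_F'); apply: nuleD.
      by have := xd.1; rewrite nx0 mul0n.
    by have := za.1; rewrite -lt_xz nx0 mul0n.
  by lia.
apply: (no_cancellation _ nx0 _ nF0 nt0 ny0); first by rewrite mulnC lt_xz mulnC.
by rewrite mulnC ltx.
Qed.

(** The leading form of b has order 0, so it contains neither t nor y; its
    degree in t is 0, and then b is in A. *)
Lemma kernel_xz b : (0 < nt)%N -> (0 < ny)%N -> D b = 0 -> exists p, b = jA p.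
Proof.
move=> nt0 ny0 Db; have [->|/eqP b0] := eqVneq b 0; first by exists 0; rewrite rmorph0.
have [g gb] := exact_exists d1 l0 a21 a31 b0.
have : nu g 0 b.
  rewrite /lead_order /lead_order_le mulr0n mulr1n addr0 /= Db.
  by split; [split; [exact: gb.1 | exact: kr_fil0] | exact: gb.2].
case/nu_leadP => [i [e [p [m [gE _ _ _ /esym/eqP]]]]].
rewrite !addn_eq0 !muln_eq0 !(eqn0Ngt nt) !(eqn0Ngt ny) nt0 ny0 /= => /and3P[_ /eqP iq /eqP ir].
have i0 : i = 0%N by rewrite (divn_eq i a3) iq ir.
move: gb; have [P ->] := nf_surj d1 l0 a21 a31 b => gb.
have P0 : P != 0.
  by apply: contra_notN gb.2 => /eqP ->; rewrite nf0; apply: kr_fil0.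
have : lexle (pdeg d l a2 a3 P) g.
  by have /(kr_fil_nf_le d1 l0 a21 a31) := gb.1; apply.
move/lexleP; rewrite gE i0 bideg0 /= => sP.
have s1 : (size P <= 1)%N.
  have arith (k : nat) (Q : Prop) : k%:Z < 0 \/ k%:Z = 0 /\ Q -> (k <= 0)%N.
    by clear; case=> [|[]]; lia.
  by have := arith _ _ sP; case: (size P) => [|[]].
by exists (P`_0); rewrite (nfE _ _ _ _ s1) big_ord1 kr_e0 mulr1.
Qed.

End Homogeneous.

(** The lexicographic order is not well founded, so the smallest del is
    found by induction on the list of the images of the generators, from the
    degrees of the nonzero ones. *)
Lemma degree_shift (s : seq ((int * int) * B)) :
  foldr (fun u P => u.2 = 0 /\ P) True s \/
  exists del, foldr (fun u P => kle (u.1 + del) u.2 /\ P) True s /\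
    ~ foldr (fun u P => klt (u.1 + del) u.2 /\ P) True s.
Proof.
have mono del del' : lexle del del' -> forall s : seq ((int * int) * B),
    foldr (fun u P => kle (u.1 + del) u.2 /\ P) True s ->
    foldr (fun u P => kle (u.1 + del') u.2 /\ P) True s.
  move=> le_d; elim=> [//|[g u] r IHr] /= [gu /IHr rP]; split=> //.
  by apply: kle_le gu _; apply: lexD_le => //; apply: lexle_refl.
have zero del (r : seq ((int * int) * B)) : foldr (fun u P => u.2 = 0 /\ P) True r ->
    foldr (fun u P => kle (u.1 + del) u.2 /\ P) True r.
  by elim: r => [//|[g u] r IHr] /= [-> /IHr rP]; split=> //; apply: kr_fil0.
have total del del' : lexle del del' \/ lexlt del' del.
  have [|/lexleP ng] := boolP (lexle del del'); first by left.
  by right; apply/lexltP; move: del del' ng => [? ?] [? ?] /=; lia.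
elim: s => [|[g u] s IHs] /=; first by left.
have [u0|/eqP u0] := eqVneq u 0.
  case: IHs => [s0|[del [sle nslt]]]; first by left.
  right; exists del; split; last by case.
  by split=> //; rewrite u0; apply: kr_fil0.
have [h [hle hnlt]] := exact_exists d1 l0 a21 a31 u0; right.
have exact_u : kle (g + (h - g)) u /\ ~ klt (g + (h - g)) u.
  by rewrite addrC subrK.
case: IHs => [s0|[del [sle nslt]]].
  by exists (h - g); split; [split; [exact: exact_u.1 | exact: zero] | case=> /exact_u.2].
case: (total (h - g) del) => [le_d|lt_d].
  exists del; split; last by case.
  by split=> //; apply: kle_le exact_u.1 _; apply: lexD_le => //; apply: lexle_refl.
exists (h - g); split; last by case=> /exact_u.2.
by split; [exact: exact_u.1 | apply: mono sle; apply: lexltW].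
Qed.

(** Take for del the degree of D that is attained on the generators; it is
    then a bound for the shift of degrees by D on all of B, and the results
    on the induced derivation apply. *)
Lemma lnd_kernel (D : locNilpDer B) :
  (forall c b, D (c *: b) = c *: D b) -> (exists b, D b <> 0) ->
  forall b, D b = 0 -> exists p, b = jA p.
Proof.
move=> Dscal [b0 Db0] b Db.
have D1' : D 1 = 0.
  by apply: (addrI (D 1)); rewrite addr0 -{3}[1]mulr1 lndM mul1r mulr1.
pose gens := [:: (bideg 0 a2, D xB); (bideg a3 0, D yB); (bideg 0 d, D zB);
  (bideg 1 0, D tB)].
case: (degree_shift gens) => /= [[Dx [Dy [Dz [Dt _]]]]|[del [[Dx [Dy [Dz [Dt _]]]] nlt]]].
  case: Db0; apply: (kr_ind (S := fun b => D b = 0)) b0 => //.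
  - by move=> u v Du Dv; rewrite lndD Du Dv addr0.
  - by move=> c u Du; rewrite Dscal Du scaler0.
  - by move=> u Du; rewrite lndM Dx Du mul0r mulr0 addr0.
  - by move=> u Du; rewrite lndM Dy Du mul0r mulr0 addr0.
  - by move=> u Du; rewrite lndM Dz Du mul0r mulr0 addr0.
  - by move=> u Du; rewrite lndM Dt Du mul0r mulr0 addr0.
pose good g u := kle g u /\ kle (g + del) (D u).
have goodM g h u v : good g u -> good h v -> good (g + h) (u * v).
  move=> [gu Du] [hv Dv]; split; first exact: (fleM (d := fil)).
  rewrite lndM; apply: kr_filD; first by rewrite addrAC; apply: (fleM (d := fil)).
  by rewrite -addrA; apply: (fleM (d := fil)).
have good1 : good 0 1.
  split; last by rewrite D1'; apply: kr_fil0.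
  by have [] := exact_e 0; rewrite kr_e0 bideg0.
have goodX g u k : good g u -> good (g *+ k) (u ^+ k).
  move=> gu; elim: k => [|k IHk]; first by rewrite mulr0n expr0.
  by rewrite mulrS exprS; apply: goodM.
have gx : good (bideg 0 a2) xB by split=> //; exact: exact_x.1.
have gy : good (bideg a3 0) yB by split=> //; exact: exact_y.1.
have gz : good (bideg 0 d) zB by split=> //; exact: exact_z.1.
have gt : good (bideg 1 0) tB by split=> //; exact: exact_t.1.
have mono i m : kle (bideg i (wt d a2 m) + del) (D (jA 'X_[m] * kr_e i)).
  suff [] : good (bideg i (wt d a2 m)) (jA 'X_[m] * kr_e i) by [].
  have -> : bideg i (wt d a2 m) = (bideg 0 a2 *+ m (inord 0) + bideg 0 d *+ m (inord 1)) +
     (bideg a3 0 *+ (i %/ a3) + bideg 1 0 *+ (i %% a3)).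
    by rewrite bideg_e !bideg_mul !bideg0D addn0.
  rewrite mpolyX2 rmorphM !rmorphXn /= kr_xz_x kr_xz_z.
  by apply: (goodM); apply: (goodM); apply: goodX.
have D_le g u : kle g u -> kle (g + del) (D u).
  move: u; apply: kr_fil_span => [|u v Du Dv|c i m le_g].
  - by rewrite lnd0; apply: kr_fil0.
  - by rewrite lndD; apply: kr_filD.
  rewrite Dscal; apply: kr_filZ; apply: kle_le (mono i m) _.
  by apply: lexD_le => //; apply: lexle_refl.
have D_lt g u : klt g u -> klt (g + del) (D u).
  move: u; apply: kr_fil_span => [|u v Du Dv|c i m le_g].
  - by rewrite lnd0; apply: kr_fil0.
  - by rewrite lndD; apply: kr_filD.
  rewrite Dscal; apply: kr_filZ; apply: kle_lt (mono i m) _.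
  by apply: lexD_lt => //; apply: lexle_refl.
have ex g u : has_degree g u -> exists n, lead_order fil D del g n u by apply: nu_exists.
have [nx order_x] := ex _ _ exact_x; have [ny order_y] := ex _ _ exact_y.
have [nz order_z] := ex _ _ exact_z; have [nt order_t] := ex _ _ exact_t.
have [nF order_F] := ex _ _ exact_F.
have nt0 : (0 < nt)%N.
  apply: (nt_gt0 D_le D_lt order_x order_y order_z order_t order_F) => -[lx [ly [lz lt]]].
  by apply: nlt.
have ny0 := ny_gt0 Dscal D_le D_lt order_x order_y order_z order_t order_F nt0.
exact: (kernel_xz D_le D_lt order_y order_t nt0 ny0 Db).
Qed.

End Kernel.

(** * Automorphisms preserve C[x, z] *)

Section Nilpotency.
Variables (B : comNzRingType) (D : B -> B).
Hypothesis DD : {morph D : a b / a + b}.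
Hypothesis DM : forall a b, D (a * b) = D a * b + a * D b.

Definition nilp a := exists n, iter n D a = 0.

Let D0 : D 0 = 0. Proof. by apply: (addrI (D 0)); rewrite -DD !addr0. Qed.
Let iter0 n : iter n D 0 = 0. Proof. by elim: n => [//|n IHn]; rewrite iterS IHn. Qed.
Let iterDD n : {morph iter n D : a b / a + b}.
Proof. by elim: n => [//|n IHn] a b; rewrite !iterS IHn DD. Qed.

Lemma nilp_ge m n a : (m <= n)%N -> iter m D a = 0 -> iter n D a = 0.
Proof. by move=> /subnK <-; rewrite iterD => ->; apply: iter0. Qed.

Lemma nilpD a b : nilp a -> nilp b -> nilp (a + b).
Proof.
move=> [m am] [n bn]; exists (m + n)%N; rewrite iterDD.
by rewrite (nilp_ge _ am) ?leq_addr // (nilp_ge _ bn) ?leq_addl ?addr0.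
Qed.

Lemma nilpM a b : nilp a -> nilp b -> nilp (a * b).
Proof.
move=> [i ai] [j bj]; exists (i + j)%N.
move eqN: (i + j)%N => N; elim: N i j eqN a b ai bj => [|N IHN] i j eqN a b ai bj.
  have [i0 j0] : i = 0%N /\ j = 0%N by lia.
  by move: ai; rewrite i0 /= => ->; rewrite mul0r.
case: i eqN ai => [|i] eqN ai; first by move: ai => /= ->; rewrite mul0r iter0.
case: j eqN bj => [|j] eqN bj; first by move: bj => /= ->; rewrite mulr0 iter0.
rewrite iterSr DM iterDD (IHN i j.+1) -?iterSr ?(IHN i.+1 j) -?iterSr ?addr0 //.
- by lia.
- by lia.
Qed.

Lemma nilp_der a : nilp (D a) -> nilp a.
Proof. by case=> n; rewrite -iterSr => an; exists n.+1. Qed.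

Lemma nilp_ker a : D a = 0 -> nilp a. Proof. by move=> Da; exists 1%N. Qed.

Lemma nilpX a n : D 1 = 0 -> nilp a -> nilp (a ^+ n).
Proof.
move=> D1 na; elim: n => [|n IHn]; first by rewrite expr0; apply: nilp_ker.
by rewrite exprS; apply: nilpM.
Qed.

End Nilpotency.

Section CanonicalDerivation.
Variables (C : numClosedFieldType) (d l a2 a3 : nat).
Hypotheses (d1 : (1 < d)%N) (l0 : (0 < l)%N) (a21 : (1 < a2)%N) (a31 : (1 < a3)%N).
Hypothesis (a2d : coprime a2 d).

Local Notation A := {mpoly C[2]}.
Local Notation B := (kr_ring C d l a2 a3).
Local Notation xB := (kr_x C d l a2 a3).
Local Notation yB := (kr_y C d l a2 a3).
Local Notation zB := (kr_z C d l a2 a3).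
Local Notation tB := (kr_t C d l a2 a3).
Local Notation F := (curve C d a2).
Local Notation jA := (@kr_xz C d l a2 a3).
Local Notation krpi := (@krpi C d l a2 a3).

Let x4 : {mpoly C[4]} := 'X_(inord 0).
Let y4 : {mpoly C[4]} := 'X_(inord 1).
Let z4 : {mpoly C[4]} := 'X_(inord 2).
Let t4 : {mpoly C[4]} := 'X_(inord 3).
Let G4 := (x4 ^+ d + z4 ^+ a2) ^+ l.

(** The derivation of C[x, y, z, t] with t |-> F^l, y |-> - a3 t^(a3-1) that
    kills x and z; it kills the equation of X. *)
Definition der4 (p : {mpoly C[4]}) : {mpoly C[4]} :=
  G4 * p^`M(inord 3) - (t4 ^+ a3.-1 *+ a3) * p^`M(inord 1).

Lemma der4D : {morph der4 : p q / p + q}.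
Proof. by move=> p q; rewrite /der4 !mderivD !mulrDr opprD addrACA. Qed.
Lemma der4M p q : der4 (p * q) = der4 p * q + p * der4 q.
Proof.
rewrite /der4 !mderivM; move: G4 (t4 ^+ a3.-1 *+ a3) => u v; ring.
Qed.
Lemma der4Z c p : der4 (c *: p) = c *: der4 p.
Proof. by rewrite /der4 !mderivZ -!scalerAr scalerBr. Qed.
Lemma der41 : der4 1 = 0.
Proof. by rewrite /der4 -[1]/(1%:MP) !mderivC !mulr0 subr0. Qed.

Let inord4_eq i j : (i < 4)%N -> (j < 4)%N -> ((inord i : 'I_4) == inord j) = (i == j).
Proof. by move=> i4 j4; rewrite -val_eqE /= !inordK. Qed.

Lemma der4x : der4 x4 = 0.
Proof. by rewrite /der4 !mderivU !inord4_eq // !mulr0 subr0. Qed.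
Lemma der4z : der4 z4 = 0.
Proof. by rewrite /der4 !mderivU !inord4_eq // !mulr0 subr0. Qed.
Lemma der4t : der4 t4 = G4.
Proof. by rewrite /der4 !mderivU !inord4_eq // mulr0 subr0 mulr1. Qed.
Lemma der4y : der4 y4 = - (t4 ^+ a3.-1 *+ a3).
Proof. by rewrite /der4 !mderivU !inord4_eq // mulr0 sub0r mulr1. Qed.

Lemma der4X p n : der4 (p ^+ n.+1) = p ^+ n * der4 p *+ n.+1.
Proof.
elim: n => [|n IHn]; first by rewrite expr1 expr0 mul1r.
by rewrite exprS der4M IHn mulrnAr mulrA -exprS [der4 p * _]mulrC -mulrS.
Qed.
Lemma der4X0 p n : der4 p = 0 -> der4 (p ^+ n) = 0.
Proof. by move=> p0; case: n => [|n]; rewrite ?expr0 ?der41 // der4X p0 mulr0 mul0rn. Qed.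

Lemma der4_poly : der4 (kr_poly C d l a2 a3) = 0.
Proof.
rewrite /kr_poly -/x4 -/y4 -/z4 -/t4 -/G4 !der4D der4M der4x der4y.
rewrite (_ : der4 G4 = 0); last by apply: der4X0; rewrite der4D !der4X0 ?der4x ?der4z ?addr0.
have -> : der4 (t4 ^+ a3) = t4 ^+ a3.-1 *+ a3 * G4.
  by rewrite -{1}(prednK (ltnW a31)) der4X der4t prednK ?(ltnW a31) // mulrnAl.
by rewrite mulr0 addr0 add0r mulNr addNr.
Qed.

(** The derivation induced by [der4] on B; its value does not depend on the
    representative. *)
Definition kr_der (b : B) : B := krpi (der4 (sval (cid (krpi_surj b)))).

Lemma kr_derE p : kr_der (krpi p) = krpi (der4 p).
Proof.
rewrite /kr_der; case: (cid _) => q /= qE.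
have [|r rE] := @krpi_eq0 C d l a2 a3 (q - p); first by rewrite rmorphB /= -qE subrr.
rewrite -(subrK p q) rE der4D der4M der4_poly mulr0 addr0 rmorphD rmorphM /=.
by rewrite krpi_poly mulr0 add0r.
Qed.

Fact kr_derD : {morph kr_der : a b / a + b}.
Proof.
move=> a b; have [p ->] := krpi_surj a; have [q ->] := krpi_surj b.
by rewrite -rmorphD !kr_derE der4D rmorphD.
Qed.
Fact kr_derM a b : kr_der (a * b) = kr_der a * b + a * kr_der b.
Proof.
have [p ->] := krpi_surj a; have [q ->] := krpi_surj b.
by rewrite -rmorphM !kr_derE der4M rmorphD !rmorphM.
Qed.
Lemma kr_derZ c a : kr_der (c *: a) = c *: kr_der a.
Proof.
by have [p ->] := krpi_surj a; rewrite -(linearZZ krpi) !kr_derE der4Z (linearZZ krpi).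
Qed.
Lemma kr_der1 : kr_der 1 = 0.
Proof. by rewrite -(rmorph1 krpi) kr_derE der41 rmorph0. Qed.
Lemma kr_derx : kr_der xB = 0.
Proof. by rewrite -krpi_x kr_derE der4x rmorph0. Qed.
Lemma kr_derz : kr_der zB = 0.
Proof. by rewrite -krpi_z kr_derE der4z rmorph0. Qed.
Lemma kr_dert : kr_der tB = jA (F ^+ l).
Proof.
rewrite -krpi_t kr_derE der4t (rmorphXn jA) /= kr_curve -krpi_x -krpi_z.
by rewrite rmorphXn rmorphD !rmorphXn.
Qed.
Lemma kr_dery : kr_der yB = - (tB ^+ a3.-1 *+ a3).
Proof. by rewrite -krpi_y kr_derE der4y rmorphN rmorphMn rmorphXn. Qed.

Lemma kr_der_xz p : kr_der (jA p) = 0.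
Proof.
have [q -> q0] : exists2 q, jA p = krpi q & der4 q = 0; last by rewrite kr_derE q0 rmorph0.
exists (p \mPo [tuple x4; z4]) => //.
move: p; apply: (mpoly_der_eq0 (h := comp_mpoly [tuple x4; z4])) => [p q|p q|c|i].
- by rewrite rmorphD der4D.
- by rewrite rmorphM der4M.
- by rewrite comp_mpolyC /der4 !mderivC !mulr0 subr0.
by elim/ord2P: i; rewrite comp_mpolyXU inordK //= ?der4x ?der4z.
Qed.

Lemma kr_der_nil b : nilp kr_der b.
Proof.
have nM := nilpM kr_derD kr_derM.
have nt : nilp kr_der tB.
  by apply/nilp_der/nilp_ker; rewrite kr_dert kr_der_xz.
have nX := nilpX kr_derD kr_derM _ kr_der1.
apply: (kr_ind (S := nilp kr_der)) b.
- exact: nilp_ker kr_der1.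
- exact: nilpD kr_derD.
- move=> c u nu; rewrite -[u]mul1r scalerAl; apply: nM => //; apply: nilp_ker.
  by rewrite kr_derZ kr_der1 scaler0.
- by move=> u nu; apply: nM => //; apply: nilp_ker; apply: kr_derx.
- move=> u nu; apply: (nM) => //; apply: nilp_der; rewrite kr_dery -mulr_natr.
  rewrite -mulrN; apply: (nM); first exact: nX.
  by apply: nilp_ker; rewrite -scaler_nat -scaleNr kr_derZ kr_der1 scaler0.
- by move=> u nu; apply: nM => //; apply: nilp_ker; apply: kr_derz.
- by move=> u nu; apply: nM.
Qed.

Section Conjugate.
Variables (s s' : {lrmorphism B -> B}).
Hypotheses (sK : cancel s s') (s'K : cancel s' s).

Definition conj_der : locNilpDer B.
Proof.
refine (@LocNilpDer B (fun b => s (kr_der (s' b))) _ _ _).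
- by move=> a b; rewrite rmorphD kr_derD rmorphD.
- by move=> a b; rewrite rmorphM kr_derM rmorphD !rmorphM /= !s'K.
- move=> b; have [n nb] := kr_der_nil (s' b); exists n.
  suff -> : iter n (fun b => s (kr_der (s' b))) b = s (iter n kr_der (s' b)).
    by rewrite nb rmorph0.
  by elim: n {nb} => [|n IHn]; rewrite ?s'K // !iterS IHn sK.
Defined.

(** The conjugate by s of the canonical derivation is locally nilpotent and
    nonzero, and it kills s(A). *)
Lemma aut_xz p : exists q, s (jA p) = jA q.
Proof.
apply: (lnd_kernel d1 l0 a21 a31 a2d (D := conj_der)) => [c b||] /=.
- by rewrite (linearZZ s') kr_derZ (linearZZ s).
- exists (s tB); rewrite sK kr_dert => /eqP.
  rewrite -(rmorph0 s) (inj_eq (can_inj sK)) -(rmorph0 jA) (inj_eq (jA_inj a21)).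
  by rewrite (negPf (curvel_neq0 _ _ _ a21)).
- by rewrite sK kr_der_xz rmorph0.
Qed.

Lemma aut_xz_lr : exists psi : {lrmorphism A -> A}, forall p, s (jA p) = jA (psi p).
Proof.
have [X XE] := aut_xz 'X_(inord 0); have [Z ZE] := aut_xz 'X_(inord 1).
exists (comp_mpoly [tuple X; Z]).
apply: (mpoly_lrmorph_ext (f := s \o jA) (g := jA \o comp_mpoly [tuple X; Z])).
by elim/ord2P; rewrite /= comp_mpolyXU inordK //= ?XE ?ZE.
Qed.

End Conjugate.

End CanonicalDerivation.

(** * The shape of an automorphism *)

Lemma coef_lin_pow (R : comNzRingType) (b a : R) n i : (i <= n)%N ->
  ((b%:P + a *: 'X) ^+ n)`_i = b ^+ (n - i) * a ^+ i *+ 'C(n, i).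
Proof.
move=> le_in; rewrite exprDn coef_sum.
rewrite (bigD1 (inord i)) //= big1 => [|j ne_j].
  rewrite inordK // exprZn -scalerAr -polyC_exp addr0 coefMn coefZ coefCM coefXn eqxx.
  by rewrite mulr1 mulrC.
rewrite exprZn -scalerAr -polyC_exp coefMn coefZ coefCM coefXn.
case: eqP => [iE|]; last by rewrite !mulr0 mul0rn.
by move: ne_j; rewrite -val_eqE /= inordK // iE eqxx.
Qed.

(** Applied to the image of the equation of X under an automorphism. *)
Lemma coef_relation (R : comNzRingType) (g f q x X : R) (L W : {poly R}) n :
  g *: (f *: L - q *: (x%:P + 'X^n)) = - (f *: (X%:P + W ^+ n)) ->
  forall i c w b e, L`_i = c -> (W ^+ n)`_i = w -> (i == 0)%N = b -> (i == n) = e ->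
  g * (f * c - q * ((if b then x else 0) + e%:R)) = - (f * ((if b then X else 0) + w)).
Proof.
move=> E i c w b e <- <- <- <-; have /polyP/(_ i) := E.
by rewrite coefZ coefB !coefZ !coefD coefXn coefN coefZ coefD !coefC.
Qed.

(** The constant coefficient of the same equation determines the image X of
    x modulo f = F^l. *)
Lemma solve_constant_coef (R : idomainType) (f V P q x X w p : R) : f != 0 ->
  V * f * (f * P - q * x) = - (f * (X + f * w * p)) ->
  X = V * q * x + f * (- V * P - p * w).
Proof.
move=> f0 E; apply: (mulfI f0); rewrite -[LHS]opprK.
have -> : - (f * X) = f * f * w * p - f * (X + f * w * p) by ring.
by rewrite -[- (f * (X + _))]E; ring.
Qed.

Section Automorphism.
Variables (C : numClosedFieldType) (d l a2 a3 : nat).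
Hypotheses (d1 : (1 < d)%N) (l0 : (0 < l)%N) (a21 : (1 < a2)%N) (a31 : (1 < a3)%N).
Hypothesis (a2d : coprime a2 d).

Local Notation A := {mpoly C[2]}.
Local Notation B := (kr_ring C d l a2 a3).
Local Notation xB := (kr_x C d l a2 a3).
Local Notation yB := (kr_y C d l a2 a3).
Local Notation zB := (kr_z C d l a2 a3).
Local Notation tB := (kr_t C d l a2 a3).
Local Notation F := (curve C d a2).
Local Notation jA := (@kr_xz C d l a2 a3).
Local Notation K := {fraction A}.
Local Notation iota := (@iota C d l a2 a3 a21).
Local Notation wsize := (mmeasure (wt d a2)).

(** The inclusion of A[t] in B. *)
Definition kr_horner (P : {poly A}) : B := horner_eval tB (map_poly jA P).
HB.instance Definition _ := GRing.RMorphism.copy kr_horner (horner_eval tB \o map_poly jA).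

Lemma kr_hornerC p : kr_horner p%:P = jA p.
Proof. by rewrite /kr_horner map_polyC /= /horner_eval hornerC. Qed.
Lemma kr_hornerX : kr_horner 'X = tB.
Proof. by rewrite /kr_horner map_polyX /= /horner_eval hornerX. Qed.
Lemma kr_hornerZ p P : kr_horner (p *: P) = jA p * kr_horner P.
Proof. by rewrite -mul_polyC rmorphM /= kr_hornerC. Qed.

Lemma iota_horner P : iota (kr_horner P) = map_poly (@tofrac A) P.
Proof.
rewrite /kr_horner /horner_eval -horner_map /= iota_t -map_poly_comp.
rewrite (eq_map_poly (g := @polyC K \o @tofrac A)); last by move=> p; apply: iota_xz.
by rewrite map_poly_comp; apply: comp_polyXr.
Qed.

Lemma kr_horner_inj : injective kr_horner.
Proof.
move=> P Q /(congr1 iota); rewrite !iota_horner => /polyP PQ; apply/polyP => i.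
by have := PQ i; rewrite !coef_map /= => /eqP; rewrite tofrac_eq => /eqP.
Qed.

(** B becomes A[t] after inverting F. *)
Lemma kr_clear b : exists N P, jA (F ^+ N) * b = kr_horner P.
Proof.
apply: (kr_ind (S := fun b => exists N P, jA (F ^+ N) * b = kr_horner P)) b.
- by exists 0%N, 1; rewrite expr0 rmorph1 mulr1 rmorph1.
- move=> u v [N [P NP]] [M [Q MQ]]; exists (N + M)%N, (F ^+ M *: P + F ^+ N *: Q).
  by rewrite (rmorphD kr_horner) /= !kr_hornerZ -NP -MQ exprD (rmorphM jA) /=; ring.
- move=> c u [N [P NP]]; exists N, (c%:MP *: P); rewrite kr_hornerZ -NP jA_C.
  by rewrite -scalerAr -scalerAl mul1r.
- move=> u [N [P NP]]; exists N, ('X_(inord 0) *: P).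
  by rewrite kr_hornerZ -NP kr_xz_x mulrCA.
- move=> u [N [P NP]]; exists (N + l)%N, (- (('X_(inord 0))%:P + 'X ^+ a3) * P).
  rewrite (rmorphM kr_horner) (rmorphN kr_horner) (rmorphD kr_horner) (rmorphXn kr_horner) /=.
  rewrite kr_hornerC kr_hornerX kr_xz_x -NP exprD (rmorphM jA) /=.
  have -> : - (xB + tB ^+ a3) = yB * jA (F ^+ l).
    apply/eqP; rewrite -subr_eq0 -oppr_eq0 -(kr_rel C d l a2 a3); apply/eqP; ring.
  ring.
- move=> u [N [P NP]]; exists N, ('X_(inord 1) *: P).
  by rewrite kr_hornerZ -NP kr_xz_z mulrCA.
- move=> u [N [P NP]]; exists N, ('X * P).
  by rewrite (rmorphM kr_horner) /= kr_hornerX -NP mulrCA.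
Qed.

Section Components.
Variables (s s' : {lrmorphism B -> B}) (psi psi' : {lrmorphism A -> A}).
Hypotheses (sK : cancel s s') (s'K : cancel s' s).
Hypotheses (spsi : forall p, s (jA p) = jA (psi p)).
Hypotheses (s'psi : forall p, s' (jA p) = jA (psi' p)).

Lemma psiK : cancel psi psi'.
Proof. by move=> p; apply: (@jA_inj C d l a2 a3 a21); rewrite -s'psi -spsi sK. Qed.
Lemma psi'K : cancel psi' psi.
Proof. by move=> p; apply: (@jA_inj C d l a2 a3 a21); rewrite -spsi -s'psi s'K. Qed.

Lemma psi_neq0 p : p != 0 -> psi p != 0.
Proof. by move=> p0; rewrite -(rmorph0 psi) (inj_eq (can_inj psiK)). Qed.

Lemma iota_s_horner P : iota (s (kr_horner P)) =
  map_poly (@tofrac A \o psi) P \Po iota (s tB).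
Proof.
rewrite /kr_horner /horner_eval -horner_map /= -horner_map /= -!map_poly_comp.
rewrite (eq_map_poly (g := @polyC K \o (@tofrac A \o psi))); last first.
  by move=> p /=; rewrite spsi iota_xz.
by rewrite map_poly_comp.
Qed.

(** The image of t generates Frac(A)[t] over Frac(A), since t is, up to a
    power of F, a polynomial in it; so it has degree 1 in t. *)
Lemma aut_t : exists al be, s tB = jA be + jA al * tB.
Proof.
have sz : size (iota (s tB)) = 2.
  have [N [P NP]] := kr_clear (s' tB).
  have := congr1 (fun b => iota (s b)) NP.
  rewrite /= iota_s_horner (rmorphM s) /= s'K spsi (rmorphM iota) /= iota_xz iota_t mul_polyC.
  move/(congr1 (fun p : {poly K} => (size p).-1)); rewrite size_comp_poly.
  rewrite size_scale ?tofrac_eq0 ?psi_neq0 ?expf_neq0 ?curve_neq0 // size_polyX /=.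
  by move/esym/eqP; rewrite muln_eq1 => /andP[_]; case: (size _) => [|[|[]]].
have [P sE] := nf_surj d1 l0 a21 a31 (s tB).
have sP : size P = 2.
  have P0 : P != 0 by apply/eqP => P0; move: sz; rewrite sE P0 nf0 rmorph0 size_poly0.
  by rewrite -sz sE (iota_nf d1 l0 a21 a31 P0).1.
exists P`_1, P`_0; rewrite sE (@nfE _ _ _ _ _ 2) ?sP // big_ord_recl big_ord1 /=.
by rewrite kr_e0 kr_e1 // mulr1.
Qed.

End Components.

(** Let W = al t + be be the image of t, X that of x and G that of F. The
    image of y is L + q y with L of degree less than a3 in t, and G^l (F^l L
    - q (x + t^a3)) = - F^l (X + W^a3) in A[t]. The coefficient of t^a3
    gives G^l q = u^a3 F^l, so that G is a multiple v F^i; i is neither 0, F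
    not being constant, nor larger than 1, for reasons of weight. So G = v F
    and q is constant; that of t^(a3-1) gives that F^l divides be, and the
    constant one that X is u^a3 x modulo F^l. Then [plane_aut_torus]
    applies. *)
Lemma aut_form (s s' : {lrmorphism B -> B}) : cancel s s' -> cancel s' s ->
  exists u r p, [/\ u != 0, r != 0, r ^+ a2 = u ^+ (a3 * d) &
    [/\ s xB = u ^+ a3 *: xB, s zB = r *: zB & s tB = u *: tB + jA (F ^+ l * p)]].
Proof.
move=> sK s'K.
have [psi spsi] := aut_xz_lr d1 l0 a21 a31 a2d sK s'K.
have [psi' s'psi] := aut_xz_lr d1 l0 a21 a31 a2d s'K sK.
have pK := psiK sK spsi s'psi; have p'K := psi'K s'K spsi s'psi.
have [al [be sbt]] := aut_t sK s'K spsi s'psi.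
have [al' [be' s'tB]] := aut_t s'K sK s'psi spsi.
have hornE b a : jA b + jA a * tB = kr_horner (b%:P + a *: 'X).
  by rewrite rmorphD /= kr_hornerC kr_hornerZ kr_hornerX.
(* The coefficient of t in the image of t under s o s' exhibits al as a
   unit. *)
have [u u0 alE] : exists2 u, u != 0 & al = u%:MP.
  apply: (@mpoly_mul_const C _ (psi al') 1 (oner_neq0 C)).
  have /kr_horner_inj/polyP/(_ 1%N) : kr_horner 'X =
      kr_horner ((psi be')%:P + psi al' *: (be%:P + al *: 'X)).
    rewrite kr_hornerX -[LHS]s'K s'tB (rmorphD s) (rmorphM s) /= !spsi sbt hornE.
    by rewrite [in RHS](rmorphD kr_horner) /= kr_hornerC kr_hornerZ.
  rewrite coefX coefD coefC coefZ coefD coefC coefZ coefX /= !add0r mulr1.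
  by rewrite mulrC => <-.
set G := psi F; set X := psi 'X_(inord 0).
have G0 : G != 0 by apply: (psi_neq0 sK spsi s'psi); apply: curve_neq0.
have [P sy] := nf_surj d1 l0 a21 a31 (s yB).
set W : {poly A} := be%:P + al *: 'X.
have rel : jA (G ^+ l) * s yB = kr_horner (- (X%:P + W ^+ a3)).
  have relB : jA (F ^+ l) * yB = - (jA 'X_(inord 0) + tB ^+ a3).
    apply/eqP; rewrite -subr_eq0 opprK -(kr_rel C d l a2 a3) kr_xz_x.
    by apply/eqP; ring.
  rewrite (rmorphN kr_horner) (rmorphD kr_horner) (rmorphXn kr_horner) /=.
  rewrite kr_hornerC -hornE -sbt /X -spsi -(rmorphXn s) -(rmorphD s) -(rmorphN s) -relB.
  by rewrite (rmorphM s) /= spsi (rmorphXn psi).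
have al0 : al != 0 by rewrite alE mpolyC_eq0.
have sW : size W = 2.
  rewrite /W addrC size_polyDl size_scale ?size_polyX //.
  by rewrite size_polyC; case: eqP.
have sWX : size (- (X%:P + W ^+ a3)) = a3.+1.
  have W0 : W != 0 by rewrite -size_poly_eq0 sW.
  have sWn : size (W ^+ a3) = a3.+1.
    have := size_exp W a3; rewrite sW mul1n => sE; rewrite -[in RHS]sE.
    by rewrite prednK // lt0n size_poly_eq0 expf_neq0.
  rewrite size_polyN addrC size_polyDl sWn // size_polyC.
  by case: eqP => //= _; rewrite ltnS ltnW.
have s_iota : size (iota (s yB)) = a3.+1.
  have := congr1 (fun b : B => size (iota b)) rel.
  rewrite /= iota_horner (rmorphM iota) /= iota_xz mul_polyC.
  rewrite size_scale ?tofrac_eq0 ?expf_neq0 // => ->.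
  rewrite size_map_inj_poly ?rmorph0 //.
  by move=> p q /eqP; rewrite tofrac_eq => /eqP.
have sP : size P = a3.+1.
  have P0 : P != 0 by apply/eqP => P0; move: s_iota; rewrite sy P0 nf0 rmorph0 size_poly0.
  by rewrite -s_iota sy (iota_nf d1 l0 a21 a31 P0).1.
pose L : {poly A} := \poly_(i < a3) P`_i; pose q := P`_a3.
have syE : s yB = kr_horner L + jA q * yB.
  rewrite sy (@nfE _ _ _ _ _ a3.+1) ?sP // big_ord_recr /= (kr_ea3 C d l a2 a31).
  congr (_ + _); rewrite /L poly_def rmorph_sum; apply: eq_bigr => i _ /=.
  rewrite kr_hornerZ (rmorphXn kr_horner) /= kr_hornerX.
  by rewrite /yt_monomial divn_small // modn_small // expr0 mul1r.
have eqGy : G ^+ l *: (F ^+ l *: L - q *: (('X_(inord 0))%:P + 'X ^+ a3)) =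
    - (F ^+ l *: (X%:P + W ^+ a3)).
  apply: kr_horner_inj; rewrite -[- (F ^+ l *: _)]scalerN !kr_hornerZ -rel syE.
  rewrite (rmorphB kr_horner) /= !kr_hornerZ (rmorphD kr_horner) (rmorphXn kr_horner) /=.
  rewrite kr_hornerC kr_hornerX.
  have -> : jA 'X_(inord 0) + tB ^+ a3 = - (jA (F ^+ l) * yB).
    apply/eqP; rewrite -subr_eq0 opprK -(kr_rel C d l a2 a3) kr_xz_x.
    by apply/eqP; ring.
  by ring.
have cE := coef_relation eqGy.
have a30 : (a3 == 0)%N = false by rewrite eqn0Ngt (ltnW a31).
have LE i : (i < a3)%N -> L`_i = P`_i by move=> lt_i; rewrite coef_poly lt_i.
have La3 : L`_a3 = 0 by rewrite coef_poly ltnn.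
have WE i : (i <= a3)%N -> (W ^+ a3)`_i = be ^+ (a3 - i) * (u ^+ i)%:MP *+ 'C(a3, i).
  by move=> le_i; rewrite /W coef_lin_pow // alE rmorphXn.
have XdE : X = psi 'X_(inord 0) by [].
clearbody L W q X.
have Eq : G ^+ l * q = (u ^+ a3)%:MP * F ^+ l.
  have := cE a3 _ _ _ _ La3 (WE _ (leqnn a3)) a30 (eqxx a3); rewrite subnn binn.
  rewrite expr0 mul1r mulr1n mulr0 sub0r !add0r mulr1 mulrN.
  by move/oppr_inj => ->; rewrite mulrC.
have ua0 : u ^+ a3 != 0 by rewrite expf_neq0.
have F0 : F != 0 := curve_neq0 C d a21.
have Fl0 : F ^+ l != 0 by rewrite expf_neq0.
have q0 : q != 0.
  apply: contraTneq (erefl true) => q0; move/esym/eqP: Eq.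
  by rewrite q0 mulr0 mulf_eq0 mpolyC_eq0 (negPf ua0) (negPf Fl0).
have [v v0 GE] : exists2 v, v != 0 & G = v%:MP * F.
  have [|i [v [le_i v0 GE]]] := @curveX_factor C d a2 d1 a21 a2d l _ G (G ^+ l.-1 * q) ua0.
    by rewrite mulrA -exprS prednK.
  case: i le_i GE => [|[|i]] le_i GE.
  - have FE : F = v%:MP.
      have /(congr1 psi') := GE; rewrite pK expr0 mulr1 => ->.
      by rewrite -[v%:MP]mulr1 mul_mpolyC linearZ rmorph1.
    have := wsize_curveX C d a21 1; rewrite expr1 FE mmeasureC v0 muln1 /=.
    by clear -d1 a21 => H; exfalso; move: H d1 a21; case: d => // d'; case: a2.
  - by exists v.
  exfalso; have := congr1 wsize Eq; rewrite GE exprMn -exprM -mulrA -rmorphXn /=.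
  rewrite !mul_mpolyC !mmeasureZ ?expf_neq0 //.
  rewrite mmeasureM ?expf_neq0 // !wsize_curveX //.
  have := mpolySpred (wt d a2) q0; move: (wsize q) => k kE.
  have : (a2 * d * l < a2 * d * (i.+2 * l))%N.
    by rewrite ltn_pmul2l ?muln_gt0 ?(ltnW a21) ?(ltnW d1) // ltn_Pmull.
  by rewrite kE addSn /= addnS; clear; lia.
have vl0 : v ^+ l != 0 by rewrite expf_neq0.
have qE : q = (v ^- l * u ^+ a3)%:MP.
  apply: (mulfI Fl0); apply: (mulfI (_ : (v ^+ l)%:MP != 0 :> A)).
    by rewrite mpolyC_eq0.
  rewrite mulrA [LHS](_ : _ = G ^+ l * q); last by rewrite GE exprMn -rmorphXn.
  by rewrite Eq mulrCA -rmorphM /= mulrA mulfV // mul1r mulrC.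
have [p beE] : exists p, be = F ^+ l * p.
  have lt1 : (a3.-1 < a3)%N by rewrite prednK ?(ltnW a31).
  have a31' : (0 < a3.-1)%N by case: (a3) a31 => [|[]].
  have := cE a3.-1 _ _ _ _ (LE _ lt1) (WE _ (ltnW lt1)) (gtn_eqF a31') (ltn_eqF lt1).
  rewrite addr0 mulr0 subr0 add0r.
  have -> : (a3 - a3.-1 = 1)%N by case: (a3) a31 => [|a] // _; rewrite subSnn.
  rewrite expr1 -mulrN mulrCA => /(mulfI Fl0).
  have -> : 'C(a3, a3.-1) = a3 by case: (a3) a31 => [|a] // _; rewrite /= binSn.
  rewrite GE exprMn -rmorphXn /= => E.
  have c0 : (u ^+ a3.-1 * a3%:R) != 0 by rewrite mulf_neq0 ?expf_neq0 // pnatr_eq0 a30.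
  exists (((u ^+ a3.-1 * a3%:R)^-1 * - v ^+ l) *: P`_a3.-1).
  apply: (mulfI (_ : (u ^+ a3.-1 * a3%:R)%:MP != 0 :> A)); first by rewrite mpolyC_eq0.
  rewrite mul_mpolyC -scalerAr mul_mpolyC scalerA mulrA mulfV // mul1r scaleNr.
  by rewrite -[in RHS]mul_mpolyC mulrA E opprK -mul_mpolyC rmorphM /= mpolyC_nat mulrC mulrA -[RHS]mulr_natr.
have XE : X = u ^+ a3 *: 'X_(inord 0) +
    F ^+ l * ((- v ^+ l) *: P`_0 - p ^+ a3 * F ^+ (l * a3.-1)).
  have := cE 0%N _ _ _ _ (LE _ (ltnW a31)) (WE _ (leq0n _)) (eqxx _) (etrans (eq_sym _ _) a30).
  rewrite addr0 subn0 expr0 mpolyC1 mulr1 bin0 mulr1n GE qE beE [(F ^+ l * p) ^+ _]exprMn -exprM.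
  have -> : (l * a3 = l + l * a3.-1)%N by rewrite -mulnS prednK ?(ltnW a31).
  rewrite exprD [(v%:MP * F) ^+ l]exprMn -[v%:MP ^+ l]rmorphXn /=.
  move=> /(solve_constant_coef Fl0) ->.
  by rewrite -(rmorphM (@mpolyC 2 C)) /= [v ^+ l * _]mulrA mulfV // mul1r -!mul_mpolyC rmorphN.
have phiF : psi F = v *: F by rewrite -mul_mpolyC -GE.
have [Xk [r r0 Zr]] := plane_aut_torus d1 a21 a2d pK p'K v0 phiF l0 (etrans (esym XdE) XE).
exists u, r, p; split=> //.
  have : (u ^+ a3 *: 'X_(inord 0)) ^+ d + (r *: 'X_(inord 1)) ^+ a2 = v *: F :> A.
    by rewrite -Xk -Zr -phiF /curve rmorphD !rmorphXn.
  move=> E; have E0 := congr1 (meval (fun i => (i == inord 0)%:R : C)) E.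
  have E1 := congr1 (meval (fun i => (i == inord 1)%:R : C)) E.
  rewrite mevalD !rmorphXn /= !mevalZ /curve mevalD !rmorphXn /= !mevalXU /= eqxx in E0.
  rewrite mevalD !rmorphXn /= !mevalZ /curve mevalD !rmorphXn /= !mevalXU /= eqxx in E1.
  rewrite eq_sym (negPf ord2_neq) in E0; rewrite (negPf ord2_neq) in E1.
  move: E0 E1; rewrite !mulr0 !mulr1 !expr0n !expr1n.
  have -> : (d == 0)%N = false by case: (d) d1.
  have -> : (a2 == 0)%N = false by case: (a2) a21.
  by rewrite !addr0 !add0r !mulr1 => E0 E1; rewrite exprM E0 -E1.
split.
- by rewrite -kr_xz_x spsi Xk linearZ.
- by rewrite -kr_xz_z spsi Zr linearZ.
rewrite sbt beE alE addrC; congr (_ + _).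
by rewrite jA_C -scalerAl mul1r.
Qed.

End Automorphism.

(** * Extending automorphisms of C[x, z, t] *)

Section CoprimePowers.
Variables (F : fieldType) (m n : nat).
Hypotheses (m0 : (0 < m)%N) (mn : coprime m n).

(** The form of Bezout's relation without subtraction. *)
Lemma coprime_bezout : exists x y, (x * m = y * n + 1)%N.
Proof.
have /(coprimeP n m0)[[x y] /= xy] := mn; exists x, y.
by rewrite -xy subnKC // ltnW // -subn_gt0 xy.
Qed.

(** With x m = y n + 1, the common root is s = u^x / r^y. *)
Lemma common_root (u r : F) : u != 0 -> r != 0 -> r ^+ m = u ^+ n ->
  exists s, [/\ s != 0, s ^+ m = u & s ^+ n = r].
Proof.
move=> u0 r0 ru; have [x [y xy]] := coprime_bezout.
exists (u ^+ x / r ^+ y); split; first by rewrite mulf_neq0 ?invr_eq0 ?expf_neq0.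
  rewrite exprMn exprVn -!exprM xy [(y * m)%N]mulnC exprM ru -exprM [(n * y)%N]mulnC.
  by rewrite exprD expr1 mulrAC mulfV ?mul1r ?expf_neq0.
rewrite exprMn exprVn -!exprM [(x * n)%N]mulnC exprM -ru -exprM [(m * x)%N]mulnC xy.
by rewrite exprD expr1 mulrAC mulfV ?mul1r ?expf_neq0.
Qed.

Lemma coprime_pow_inj (u v : F) : u != 0 ->
  u ^+ m = v ^+ m -> u ^+ n = v ^+ n -> u = v.
Proof.
move=> u0 um un; have [x [y xy]] := coprime_bezout.
have : u ^+ (y * n + 1) = v ^+ (y * n + 1).
  by rewrite -xy ![(x * m)%N]mulnC !exprM um.
rewrite !exprD !expr1 ![(y * n)%N]mulnC !exprM un => /mulfI -> //.
by rewrite expf_neq0 // -un expf_neq0.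
Qed.

End CoprimePowers.

Section Extension.
Variables (C : numClosedFieldType) (d l a2 a3 : nat).
Hypotheses (d1 : (1 < d)%N) (l0 : (0 < l)%N) (a21 : (1 < a2)%N) (a31 : (1 < a3)%N).

Local Notation A := {mpoly C[2]}.
Local Notation A3 := {mpoly C[3]}.
Local Notation B := (kr_ring C d l a2 a3).
Local Notation xB := (kr_x C d l a2 a3).
Local Notation yB := (kr_y C d l a2 a3).
Local Notation zB := (kr_z C d l a2 a3).
Local Notation tB := (kr_t C d l a2 a3).
Local Notation F := (curve C d a2).
Local Notation jA := (@kr_xz C d l a2 a3).
Local Notation krpi := (@krpi C d l a2 a3).
Local Notation ux := (xzt_x C).
Local Notation uz := (xzt_z C).
Local Notation ut := (xzt_t C).
Local Notation incl := (@xz_incl C).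

Definition xzt4 (q : A3) : {mpoly C[4]} :=
  q \mPo [tuple 'X_(inord 0); 'X_(inord 2); 'X_(inord 3)].
HB.instance Definition _ := GRing.LRMorphism.copy xzt4
  (comp_mpoly [tuple 'X_(inord 0); 'X_(inord 2); 'X_(inord 3)] : A3 -> {mpoly C[4]}).

Definition kr_xzt (q : A3) : B := krpi (xzt4 q).
HB.instance Definition _ := GRing.LRMorphism.copy kr_xzt (krpi \o xzt4).

Lemma kr_xzt_x : kr_xzt ux = xB.
Proof. by rewrite /kr_xzt /xzt4 comp_mpolyXU inordK. Qed.
Lemma kr_xzt_z : kr_xzt uz = zB.
Proof. by rewrite /kr_xzt /xzt4 comp_mpolyXU inordK. Qed.
Lemma kr_xzt_t : kr_xzt ut = tB.
Proof. by rewrite /kr_xzt /xzt4 comp_mpolyXU inordK. Qed.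

Lemma kr_xzt_incl p : kr_xzt (incl p) = jA p.
Proof.
apply: (mpoly_lrmorph_ext (f := kr_xzt \o incl) (g := jA)) => i /=.
elim/ord2P: i; first by rewrite xz_incl_x kr_xzt_x kr_xz_x.
by rewrite xz_incl_z kr_xzt_z kr_xz_z.
Qed.

Lemma xz_incl_inj : injective incl.
Proof. by move=> p q /(congr1 kr_xzt); rewrite !kr_xzt_incl => /(jA_inj a21). Qed.

Lemma xz_incl_curvel : incl (F ^+ l) = (ux ^+ d + uz ^+ a2) ^+ l.
Proof. exact: xz_incl_F. Qed.

Definition extends (s : B -> B) (f : A3 -> A3) := forall q, s (kr_xzt q) = kr_xzt (f q).

Lemma extends_gen (s : {lrmorphism B -> B}) (f : {lrmorphism A3 -> A3}) :
  s xB = kr_xzt (f ux) -> s zB = kr_xzt (f uz) -> s tB = kr_xzt (f ut) -> extends s f.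
Proof.
move=> sx sz st; apply: (mpoly_lrmorph_ext (f := s \o kr_xzt) (g := kr_xzt \o f)).
move=> -[[|[|[|//]]] i3] /=.
- have -> : Ordinal i3 = inord 0 by apply: val_inj; rewrite /= inordK.
  by rewrite [X in s X]kr_xzt_x.
- have -> : Ordinal i3 = inord 1 by apply: val_inj; rewrite /= inordK.
  by rewrite [X in s X]kr_xzt_z.
- have -> : Ordinal i3 = inord 2 by apply: val_inj; rewrite /= inordK.
  by rewrite [X in s X]kr_xzt_t.
Qed.

(** The value on y is determined because y F^l = - (x + t^a3) and B is a
    domain. *)
Lemma extends_unique (s s' : {lrmorphism B -> B}) (f : A3 -> A3) :
  extends s f -> extends s' f -> s (jA (F ^+ l)) != 0 -> s =1 s'.
Proof.
move=> sf s'f Fl0.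
have eq_s q : s (kr_xzt q) = s' (kr_xzt q) by rewrite sf s'f.
apply: kr_lrmorph_ext; rewrite -?kr_xzt_x -?kr_xzt_z -?kr_xzt_t //.
apply/eqP; rewrite -subr_eq0; apply/eqP.
have relB : yB * jA (F ^+ l) = - (xB + tB ^+ a3).
  by apply/eqP; rewrite -addr_eq0 addrCA addrA (kr_rel C d l a2 a3).
have [|//|/eqP] := @kr_mul_eq0 C d l a2 a3 d1 l0 a21 a31 (s yB - s' yB) (s (jA (F ^+ l)));
  last by rewrite (negPf Fl0).
rewrite mulrBl -(rmorphM s) -[in s' _ * _]kr_xzt_incl eq_s kr_xzt_incl -(rmorphM s') relB.
by rewrite -kr_xzt_x -kr_xzt_t -(rmorphXn kr_xzt) -rmorphD -rmorphN /= eq_s subrr.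
Qed.

(** The images of x, y, z, t are lifted to C[x, y, z, t], and the
    substitution that they define kills the equation of X. *)
Lemma extends_ex (f : {lrmorphism A3 -> A3}) (y : B) :
  kr_xzt (f ux) + y * kr_xzt (f (incl (F ^+ l))) + kr_xzt (f ut) ^+ a3 = 0 ->
  exists s : {lrmorphism B -> B}, extends s f /\ s yB = y.
Proof.
have [Y ->] := krpi_surj y => E.
have [g [gx gy gz gt]] : exists g : {lrmorphism {mpoly C[4]} -> B},
    [/\ g 'X_(inord 0) = kr_xzt (f ux), g 'X_(inord 1) = krpi Y,
        g 'X_(inord 2) = kr_xzt (f uz) & g 'X_(inord 3) = kr_xzt (f ut)].
  exists (krpi \o comp_mpoly [tuple xzt4 (f ux); Y; xzt4 (f uz); xzt4 (f ut)]).
  by rewrite /= !comp_mpolyXU !inordK.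
have [|s sE] := @kr_lift_alg C d l a2 a3 B g.
  rewrite /kr_poly !(rmorphD g) !(rmorphM g) !(rmorphXn g) (rmorphD g) !(rmorphXn g) /=.
  rewrite gx gy gz gt -[RHS]E xz_incl_curvel; congr (_ + _ * _ + _).
  by rewrite !(rmorphXn, rmorphD).
exists s; split; last by rewrite -gy -sE.
by apply: extends_gen; rewrite -?gx -?gz -?gt -sE.
Qed.

(** The equation of X at the images of x, z, t under f and the value y. *)
Definition rel_at (f : A3 -> A3) (y : B) :=
  kr_xzt (f ux) + y * kr_xzt (f (incl (F ^+ l))) + kr_xzt (f ut) ^+ a3 = 0.

Lemma extends_algAut (f : algAut A3) (y y' : B) :
  rel_at f y -> rel_at (f^-1)%g y' ->
  exists s : algAut B, extends s f /\ s yB = y.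
Proof.
move=> /extends_ex[s [sf sy]] /extends_ex[s' [s'f _]].
have Fl0 : jA (F ^+ l) != 0.
  by rewrite -(rmorph0 jA) (inj_eq (@jA_inj C d l a2 a3 a21)) expf_neq0 ?curve_neq0.
have sK : idfun =1 s' \o s.
  apply: (@extends_unique idfun (s' \o s) idfun) => // q /=.
  by rewrite sf s'f -algAutME mulVg.
have s'K : idfun =1 s \o s'.
  apply: (@extends_unique idfun (s \o s') idfun) => // q /=.
  by rewrite s'f sf -algAutME mulgV.
by exists (@AlgAut _ _ s (@Bijective _ _ s s' (fsym sK) (fsym s'K))).
Qed.

Lemma algAut_unique (s s' : algAut B) (f : A3 -> A3) :
  extends s f -> extends s' f -> s = s'.
Proof.
move=> sf s'f; apply: algAutP; apply: (extends_unique sf s'f).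
rewrite -(rmorph0 s) (inj_eq (bij_inj (algAut_bij s))) -(rmorph0 jA).
by rewrite (inj_eq (@jA_inj C d l a2 a3 a21)) expf_neq0 ?curve_neq0.
Qed.

Section Shears.
Variable f : algAut A3.
Hypothesis fA : f \in @kr_A C d l a2.

Lemma kr_A_incl p : f (incl p) = incl p.
Proof. by case/asboolP: fA. Qed.
Lemma kr_A_x : f ux = ux. Proof. by rewrite -xz_incl_x kr_A_incl. Qed.
Lemma kr_A_z : f uz = uz. Proof. by rewrite -xz_incl_z kr_A_incl. Qed.

Lemma kr_A_t : exists p, f ut = ut + incl (F ^+ l * p).
Proof. by case/asboolP: fA => _ [p ->]; exists p; rewrite rmorphM /= xz_incl_curvel. Qed.

(** As (t + F^l p)^a3 - t^a3 is divisible by F^l, the change of t can be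
    absorbed in y. *)
Lemma kr_A_rel : exists y, rel_at f y.
Proof.
have [p ft] := kr_A_t.
exists (yB - jA p * \sum_(i < a3) (tB + jA (F ^+ l * p)) ^+ (a3.-1 - i) * tB ^+ i).
rewrite /rel_at kr_A_x kr_A_incl ft (rmorphD kr_xzt) /= !kr_xzt_incl kr_xzt_x kr_xzt_t.
have -> (h : B) : (tB + h) ^+ a3 = h * (\sum_(i < a3) (tB + h) ^+ (a3.-1 - i) * tB ^+ i) + tB ^+ a3.
  by rewrite -[LHS](subrK (tB ^+ a3)) subrXX addrAC subrr add0r.
move: (\sum_(i < a3) _) => S; rewrite -[RHS](kr_rel C d l a2 a3) (rmorphM jA) /=.
by rewrite mulrBl [_ * S * _]mulrAC [jA p * _]mulrC -!addrA addKr.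
Qed.

End Shears.

Lemma torus_rel (u : Gm C) :
  rel_at (@torus_aut C d a2 a3 u) (Gm_val u ^- ((d * l - 1) * a2 * a3) *: yB).
Proof.
have dl : (0 < d * l)%N by rewrite muln_gt0 l0 ltnW.
have tF : torus_fun d a2 a3 u (incl (F ^+ l)) = Gm_val u ^+ (d * a2 * a3 * l) *: incl (F ^+ l).
  rewrite xz_incl_curvel rmorphXn rmorphD !rmorphXn /= torus_fun_x torus_fun_z.
  rewrite !exprZn -!exprM [(a2 * a3 * d)%N]mulnC mulnA [(d * a3 * a2)%N]mulnAC.
  by rewrite -scalerDr exprZn -exprM.
rewrite /rel_at /= torus_fun_x torus_fun_t tF !(linearZZ kr_xzt) /= kr_xzt_incl.
rewrite kr_xzt_x kr_xzt_t exprZn -exprM -scalerAl -scalerAr scalerA.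
have -> : (d * a2 * a3 * l = (d * l - 1) * a2 * a3 + a2 * a3)%N.
  by rewrite -!mulnA -[X in (_ + X)%N]mul1n -mulnDl subnK // -!mulnA [(l * _)%N]mulnC -!mulnA.
by rewrite exprD mulKf ?expf_neq0 ?Gm_neq0 // -!scalerDr (kr_rel C d l a2 a3) scaler0.
Qed.

Lemma torus_extends (u : Gm C) : exists s : algAut B,
  extends s (@torus_aut C d a2 a3 u) /\
  s yB = Gm_val u ^- ((d * l - 1) * a2 * a3) *: yB.
Proof.
by apply: (extends_algAut (torus_rel u)); rewrite -torus_autV; apply: torus_rel.
Qed.

Lemma kr_A_extends (f : algAut A3) : f \in @kr_A C d l a2 ->
  exists s : algAut B, extends s f.
Proof.
move=> fA; have [y yf] := kr_A_rel fA.
have [|y' y'f] := @kr_A_rel (f^-1)%g; last by have [s [sf _]] := extends_algAut yf y'f; exists s.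
have [A1 AV] := @kr_A_closed C d l a2; by rewrite -[(f^-1)%g]mul1g; apply: AV.
Qed.

Definition shear_fun (p : A) (q : A3) : A3 :=
  q \mPo [tuple ux; uz; ut + incl (F ^+ l * p)].
HB.instance Definition _ p := GRing.LRMorphism.copy (shear_fun p)
  (comp_mpoly [tuple ux; uz; ut + incl (F ^+ l * p)] : A3 -> A3).

Lemma shear_x p : shear_fun p ux = ux.
Proof. by rewrite /shear_fun comp_mpolyXU inordK. Qed.
Lemma shear_z p : shear_fun p uz = uz.
Proof. by rewrite /shear_fun comp_mpolyXU inordK. Qed.
Lemma shear_t p : shear_fun p ut = ut + incl (F ^+ l * p).
Proof. by rewrite /shear_fun comp_mpolyXU inordK. Qed.

Lemma shear_incl p q : shear_fun p (incl q) = incl q.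
Proof.
apply: (mpoly_lrmorph_ext (f := shear_fun p \o incl) (g := incl)) => i /=.
elim/ord2P: i; first by rewrite xz_incl_x shear_x.
by rewrite xz_incl_z shear_z.
Qed.

Lemma shearK p q : p + q = 0 -> cancel (shear_fun p) (shear_fun q).
Proof.
move=> pq; apply: (mpoly3_ext (f := shear_fun q \o shear_fun p) (g := idfun)) => /=.
- by rewrite !shear_x.
- by rewrite !shear_z.
rewrite shear_t rmorphD /= shear_incl shear_t -addrA -rmorphD /= -mulrDr.
by rewrite addrC addrC [q + p]addrC pq mulr0 rmorph0 addr0.
Qed.

Definition shear p : algAut A3 := @AlgAut C A3 (shear_fun p)
  (Bijective (shearK (subrr p)) (shearK (addNr p))).

Lemma shear_kr_A p : shear p \in @kr_A C d l a2.
Proof.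
apply/asboolP; split=> [q|]; first exact: shear_incl.
by exists p; rewrite /= shear_t rmorphM /= xz_incl_curvel.
Qed.

Definition shear_kr p : kr_A_group C d l a2 := Sub (shear p) (shear_kr_A p).

End Extension.

(** * The semidirect product *)

Lemma linear_poly_inj (R : nzRingType) (a b c e : R) :
  a%:P + b *: 'X = c%:P + e *: 'X -> a = c /\ b = e.
Proof.
move=> /polyP E; split; [have := E 0%N | have := E 1%N];
  by rewrite !coefD !coefC !coefZ !coefX /= ?mulr0 ?mulr1 ?addr0 ?add0r.
Qed.

Section Isomorphism.
Variables (C : numClosedFieldType) (d l a2 a3 : nat).
Hypotheses (d1 : (1 < d)%N) (l0 : (0 < l)%N) (a21 : (1 < a2)%N) (a31 : (1 < a3)%N).
Hypotheses (a2d : coprime a2 d) (a23 : coprime a2 a3).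

Local Notation A := {mpoly C[2]}.
Local Notation A3 := {mpoly C[3]}.
Local Notation B := (kr_ring C d l a2 a3).
Local Notation xB := (kr_x C d l a2 a3).
Local Notation yB := (kr_y C d l a2 a3).
Local Notation zB := (kr_z C d l a2 a3).
Local Notation tB := (kr_t C d l a2 a3).
Local Notation F := (curve C d a2).
Local Notation jA := (@kr_xz C d l a2 a3).
Local Notation extends := (@extends C d l a2 a3).
Local Notation ut := (xzt_t C).
Local Notation incl := (@xz_incl C).
Local Notation G := (semidirect (torus_act C d l a2 a3)).
Local Notation torus := (@torus_aut C d a2 a3).
Local Notation toAut f := (val f : algAut A3).

Definition sd_aut (w : G) : algAut A3 := (val (sd_left w) * torus (sd_right w))%g.

Lemma sd_autM : {morph sd_aut : w w' / (w * w')%g}.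
Proof.
move=> [f u] [g v]; rewrite /sd_aut /=.
transitivity (\val f * (torus u * \val g * (torus u)^-1) * torus (u * v))%g; first by [].
by rewrite torus_autM !mulgA mulgVK.
Qed.

Lemma sd_aut_extends w : exists s : algAut B, extends s (sd_aut w).
Proof.
have [s sf] := kr_A_extends d1 l0 a21 a31 (valP (sd_left w)).
have [s' [s'u _]] := torus_extends d1 l0 a21 a31 (sd_right w).
by exists (s * s')%g => q; rewrite algAutME s'u sf.
Qed.

(** The unique extension to B of the automorphism of C[x, z, t] given by an
    element of the semidirect product. *)
Definition kr_action (w : G) : algAut B := sval (cid (sd_aut_extends w)).

Lemma kr_actionP w : extends (kr_action w) (sd_aut w).
Proof. exact: svalP (cid (sd_aut_extends w)). Qed.

Lemma kr_actionM : {morph kr_action : w w' / (w * w')%g}.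
Proof.
move=> w w'; apply: (algAut_unique d1 l0 a21 a31 (kr_actionP (w * w')%g)) => q.
rewrite sd_autM.
exact: etrans (congr1 _ (kr_actionP w' q)) (kr_actionP w _).
Qed.

Lemma kr_action_values w : exists p,
  [/\ forall q, toAut (sd_left w) (incl q) = incl q,
      toAut (sd_left w) ut = ut + incl (F ^+ l * p),
      kr_action w zB = Gm_val (sd_right w) ^+ (d * a3) *: zB &
      kr_action w tB = Gm_val (sd_right w) ^+ a2 *: (tB + jA (F ^+ l * p))].
Proof.
have fA := valP (sd_left w); have [p ft] := kr_A_t fA.
exists p; split=> //; first exact: kr_A_incl fA.
- rewrite -{1}(kr_xzt_z C d l a2 a3) kr_actionP algAutME /= torus_fun_z linearZ /=.
  by rewrite (kr_A_z fA) linearZ /= kr_xzt_z.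
rewrite -{1}(kr_xzt_t C d l a2 a3) kr_actionP algAutME /= torus_fun_t linearZ /=.
by rewrite ft linearZ rmorphD /= kr_xzt_t kr_xzt_incl.
Qed.

Lemma scale_z_inj (u v : C) : u *: zB = v *: zB -> u = v.
Proof.
rewrite -kr_xz_z -!(linearZZ jA) => /(jA_inj a21)/(congr1 (meval (fun=> 1))).
by rewrite !mevalZ mevalXU !mulr1.
Qed.

Lemma affine_t_inj (u v : C) p q : u != 0 ->
  u *: (tB + jA (F ^+ l * p)) = v *: (tB + jA (F ^+ l * q)) -> u = v /\ p = q.
Proof.
move=> u0; have E (c : C) r : c *: (tB + jA (F ^+ l * r)) =
    kr_horner d l a2 a3 ((c *: (F ^+ l * r))%:P + c%:MP *: 'X).
  rewrite (rmorphD (kr_horner d l a2 a3)) /= kr_hornerZ kr_hornerC kr_hornerX linearZ /=.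
  by rewrite jA_C -scalerAl mul1r scalerDr addrC.
rewrite !E => /(kr_horner_inj a21)/linear_poly_inj[E0 uv].
have {}uv : u = v by have := congr1 (meval (fun=> 0)) uv; rewrite !mevalC.
split=> //; move: E0; rewrite -uv => /(scalerI u0)/mulfI; apply.
by rewrite expf_neq0 ?curve_neq0.
Qed.

Lemma a2_da3 : coprime a2 (d * a3).
Proof. by rewrite coprimeMr a2d. Qed.

(** The image of z determines v^(d a3) and that of t determines v^a2 and p;
    these powers determine v. *)
Lemma kr_action_inj : injective kr_action.
Proof.
move=> [f u] [g v] E.
have [p [fxz ft Ez Et]] := kr_action_values (SemiDirect _ f u).
have [q [gxz gt Ez' Et']] := kr_action_values (SemiDirect _ g v).
move: Ez Et; rewrite E Ez' Et' /= => /scale_z_inj zE /affine_t_inj tE.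
have [tvu qp] := tE (expf_neq0 _ (Gm_neq0 v)).
have -> : u = v.
  apply: val_inj; apply/esym.
  exact: (coprime_pow_inj (ltnW a21) a2_da3 (Gm_neq0 v)).
congr (SemiDirect _ _ _); apply: val_inj; apply: algAutP.
apply: mpoly3_ext; rewrite -?xz_incl_x -?xz_incl_z; first by rewrite fxz gxz.
  by rewrite fxz gxz.
by move: ft gt => /= -> ->; rewrite qp.
Qed.

(** The automorphism of [aut_form] is the image of (shear by p / u, v), with
    v the common root. *)
Lemma kr_action_surj (s : algAut B) : exists w, kr_action w = s.
Proof.
have [u [r [p [u0 r0 ru [sx sz st]]]]] :=
  aut_form d1 l0 a21 a31 a2d (algAutK s) (algAutVK s).
have [|v [v0 vu vr]] := common_root (ltnW a21) a2_da3 u0 r0.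
  by rewrite ru mulnC.
pose w : G := SemiDirect _ (shear_kr d l a2 (u^-1 *: p)) (MkGm v0).
exists w; apply: (algAut_unique d1 l0 a21 a31 (kr_actionP w)).
have wE q : sd_aut w q = shear_fun d l a2 (u^-1 *: p) (torus (MkGm v0) q) by [].
apply: (extends_gen (f := sd_aut w)); rewrite wE.
- rewrite /= torus_fun_x linearZ /= shear_x linearZ /= kr_xzt_x sx.
  by rewrite exprM vu.
- by rewrite /= torus_fun_z linearZ /= shear_z linearZ /= kr_xzt_z sz vr.
rewrite /= torus_fun_t linearZ /= shear_t linearZ rmorphD /= kr_xzt_t kr_xzt_incl st vu.
by rewrite -scalerAr linearZ /= scalerDr scalerA mulfV // scale1r.
Qed.

Lemma kr_action_bij : bijective kr_action.
Proof.
pose h s := sval (cid (kr_action_surj s)).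
have hK : cancel h kr_action by move=> s; apply: (svalP (cid (kr_action_surj s))).
by exists h => // w; apply: kr_action_inj; rewrite hK.
Qed.

Lemma kr_action_torus (u : Gm C) : let s := kr_action (SemiDirect _ 1%g u) in
  [/\ s xB = Gm_val u ^+ (a2 * a3) *: xB,
      s yB = Gm_val u ^- ((d * l - 1) * a2 * a3) *: yB,
      s zB = Gm_val u ^+ (d * a3) *: zB & s tB = Gm_val u ^+ a2 *: tB].
Proof.
have [s' [s'u s'y]] := torus_extends d1 l0 a21 a31 u.
have -> : kr_action (SemiDirect _ 1%g u) = s'.
  apply: (algAut_unique d1 l0 a21 a31 (kr_actionP _)) => q.
  exact: s'u.
split=> //.
- by rewrite -{1}(kr_xzt_x C d l a2 a3) s'u /= torus_fun_x linearZ /= kr_xzt_x.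
- by rewrite -{1}(kr_xzt_z C d l a2 a3) s'u /= torus_fun_z linearZ /= kr_xzt_z.
- by rewrite -{1}(kr_xzt_t C d l a2 a3) s'u /= torus_fun_t linearZ /= kr_xzt_t.
Qed.

Lemma kr_A_coef_ex (f : kr_A_group C d l a2) :
  exists p, toAut f ut = ut + incl (F ^+ l * p).
Proof. exact: kr_A_t (valP f). Qed.

Definition kr_A_coef (f : kr_A_group C d l a2) : Algebra.to_multiplicative A :=
  sval (cid (kr_A_coef_ex f)).

Lemma kr_A_coefP f : toAut f ut = ut + incl (F ^+ l * kr_A_coef f).
Proof. exact: svalP (cid (kr_A_coef_ex f)). Qed.

Lemma shear_coef_inj : injective (fun p => ut + incl (F ^+ l * p)).
Proof.
move=> p q /addrI/(xz_incl_inj d l a3 a21)/mulfI; apply.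
by rewrite expf_neq0 ?curve_neq0.
Qed.

Lemma kr_A_coefM : {morph kr_A_coef : f g / (f * g)%g}.
Proof.
move=> f g; apply: shear_coef_inj; rewrite -kr_A_coefP.
transitivity (toAut f (toAut g ut)); first by [].
rewrite !kr_A_coefP rmorphD /= (kr_A_incl (valP f)) kr_A_coefP -addrA -rmorphD.
by rewrite -mulrDr.
Qed.

Lemma kr_A_coef_bij : bijective kr_A_coef.
Proof.
exists (shear_kr d l a2) => [f|p].
  apply: val_inj; apply: algAutP; apply: mpoly3_ext => /=.
  - by rewrite shear_x (kr_A_x (valP f)).
  - by rewrite shear_z (kr_A_z (valP f)).
  by rewrite shear_t kr_A_coefP.
apply: shear_coef_inj; rewrite -kr_A_coefP.
by rewrite /= shear_t.
Qed.

End Isomorphism.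

Unset Implicit Arguments.

Theorem mainTheorem1 (R : realType) (d l a2 a3 : nat)
    (hd : (2 <= d)%N) (hl : (1 <= l)%N)
    (ha2 : (2 <= a2)%N) (ha23 : (a2 <= a3)%N)
    (ha2d : gcdn a2 d = 1%N) (ha2a3 : gcdn a2 a3 = 1%N) :
  (exists Phi : {multiplicative semidirect (torus_act R[i] d l a2 a3) ->
                   algAut (kr_ring R[i] d l a2 a3)},
     bijective Phi /\
     forall u : Gm R[i],
       [/\ Phi (SemiDirect _ 1%g u) (kr_x R[i] d l a2 a3) =
             Gm_val u ^+ (a2 * a3) *: kr_x R[i] d l a2 a3,
           Phi (SemiDirect _ 1%g u) (kr_y R[i] d l a2 a3) =
             Gm_val u ^- ((d * l - 1) * a2 * a3) *: kr_y R[i] d l a2 a3,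
           Phi (SemiDirect _ 1%g u) (kr_z R[i] d l a2 a3) =
             Gm_val u ^+ (d * a3) *: kr_z R[i] d l a2 a3 &
           Phi (SemiDirect _ 1%g u) (kr_t R[i] d l a2 a3) =
             Gm_val u ^+ a2 *: kr_t R[i] d l a2 a3]) /\
  (exists Psi : {multiplicative kr_A_group R[i] d l a2 ->
                   Algebra.to_multiplicative {mpoly R[i][2]}},
     bijective Psi).
Proof.
have ha3 : (1 < a3)%N := leq_trans ha2 ha23.
have a2d : coprime a2 d by apply/eqP.
have a23 : coprime a2 a3 by apply/eqP.
split.
  pose phi := @kr_action R[i] d l a2 a3 hd hl ha2 ha3.
  pose phiM := isMultiplicative.Build _ _ phi (@kr_actionM R[i] d l a2 a3 hd hl ha2 ha3).
  pose Phi : {multiplicative semidirect (torus_act R[i] d l a2 a3) ->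
                algAut (kr_ring R[i] d l a2 a3)} := HB.pack phi phiM.
  exists Phi; split; first exact: kr_action_bij.
  by move=> u; apply: kr_action_torus.
pose psi := @kr_A_coef R[i] d l a2.
pose psiM := isMultiplicative.Build _ _ psi (@kr_A_coefM R[i] d l a2 a3 ha2).
pose Psi : {multiplicative kr_A_group R[i] d l a2 ->
              Algebra.to_multiplicative {mpoly R[i][2]}} := HB.pack psi psiM.
by exists Psi; apply: kr_A_coef_bij.
Qed.
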